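(* Suppose that (the assumption called G1) there exists $s_0\in\mathbb{R}$ such that $G(s_0)<0$, and that (the assumption called G2) there exist constants $C>0$, $p,q,p_*,s_*$ with $2<p_*<6$ and $2<p\le q$ such that $$|G'(s)|\le C(|s|^{p-1}+|s|^{q-1})\ \text{ for all } s\in\mathbb{R},\qquad -C|s|^{p_*-1}\le G'(s)\ \text{ for all } s\ge s_*.$$ Then there exists $\lambda_*\ge 0$ such that for every $\lambda>\lambda_*$ the functional $E$ attains its minimum on $S(\lambda)$, and the set $\mathcal{G}_\lambda$ is (orbitally) stable.
   Context: Let $f:\mathbb{C}\to\mathbb{C}$ be $C^1$ (in the real sense) with $f(\overline{s})=\overline{f(s)}$ and $f(zs)=zf(s)$ for all $s,z\in\mathbb{C}$ with $|z|=1$. Then $f$ maps $\mathbb{R}$ to $\mathbb{R}$; let $g=f|_{\mathbb{R}}$, let $G$ be the primitive of $g$ with $G(0)=0$, and set $F(s)=G(|s|)$ for $s\in\mathbb{C}$. On $H^1(\mathbb{R};\mathbb{C})$ put $$E(u)=\frac12\int_{\mathbb{R}}|u'(x)|^2dx+\int_{\mathbb{R}}F(u(x))\,dx,\qquad M(u)=\int_{\mathbb{R}}|u(x)|^2dx,$$ and for $\lambda>0$ let $S(\lambda)=\{u\in H^1(\mathbb{R};\mathbb{C}) : M(u)=\lambda\}$ and $\mathcal{G}_\lambda=\{u\in S(\lambda): E(u)=\inf_{S(\lambda)}E\}$. Consider the equation $i\partial_t\phi+\partial_{xx}\phi-f(\phi)=0$, $\phi:[0,\infty)\times\mathbb{R}\to\mathbb{C}$.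 It is a standing assumption that the initial value problem is globally well posed in $H^1(\mathbb{R};\mathbb{C})$: for each $u_0\in H^1(\mathbb{R};\mathbb{C})$ there is a unique solution $\phi\in C([0,\infty);H^1(\mathbb{R};\mathbb{C}))$ with $\phi(0,\cdot)=u_0$. Write $U_t(u_0)=\phi(t,\cdot)$. $H^1(\mathbb{R};\mathbb{C})$ carries the distance from the scalar product $\mathrm{Re}\int u\overline{w}\,dx+\mathrm{Re}\int u'\overline{w'}\,dx$. A set $S\subseteq H^1(\mathbb{R};\mathbb{C})$ is stable (orbitally stable) if for every $\varepsilon>0$ there is $\delta>0$ such that $\mathrm{dist}(u,S)<\delta$ implies $\mathrm{dist}(U_t(u),S)<\varepsilon$ for every $t\ge0$. *)

(* Defs.v *)
From HB Require Import structures.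
From mathcomp Require Import all_boot all_order all_algebra.
From mathcomp Require Import all_classical all_reals all_analysis.
From mathcomp Require Import complex.
Set Implicit Arguments.
Unset Strict Implicit.
Unset Printing Implicit Defensive.
Import Order.TTheory GRing.Theory Num.Theory.
Import numFieldNormedType.Exports.
Local Open Scope classical_set_scope.
Local Open Scope ring_scope.

(* The library norm on R[i] is R[i]-valued; this is the real-valued modulus. *)
Notation cabs := Normc.normc.

Section Functions.
Context {R : realType}.
Implicit Types (u v w : R -> R[i]) (f : R[i] -> R[i]).

Definition as_real_map f (p : R * R) : R * R :=
  let z := f (Complex p.1 p.2) in (complex.Re z, complex.Im z).

Definition C1_real f : Prop :=
  (forall p, differentiable (as_real_map f) p) /\
  (forall h : R * R, continuous (fun p => 'd (as_real_map f) p h)).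

Definition test_function (psi : R -> R) : Prop :=
  (forall (n : nat) (x : R), derivable (derive1n n psi) x 1) /\
  compact (closure [set x | psi x != 0]).

Definition cintegral u : R[i] :=
  Complex (\int[lebesgue_measure]_x complex.Re (u x))
          (\int[lebesgue_measure]_x complex.Im (u x)).

(* Elements of L^2 and H^1 are represented by functions; two functions that
   agree almost everywhere represent the same element. *)
Definition L2 : set (R -> R[i]) :=
  [set u | (fun x => complex.Re (u x)) \in Lfun lebesgue_measure 2%:E /\
           (fun x => complex.Im (u x)) \in Lfun lebesgue_measure 2%:E].

Definition is_weak_derivative u v : Prop :=
  forall psi, test_function psi ->
    cintegral (fun x => u x * Complex (derive1 psi x) 0) =
    - cintegral (fun x => v x * Complex (psi x) 0).

Definition H1 : set (R -> R[i]) :=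
  [set u | L2 u /\ exists v, L2 v /\ is_weak_derivative u v].

(* A chosen L^2 representative of u', meaningful for u in H^1. *)
Definition weak_derivative u : R -> R[i] :=
  xget (fun=> 0) [set v | L2 v /\ is_weak_derivative u v].

Definition L2_dot u w : R :=
  \int[lebesgue_measure]_x complex.Re (u x * conjc (w x)).

Definition H1_dot u w : R :=
  L2_dot u w + L2_dot (weak_derivative u) (weak_derivative w).

Definition H1_dist u w : R :=
  let d := fun x => u x - w x in Num.sqrt (H1_dot d d).

(* +oo when S is empty *)
Definition dist_to (S : set (R -> R[i])) u : \bar R :=
  ereal_inf [set (H1_dist u w)%:E | w in S].

Definition mass u : R := \int[lebesgue_measure]_x (cabs (u x) ^+ 2).

Definition energy (G : R -> R) u : R :=
  2^-1 * (\int[lebesgue_measure]_x (cabs (weak_derivative u x) ^+ 2)) +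
  \int[lebesgue_measure]_x G (cabs (u x)).

Definition mass_sphere (lambda : R) : set (R -> R[i]) :=
  [set u | H1 u /\ mass u = lambda].

(* The infimum is taken in \bar R, hence is -oo if E is unbounded below. *)
Definition ground_states (G : R -> R) (lambda : R) : set (R -> R[i]) :=
  [set u | mass_sphere lambda u /\
    (energy G u)%:E = ereal_inf [set (energy G v)%:E | v in mass_sphere lambda]].

Definition restr_real f (s : R) : R := complex.Re (f (Complex s 0)).

Definition is_primitive0 (G g : R -> R) : Prop :=
  G 0 = 0 /\ forall s : R, is_derive s 1 G (g s).

(* phi in C([0,oo); H^1) with phi(0) = u0 solving
   i phi_t + phi_xx - f(phi) = 0 in H^-1 at every time t > 0, where H^-1 is
   paired with H^1 through the real duality Re \int _ conj(w).
   Only the values of phi at nonnegative times matter. *)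
Definition is_solution f u0 (phi : R -> R -> R[i]) : Prop :=
  [/\ forall t : R, 0 <= t -> H1 (phi t),
      forall t : R, 0 <= t ->
        H1_dist (phi s) (phi t) @[s --> within [set s | 0 <= s] (nbhs t)]
          --> (0 : R),
      {ae lebesgue_measure, forall x : R, phi 0 x = u0 x} &
      forall (t : R) w, 0 < t -> H1 w ->
        is_derive t (1 : R)
          (fun s => L2_dot (fun x => Complex 0 1 * phi s x) w)
          (L2_dot (weak_derivative (phi t)) (weak_derivative w) +
           L2_dot (fun x => f (phi t x)) w)].

Definition globally_well_posed f : Prop :=
  forall u0, H1 u0 ->
    exists2 phi, is_solution f u0 phi &
      forall psi, is_solution f u0 psi -> forall t : R, 0 <= t ->
        {ae lebesgue_measure, forall x : R, psi t x = phi t x}.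

(* U_t(u0), meaningful when the equation is globally well posed. *)
Definition flow f (t : R) u0 : R -> R[i] :=
  xget (fun _ _ => 0) [set phi | is_solution f u0 phi] t.

Definition stable f (S : set (R -> R[i])) : Prop :=
  forall eps : R, 0 < eps -> exists2 delta : R, 0 < delta &
    forall u, H1 u -> (dist_to S u < delta%:E)%E ->
      forall t : R, 0 <= t -> (dist_to S (flow f t u) < eps%:E)%E.

End Functions.

(* Main.v *)
(* Spreading out a plateau of height s0 with G s0 < 0 makes the infimum m of E on
   S(lambda) negative as soon as lambda is large. The scaling u(c x) turns m < 0
   into strict subadditivity of the infimum in lambda, so an almost minimizer
   cannot be cut at a point where it is small into two pieces of substantial mass;
   vanishing is excluded by m < 0 too. Translated by the median of |u|^2, almost
   minimizers are therefore tight, hence precompact in L^2, and the lower bound m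
   for the energy of the midpoint of two of them controls the derivatives. Thus
   every almost minimizer is H^1-close to a ground state, and stability follows
   once mass and energy are conserved.

   The solution is differentiable in time only as an H^(-1)-valued map, so the
   energy cannot be differentiated directly. Instead, with
   P(u) = <f(u), u> - 2 int F(u), the time derivative of <i phi(t + h), phi(t)> is
   P(phi(t + h)) - P(phi(t)) up to O(|phi(t + h) - phi(t)|^2) = o(h), whereas the
   quotient of <i phi(t + h), phi(t)> by h tends to |phi_x|^2 + <f(phi), phi>.
   Letting h tend to 0, |phi_x|^2 + 2 int F(phi) is constant. *)
From HB Require Import structures.
Require Import Defs.
From mathcomp Require Import all_boot all_order all_algebra.
From mathcomp Require Import all_classical all_reals all_analysis.
From mathcomp Require Import measurable_realfun complex.
From mathcomp Require Import ring lra.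
Import Order.TTheory GRing.Theory Num.Theory.
Import numFieldNormedType.Exports.
Local Open Scope classical_set_scope.
Local Open Scope ring_scope.
Set Implicit Arguments.
Unset Strict Implicit.
Unset Printing Implicit Defensive.

Local Notation mu := lebesgue_measure.
Local Notation itg D f := (mu.-integrable D (EFin \o f)).
Local Notation L2r f := (f \in Lfun mu 2%:E).
Local Notation Re := complex.Re.
Local Notation Im := complex.Im.
(* The Lebesgue measure lives on [measurableTypeR R], whose measurable structure
   unification does not infer from [R] alone. *)
Local Notation msb D := (@measurable _ (measurableTypeR _) D).
Local Notation mfn D f := (@measurable_fun _ _ (measurableTypeR _) _ D f).

(** * Integration on the real line *)

(** Elements of H^1 are arbitrary representatives and [weak_derivative] is an arbitrary choice,
    whereas cutting at a point, gluing and sup bounds need point values. The variational part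
    therefore handles pairs [sobolev u v], where [u] is continuous and is the integral of [v];
    [H1_sobolev] and [H1_ae] translate. The growth of [G] is bounded above only by powers of
    arbitrary size, so potential energies are compared on sets bounded in H^1, where [sobolev_sup]
    and the local Lipschitz constants of [g] apply. The lower bound must be global, and there 6 is
    the critical exponent: by [sobolev_sup], |u|^4 is at most of the order of mass times kinetic
    energy, so a sextic term is of the order of mass^2 times kinetic energy and is absorbed once its
    coefficient is small. In time, the data are continuity with values in H^1 and the equation
    tested against one fixed function. What makes second order terms negligible is [flow_holder]:
    testing an increment against itself, which is small in H^1, gives |phi(t + h) - phi(t)|^2 = o(h)
    in L^2. *)

Lemma eq_ler {R : realType} (a b : R) : a = b -> a <= b. Proof. by move->. Qed.

Lemma MVT_all {R : realType} (F dF : R -> R) (a b : R) : a <= b ->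
  (forall x : R, is_derive x 1 F (dF x)) ->
  exists2 c : R, a <= c <= b & F b - F a = dF c * (b - a).
Proof.
move=> ab H; have := @MVT_segment R F dF a b ab (fun x _ => H x).
have h2 : {within `[a, b], continuous F}.
  by apply: derivable_within_continuous => x _; case: (H x).
by move=> /(_ h2)[c]; rewrite in_itv/= => cab E; exists c.
Qed.

Section RealIntegrals.
Context {R : realType}.
Implicit Types (f g h : R -> R) (D : set R).

Lemma near_dist (x e : R) : 0 < e -> \forall y \near x, `|x - y| < e.
Proof. by move=> e0; exact: nbhsx_ballx. Qed.

Lemma normr_le_sqr (a b : R) : 0 <= b -> a ^+ 2 <= b ^+ 2 -> `|a| <= b.
Proof.
by move=> b0 ab; rewrite -(@ler_pXn2r _ 2)// ?nnegrE// real_normK ?num_real.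
Qed.

Lemma normr_lt_sqr (a b : R) : 0 < b -> a ^+ 2 < b ^+ 2 -> `|a| < b.
Proof.
move=> b0 ab; rewrite -(@ltr_pXn2r _ 2)// ?nnegrE ?(ltW b0)//.
by rewrite real_normK ?num_real.
Qed.

(** Writing the remainder without a quotient includes the increment [h = 0] and lets derivatives be
    shifted, reflected and combined by plain estimates. *)
Lemma is_deriveP (f : R -> R) (x l : R) : is_derive x 1 f l <->
  forall e : R, 0 < e -> exists2 d : R, 0 < d & forall h : R, `|h| < d ->
    `|f (x + h) - f x - h * l| <= e * `|h|.
Proof.
split=> [[df <-] e e0|H].
  have := df; rewrite /derivable => /cvg_ex[l' dl].
  have -> : 'D_1 f x = l' by apply/cvg_lim.
  move/cvgrPdist_le : dl => /(_ _ e0).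
  rewrite near_withinE => /nbhs_ballP[d /= d0 hd].
  exists d => // h hhd; have [->|h0] := eqVneq h 0.
    by rewrite addr0 subrr mul0r subr0 normr0 mulr0.
  have := hd h; rewrite /ball/= sub0r normrN => /(_ hhd h0).
  rewrite /GRing.scale/= mulr1 [h + x]addrC => H.
  have -> : f (x + h) - f x - h * l' = - (h * (l' - h^-1 * (f (x + h) - f x))).
    by field.
  by rewrite normrN normrM mulrC ler_wpM2r.
suff H' : h^-1 *: ((f \o shift x) (h *: 1) - f x) @[h --> 0^'] --> l.
  by apply: DeriveDef; [apply/cvg_ex; exists l|exact/cvg_lim].
apply/cvgrPdist_le => e e0; have [d d0 hd] := H _ e0.
rewrite near_withinE; apply/nbhs_ballP; exists d => //= h.
rewrite /ball/= sub0r normrN => hhd h0.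
have := hd _ hhd; rewrite /GRing.scale/= mulr1 [h + x]addrC => H'.
have -> : l - h^-1 * (f (x + h) - f x) = - (h^-1 * (f (x + h) - f x - h * l)).
  by field.
by rewrite normrN normrM normfV mulrC ler_pdivrMr ?normr_gt0.
Qed.

Lemma itgD D f g : msb D -> itg D f -> itg D g ->
  itg D (fun x => f x + g x).
Proof. by move=> mD hf hg; have := integrableD mD hf hg. Qed.

Lemma itgZ D c f : msb D -> itg D f -> itg D (fun x => c * f x).
Proof. by move=> mD hf; have := integrableZl mD c hf. Qed.

Lemma itgB D f g : msb D -> itg D f -> itg D g ->
  itg D (fun x => f x - g x).
Proof. by move=> mD hf hg; have := integrableB mD hf hg. Qed.

Lemma itg_measurable D f : itg D f -> mfn D f.
Proof. by move/measurable_int/measurable_EFinP. Qed.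

Lemma itg_le D f g : msb D -> mfn D f -> itg D g ->
  (forall x, D x -> `|f x| <= g x) -> itg D f.
Proof.
move=> mD mf ig fg; apply: (le_integrable mD) ig.
  exact/measurable_EFinP.
move=> x Dx /=; rewrite lee_fin (le_trans (fg _ Dx))//.
by rewrite ger0_norm// (le_trans _ (fg _ Dx)).
Qed.

Lemma itg_sub D f : msb D -> itg setT f -> itg D f.
Proof. by move=> mD hf; apply: (integrableS measurableT mD _ hf). Qed.

Lemma itg_norm D f : msb D -> itg D f -> itg D (fun x => `|f x|).
Proof. move=> mD; exact: integrable_norm. Qed.

Lemma L2rP f : L2r f <-> mfn setT f /\ itg setT (fun x => f x ^+ 2).
Proof.
split=> [hf|[mf hf]].
  split; last exact: Lfun2_integrable_sqr.
  by have := sub_Lfun_mfun hf; rewrite inE.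
rewrite inE; apply/andP; split; rewrite inE//=/finite_norm unlock/=.
rewrite poweR_lty//.
move/integrableP : hf => [_]; apply: le_lt_trans.
rewrite le_eqVlt; apply/orP; left; apply/eqP; apply: eq_integral => x _ /=.
by rewrite powR_mulrn// normrX.
Qed.

Lemma L2r_meas f : L2r f -> mfn setT f.
Proof. by case/L2rP. Qed.

Lemma L2r_sq f : L2r f -> itg setT (fun x => f x ^+ 2).
Proof. by case/L2rP. Qed.

Lemma L2r_le f g : mfn setT f -> L2r g ->
  (forall x, `|f x| <= `|g x|) -> L2r f.
Proof.
move=> mf /L2rP[mg ig] fg; apply/L2rP; split=> //.
apply: (itg_le measurableT _ ig); first exact: measurable_funX.
by move=> x _; rewrite normrX -(real_normK (num_real (g x))) lerXn2r ?nnegrE.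
Qed.

Lemma L2rM f g : L2r f -> L2r g -> itg setT (fun x => f x * g x).
Proof. by move=> hf hg; apply/Lfun1_integrable; exact: Lfun2_mul_Lfun1. Qed.

Lemma L2rD f g : L2r f -> L2r g -> L2r (fun x => f x + g x).
Proof.
move=> hf hg; have [mf iff] := (L2rP f).1 hf; have [mg ig] := (L2rP g).1 hg.
apply/L2rP; split; first exact: measurable_funD.
rewrite (_ : (fun x => _) =
  (fun x => (f x ^+ 2 + 2 * (f x * g x)) + g x ^+ 2)); last first.
  by apply/funext => x; ring.
apply: itgD => //; apply: itgD => //; apply: itgZ => //; exact: L2rM.
Qed.

Lemma L2rZ c f : L2r f -> L2r (fun x => c * f x).
Proof.
move=> hf; have [mf iff] := (L2rP f).1 hf.
apply/L2rP; split; first exact: measurable_funM.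
rewrite (_ : (fun x => _) = (fun x => c ^+ 2 * f x ^+ 2)); last first.
  by apply/funext => x; ring.
exact: itgZ.
Qed.

Lemma L2rN f : L2r f -> L2r (fun x => - f x).
Proof.
by move=> hf; rewrite (_ : (fun _ => _) = (fun x => -1 * f x));
  [exact: L2rZ|apply/funext => x; ring].
Qed.

Lemma L2rB f g : L2r f -> L2r g -> L2r (fun x => f x - g x).
Proof. by move=> hf hg; apply: L2rD => //; exact: L2rN. Qed.

Lemma L2r0 : L2r (fun _ : R => 0 : R).
Proof.
apply/L2rP; split=> //.
rewrite (_ : EFin \o _ = cst 0%E); first exact: integrable0.
by apply/funext => x /=; rewrite expr0n.
Qed.

(* The nonnegative quadratic polynomial in t has nonpositive discriminant. *)
Lemma Rintegral_cauchy_schwarz D f g : msb D ->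
  itg D (fun x => f x ^+ 2) -> itg D (fun x => g x ^+ 2) ->
  itg D (fun x => f x * g x) ->
  (\int[mu]_(x in D) (f x * g x)) ^+ 2 <=
  (\int[mu]_(x in D) (f x ^+ 2)) * (\int[mu]_(x in D) (g x ^+ 2)).
Proof.
move=> mD hf hg hfg.
set a := \int[mu]_(x in D) (f x ^+ 2); set b := \int[mu]_(x in D) (g x ^+ 2).
set c := \int[mu]_(x in D) (f x * g x).
have key (s t : R) : 0 <= s ^+ 2 * a + 2 * s * t * c + t ^+ 2 * b.
  rewrite -!RintegralZl// -RintegralD//; try exact: itgZ.
  rewrite -RintegralD//; try exact: itgZ; last by apply: itgD => //; exact: itgZ.
  apply: Rintegral_ge0 => x _.
  rewrite (_ : _ + _ = (s * f x + t * g x) ^+ 2); last by ring.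
  exact: sqr_ge0.
have a0 : 0 <= a by apply: Rintegral_ge0 => x _; exact: sqr_ge0.
have b0 : 0 <= b by apply: Rintegral_ge0 => x _; exact: sqr_ge0.
have [az|an] := eqVneq a 0.
  have [->|cn] := eqVneq c 0; first by rewrite expr0n mulr_ge0.
  have := key (- (b + 1) / (2 * c)) 1; rewrite az => h.
  exfalso; have : 2 * (- (b + 1) / (2 * c)) * 1 * c = - (b + 1).
    by field; rewrite cn.
  by move: h; rewrite mulr0 expr1n => h h'; lra.
have := key (- c) a; rewrite (_ : _ + _ = a * (a * b - c ^+ 2)); last by ring.
by rewrite pmulr_rge0 ?lt_def ?an// subr_ge0.
Qed.

Lemma aeS (P Q : R -> Prop) : (forall x, P x -> Q x) ->
  {ae mu, forall x, P x} -> {ae mu, forall x, Q x}.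
Proof. by move=> PQ; apply: filterS => //; exact: (ae_filter_ringOfSetsType mu). Qed.

Lemma aeI (P Q : R -> Prop) : {ae mu, forall x, P x} ->
  {ae mu, forall x, Q x} -> {ae mu, forall x, P x /\ Q x}.
Proof. by move=> hP hQ; apply: filterI => //; exact: (ae_filter_ringOfSetsType mu). Qed.

Lemma aeT (P : R -> Prop) : (forall x, P x) -> {ae mu, forall x, P x}.
Proof. by move=> hP; apply: nearW. Qed.

Lemma ae_eq_Rintegral f g : mfn setT f -> mfn setT g ->
  {ae mu, forall x, f x = g x} -> \int[mu]_x f x = \int[mu]_x g x.
Proof.
move=> mf mg fg; congr fine; apply: ae_eq_integral => //.
- exact/measurable_EFinP.
- exact/measurable_EFinP.
- by apply: aeS fg => x /= ->.
Qed.

Lemma Rintegral_split f (a : R) : itg setT f ->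
  \int[mu]_x f x = \int[mu]_(x in `]-oo, a]) f x + \int[mu]_(x in `]a, +oo[) f x.
Proof.
move=> hf; rewrite -Rintegral_setU//=.
- congr (Rintegral mu _ _); apply/seteqP; split => x //= _.
  by rewrite !in_itv /= andbT; have [|] := leP x a; [left|right].
- apply: itg_sub hf; exact: measurableU.
- by apply: lt_disjoint => x y; rewrite !in_itv/= andbT => /le_lt_trans; apply.
Qed.

Lemma Rintegral_itv_split f (a b c : R) : a <= b -> b <= c ->
  itg `[a, c] f ->
  \int[mu]_(x in `[a, c]) f x =
  \int[mu]_(x in `[a, b]) f x + \int[mu]_(x in `[b, c]) f x.
Proof.
move=> ab bc hf.
have := @Rintegral_itvB R f (BLeft a) (BRight c) b hf.
rewrite !bnd_simp => /(_ ab bc).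
rewrite Rintegral_itv_obnd_cbnd; first by move=> <-; rewrite addrC subrK.
apply: integrableS hf => // x /=; rewrite !in_itv/= => /andP[bx xc].
by rewrite xc (le_trans ab (ltW bx)).
Qed.

End RealIntegrals.

(** * Primitives of square integrable functions and integration by parts *)

Section AbsolutelyContinuous.
Context {R : realType}.
Implicit Types (f g h : R -> R) (D : set R).

Lemma msb_itv (i : interval R) : msb ([set` i] : set R).
Proof. have h : measurable [set` i] by []; exact: h. Qed.

Lemma itg_cst_itv (c x y : R) : itg `[x, y] (fun=> c).
Proof.
apply: measurable_bounded_integrable => //=.
  by rewrite lebesgue_measure_itv; case: ifP => //= _; rewrite -EFinD ltry.
exact: bounded_cst.
Qed.

Lemma itg_L2r_itv f (x y : R) : L2r f -> itg `[x, y] f.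
Proof.
move=> hf; have [mf sf] := (L2rP f).1 hf.
have mI : msb (`[x, y]%classic : set R) by exact: msb_itv.
apply: (itg_le mI (measurable_funTS mf) (g := fun t => 1 + f t ^+ 2)).
  by apply: itgD => //; [exact: itg_cst_itv|exact: itg_sub].
move=> t _; rewrite -(real_normK (num_real (f t))).
by have := sqr_ge0 (`|f t| - 1); have := normr_ge0 (f t); nra.
Qed.

Lemma Rintegral_cst_itv (c x y : R) : x <= y ->
  \int[mu]_(t in `[x, y]) c = c * (y - x).
Proof.
move=> xy; rewrite Rintegral_cst; last exact: msb_itv.
rewrite /= lebesgue_measure_itv /= lte_fin.
by case: ltgtP xy => //= -> _; rewrite subrr.
Qed.

Lemma itg_restrict f D : msb D -> itg D f -> itg setT (f \_ D).
Proof.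
by move=> mD hf; have := (@integrable_mkcond _ (measurableTypeR R) _ mu D (EFin \o f) mD).1 hf;
  rewrite restrict_EFin.
Qed.

Lemma Rintegral_le_setT f D : msb D -> itg setT f -> (forall x, 0 <= f x) ->
  \int[mu]_(x in D) f x <= \int[mu]_x f x.
Proof.
move=> mD hf f0.
rewrite [leLHS]Rintegral_mkcond; apply: le_Rintegral => //.
  apply: itg_restrict => //; exact: itg_sub.
by move=> x _; rewrite patchE; case: ifP.
Qed.

Lemma Rintegral_itv_sqr_le f (x y : R) : x <= y -> L2r f ->
  (\int[mu]_(t in `[x, y]) f t) ^+ 2 <= (y - x) * \int[mu]_t (f t ^+ 2).
Proof.
move=> xy hf; have mI : msb (`[x, y]%classic : set R) by exact: msb_itv.
have sf := L2r_sq hf.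
have := @Rintegral_cauchy_schwarz R `[x, y] (fun=> 1) f mI.
rewrite expr1n Rintegral_cst_itv// mul1r.
under eq_Rintegral do rewrite mul1r.
move=> /(_ (itg_cst_itv _ _ _) (itg_sub mI sf)) h.
apply: le_trans (h _) _.
  rewrite (_ : (fun t => 1 * f t) = f); first exact: itg_L2r_itv.
  by apply/funext => t; rewrite mul1r.
apply: ler_wpM2l; first by rewrite subr_ge0.
by apply: Rintegral_le_setT => // t; exact: sqr_ge0.
Qed.

(** The continuous representative [f] of a real H^1 function with one representative [g] of its
    derivative. Asking for the fundamental theorem of calculus on every interval gives [f]
    meaningful point values. *)
Definition ac2 f g := [/\ L2r f, L2r g &
  forall x y : R, x <= y -> f y - f x = \int[mu]_(t in `[x, y]) g t].

Lemma primitive_holder f g (x y : R) : L2r g ->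
  (forall x y : R, x <= y -> f y - f x = \int[mu]_(t in `[x, y]) g t) ->
  (f y - f x) ^+ 2 <= `|y - x| * \int[mu]_t (g t ^+ 2).
Proof.
move=> hg fg; wlog xy : x y / x <= y.
  move=> H; have [/H//|/ltW/H] := leP x y.
  by rewrite distrC -[f x - f y]opprB sqrrN.
by rewrite fg// ger0_norm ?subr_ge0//; exact: Rintegral_itv_sqr_le.
Qed.

(** Square integrability is asked of [g] alone, since this also serves for primitives where that of
    [f] is still to be shown, as in [wder_ac2], or false, as for the cumulative mass in [median]. *)
Lemma primitive_continuous f g : L2r g ->
  (forall x y : R, x <= y -> f y - f x = \int[mu]_(t in `[x, y]) g t) ->
  continuous f.
Proof.
move=> hg fg x; apply/cvgrPdist_lt => e e0.
set K := \int[mu]_t (g t ^+ 2).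
have K0 : 0 <= K by apply: Rintegral_ge0 => t _; exact: sqr_ge0.
have K1 : 0 < K + 1 by rewrite ltr_wpDl.
have d0 : 0 < e ^+ 2 / (K + 1) by rewrite divr_gt0 ?exprn_gt0.
near=> y.
have xy : `|x - y| < e ^+ 2 / (K + 1) by near: y; exact: near_dist.
apply: normr_lt_sqr => //.
apply: le_lt_trans (primitive_holder y x hg fg) _; rewrite -/K.
apply: (@le_lt_trans _ _ (`|x - y| * (K + 1))); first by rewrite ler_wpM2l// lerDl.
by rewrite -ltr_pdivlMr.
Unshelve. all: by end_near. Qed.

Lemma ac2_holder f g (x y : R) : ac2 f g ->
  (f y - f x) ^+ 2 <= `|y - x| * \int[mu]_t (g t ^+ 2).
Proof. by move=> [_ hg fg]; exact: primitive_holder. Qed.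

Lemma ac2_continuous f g : ac2 f g -> continuous f.
Proof. by move=> [_ hg fg]; exact: (primitive_continuous hg). Qed.

(* Telescoping over a subdivision whose mesh tends to 0. *)
Lemma additive_small_eq0 (E L : R -> R -> R) (s t : R) : s <= t ->
  (forall x y z, s <= x -> x <= y -> y <= z -> z <= t ->
     E x z = E x y + E y z /\ L x z = L x y + L y z) ->
  (forall e : R, 0 < e -> exists2 r : R, 0 < r &
     forall x y, s <= x -> x <= y -> y <= t -> y - x <= r ->
       `|E x y| <= e * L x y) ->
  E s t = 0.
Proof.
move=> st add small; apply/eqP; rewrite -normr_le0.
have key e : 0 < e -> `|E s t| <= e * L s t.
  move=> e0; have [r r0 sm] := small _ e0.
  pose N := (Num.truncn ((t - s) / r)).+1.
  have N0 : 0 < (N%:R : R) by rewrite ltr0n.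
  pose h := (t - s) / N%:R.
  have h0 : 0 <= h by rewrite divr_ge0 ?subr_ge0// ltW.
  have hr : h <= r.
    rewrite ler_pdivrMr// mulrC -ler_pdivrMr//.
    exact/ltW/Num.Theory.truncnS_gt.
  have hN : s + N%:R * h = t.
    by rewrite /h mulrC -mulrA mulVf ?gt_eqF// mulr1 addrC subrK.
  have le_n n : (n <= N)%N -> s + n%:R * h <= t.
    by move=> nN; rewrite -hN lerD2l ler_wpM2r// ler_nat.
  have ind n : (n <= N)%N -> `|E s (s + n%:R * h)| <= e * L s (s + n%:R * h).
    elim: n => [|n IH] nN.
      by rewrite mul0r addr0; apply: sm => //; rewrite subrr ltW.
    have s1 : s + n.+1%:R * h = s + n%:R * h + h.
      by rewrite -natr1 mulrDl mul1r addrA.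
    have s2 : s <= s + n%:R * h by rewrite lerDl mulr_ge0.
    have s3 : s + n%:R * h <= s + n.+1%:R * h by rewrite s1 lerDl.
    have [-> ->] := add s _ _ (lexx s) s2 s3 (le_n _ nN).
    apply: le_trans (ler_normD _ _) _; rewrite mulrDr lerD ?IH// 1?ltnW//.
    apply: sm => //; first exact: le_n.
    by rewrite s1 addrC addKr.
  by have := ind N (leqnn _); rewrite hN.
(* The sign of [L] is not among the hypotheses; [key] at 1 provides it. *)
have L0 : 0 <= L s t by have := key 1 ltr01; rewrite mul1r; apply: le_trans.
apply/ler_addgt0Pr => z z0; rewrite add0r; apply: le_trans (key (z / (L s t + 1)) _) _.
  by rewrite divr_gt0// ltr_wpDl.
by rewrite mulrAC ler_pdivrMr ?ltr_wpDl// ler_wpM2l ?lerDl// ltW.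
Qed.

Lemma Rintegral_derive f g (x y : R) : x <= y -> continuous g ->
  (forall t : R, is_derive t 1 f (g t)) ->
  \int[mu]_(t in `[x, y]) g t = f y - f x.
Proof.
rewrite le_eqVlt => /predU1P[<- _ _|xy cg fg].
  by rewrite set_itv1 Rintegral_set1 subrr.
rewrite /Rintegral (@continuous_FTC2 _ g f)//.
- by apply: continuous_subspaceT.
- have cf t : {for t, continuous f}.
    by apply/differentiable_continuous/derivable1_diffP; case: (fg t).
  split.
  + by move=> t _; case: (fg t).
  + by apply: cvg_at_right_filter; exact: cf.
  + by apply: cvg_at_left_filter; exact: cf.
- by move=> t _; rewrite derive1E; apply: derive_val.
Qed.

Lemma itg_continuous f (x y : R) : continuous f -> itg `[x, y] f.
Proof.
move=> cf; apply: continuous_compact_integrable; first exact: segment_compact.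
exact: continuous_subspaceT.
Qed.

Lemma continuous_bounded_itv f (x y : R) : continuous f ->
  exists2 B : R, 0 < B & forall t, x <= t -> t <= y -> `|f t| <= B.
Proof.
move=> cf; have [xy|yx] := leP x y; last first.
  by exists 1 => // t xt ty; move: (le_trans xt ty); rewrite leNgt yx.
have c1 : {within `[x, y], continuous (fun t => `|f t|)}.
  by apply: continuous_subspaceT => t; apply: continuous_comp;
    [exact: cf|exact: norm_continuous].
have [c _ hc] := EVT_max xy c1.
exists (`|f c| + 1); first by rewrite ltr_wpDl.
move=> t xt ty; apply: le_trans (hc t _) _; first by rewrite in_itv/= xt.
by rewrite lerDl.
Qed.

Lemma Rintegral_supp_itv f (s t : R) : (forall x, x < s \/ t < x -> f x = 0) ->
  \int[mu]_x f x = \int[mu]_(x in `[s, t]) f x.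
Proof.
move=> f0; rewrite [RHS]Rintegral_mkcond; apply: eq_Rintegral => x _.
rewrite patchE; case: ifPn => // /negP xA; apply: f0.
have [|sx] := ltP x s; first by left.
have [|xt] := ltP t x; first by right.
by exfalso; apply: xA; rewrite inE/= in_itv/= sx.
Qed.

Lemma Rintegral_supp f (A : R) : (forall x, A < `|x| -> f x = 0) ->
  \int[mu]_x f x = \int[mu]_(x in `[- A, A]) f x.
Proof.
move=> f0; apply: Rintegral_supp_itv => x xA; apply: f0.
by rewrite lter_normr; case: xA => h; rewrite ?h ?orbT// ltrNr h orbT.
Qed.

(** [g] is the derivative of [f] only in the integrated sense, so the product rule has no pointwise
    form to integrate. Its integrated defect [E] is additive over intervals, and on a short interval
    it is at most a small multiple of the integral of |g| + |chi|; [additive_small_eq0] then makes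
    it vanish. *)
Lemma ac2_by_parts f g (psi chi : R -> R) (A : R) : ac2 f g -> 0 <= A ->
  continuous chi -> (forall t : R, is_derive t 1 psi (chi t)) ->
  (forall x, A <= `|x| -> psi x = 0) -> (forall x, A < `|x| -> chi x = 0) ->
  \int[mu]_x (f x * chi x) = - \int[mu]_x (g x * psi x).
Proof.
move=> fg A0 cchi dpsi psi0 chi0.
have [hf hg fgE] := fg.
have cf := ac2_continuous fg.
have cpsi : continuous psi.
  move=> t; apply/differentiable_continuous/derivable1_diffP.
  by case: (dpsi t).
rewrite (@Rintegral_supp _ A); last by move=> x xA; rewrite chi0 ?mulr0.
rewrite (@Rintegral_supp (fun x => g x * psi x) A); last first.
  by move=> x /ltW xA; rewrite psi0 ?mulr0.
have mI (x y : R) : msb (`[x, y]%classic : set R) by exact: msb_itv.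
have ifchi (x y : R) : itg `[x, y] (fun t => f t * chi t).
  by apply: itg_continuous => t; apply: continuousM; [exact: cf|exact: cchi].
have ig (x y : R) : itg `[x, y] g by exact: itg_L2r_itv.
have mg : mfn setT g by exact: L2r_meas.
have mpsi : mfn setT psi by exact: continuous_measurable_fun.
have igpsi (x y : R) : itg `[x, y] (fun t => g t * psi t).
  have [B B0 hB] := @continuous_bounded_itv psi x y cpsi.
  apply: (itg_le _ _ (g := fun t => B * `|g t|)) => //.
  - by apply: measurable_funTS; exact: measurable_funM.
  - by apply: itgZ => //; exact: itg_norm.
  - move=> t /=; rewrite in_itv/= => /andP[xt ty].
    by rewrite normrM mulrC ler_wpM2r// hB.
pose p t := f t * chi t + g t * psi t.
have ip (x y : R) : itg `[x, y] p by apply: itgD.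
suff : f A * psi A - f (- A) * psi (- A) - \int[mu]_(t in `[- A, A]) p t = 0.
  rewrite !psi0 ?normrN ?ger0_norm// !mulr0 subrr sub0r => /eqP.
  by rewrite oppr_eq0 RintegralD// addr_eq0 => /eqP.
pose E x y := f y * psi y - f x * psi x - \int[mu]_(t in `[x, y]) p t.
pose L x y := \int[mu]_(t in `[x, y]) (`|g t| + `|chi t|).
have iL (x y : R) : itg `[x, y] (fun t => `|g t| + `|chi t|).
  apply: itgD => //; first exact: itg_norm.
  by apply: itg_norm => //; exact: itg_continuous.
have NA : - A <= A by rewrite ge0_cp.
apply: (@additive_small_eq0 E L (- A) A) => //.
  move=> x y z _ xy yz _; split; last by rewrite /L (@Rintegral_itv_split R _ x y).
  by rewrite /E (@Rintegral_itv_split R _ x y)//; ring.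
move=> e e0.
have [B B0 hB] := @continuous_bounded_itv chi (- A) A cchi.
set K := \int[mu]_t (g t ^+ 2).
have K0 : 0 <= K by apply: Rintegral_ge0 => t _; exact: sqr_ge0.
(* On an interval of length at most [r], [psi] oscillates by at most [e] because its derivative is
   bounded by [B], and [f] by at most [e] because of its Holder bound with constant [K]. *)
pose r := Num.min (e / B) (e ^+ 2 / (K + 1)).
have K1 : 0 < K + 1 by rewrite ltr_wpDl.
exists r; first by rewrite lt_min !divr_gt0// exprn_gt0.
move=> x y Ax xy yA xyr.
have xyB : (y - x) * B <= e.
  by rewrite -ler_pdivlMr// (le_trans xyr)// ge_min lexx.
have xyK : (y - x) * K <= e ^+ 2.
  apply: (@le_trans _ _ ((y - x) * (K + 1))).
    by rewrite ler_wpM2l ?subr_ge0// lerDl.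
  by rewrite -ler_pdivlMr// (le_trans xyr)// ge_min lexx orbT.
have Dpsi s t : - A <= s -> s <= t -> t <= A -> `|psi t - psi s| <= (t - s) * B.
  move=> As sst tA; rewrite -(@Rintegral_derive psi chi)//.
  apply: le_trans (le_normr_Rintegral _ _) _ => //; first exact: itg_continuous.
  rewrite mulrC -Rintegral_cst_itv//; apply: le_Rintegral => //.
  - by apply: itg_norm => //; exact: itg_continuous.
  - exact: itg_cst_itv.
  - move=> z /=; rewrite in_itv/= => /andP[sz zt].
    by rewrite hB ?(le_trans As)// (le_trans zt).
(* The increments of [f] and [psi] are the integrals of [g] and [chi]; freezing [psi] at the right
   end and [f] at the left end turns the defect into an integral of small differences. *)
have EE : E x y = \int[mu]_(t in `[x, y])
    (g t * (psi y - psi t) + chi t * (f x - f t)).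
  have -> : (fun t => g t * (psi y - psi t) + chi t * (f x - f t)) =
      (fun t => (psi y * g t + f x * chi t) - p t).
    by apply/funext => t; rewrite /p; ring.
  rewrite RintegralB//; last first.
    by apply: itgD => //; apply: itgZ => //; exact: itg_continuous.
  rewrite RintegralD//; last 2 first.
  - exact: itgZ.
  - by apply: itgZ => //; exact: itg_continuous.
  rewrite !RintegralZl//; last exact: itg_continuous.
  by rewrite -fgE// (@Rintegral_derive psi chi)// /E; ring.
rewrite EE; apply: le_trans (le_normr_Rintegral _ _) _ => //.
  have -> : (fun t => g t * (psi y - psi t) + chi t * (f x - f t)) =
      (fun t => (psi y * g t + f x * chi t) - p t).
    by apply/funext => t; rewrite /p; ring.
  apply: itgB => //.
  by apply: itgD => //; apply: itgZ => //; exact: itg_continuous.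
rewrite /L -RintegralZl//; apply: le_Rintegral => //.
- apply: itg_norm => //.
  have -> : (fun t => g t * (psi y - psi t) + chi t * (f x - f t)) =
      (fun t => (psi y * g t + f x * chi t) - p t).
    by apply/funext => t; rewrite /p; ring.
  apply: itgB => //.
  by apply: itgD => //; apply: itgZ => //; exact: itg_continuous.
- exact: itgZ.
move=> t /=; rewrite in_itv/= => /andP[xt ty].
apply: le_trans (ler_normD _ _) _; rewrite [leRHS]mulrDr !normrM lerD//.
  rewrite mulrC ler_wpM2r//; apply: le_trans (Dpsi _ _ _ ty yA) _.
    exact: le_trans xt.
  by apply: le_trans xyB; rewrite ler_pM2r// lerB.
rewrite mulrC ler_wpM2r//; apply: normr_le_sqr; first exact: ltW.
apply: le_trans (ac2_holder _ _ fg) _.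
apply: le_trans xyK; rewrite ler_wpM2r// distrC ger0_norm ?subr_ge0//.
by rewrite lerB.
Qed.

End AbsolutelyContinuous.

(** * Smooth cut-off functions *)

Section SmoothStep.
Context {R : realType}.
Implicit Types (f g h : R -> R).

(** The functions x^(-k) exp(-1/x) extended by 0. All derivatives of [flat 0] lie in their span, so
    one differentiation formula covers every order. *)
Definition flat (k : nat) (x : R) : R :=
  if 0 < x then x^-1 ^+ k * expR (- x^-1) else 0.

Lemma flat_le0 k x : x <= 0 -> flat k x = 0.
Proof. by rewrite /flat leNgt => /negbTE ->. Qed.

Lemma flat_ge0 k x : 0 <= flat k x.
Proof.
rewrite /flat; case: ifP => // x0.
by rewrite mulr_ge0 ?expR_ge0// exprn_ge0// invr_ge0 ltW.
Qed.

Lemma flat0_gt0 x : 0 < x -> 0 < flat 0 x.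
Proof. by move=> x0; rewrite /flat x0 expr0 mul1r expR_gt0. Qed.

(** A quadratic bound makes every [flat k] differentiable at 0 with derivative 0. It comes from
    exp(y) >= (y / n)^n with y = 1 / x and n = k + 2. *)
Lemma flat_le_sqr k x : flat k x <= (k.+2%:R ^+ k.+2) * x ^+ 2.
Proof.
have [x0|x0] := leP x 0.
  by rewrite flat_le0// mulr_ge0 ?sqr_ge0// exprn_ge0.
set n := k.+2; rewrite /flat x0; set y := x^-1.
have y0 : 0 < y by rewrite invr_gt0.
have n0 : 0 < (n%:R : R) by rewrite ltr0n.
have h1 : (y / n%:R) ^+ n <= expR y.
  have -> : expR y = expR (y / n%:R) ^+ n.
    by rewrite -expRM_natl mulrC divfK// gt_eqF.
  rewrite lerXn2r ?nnegrE ?expR_ge0 ?divr_ge0 ?ltW//.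
  by apply: lt_le_trans (expR_ge1Dx _); rewrite ltrDr.
have h2 : y ^+ n * expR (- y) <= n%:R ^+ n.
  rewrite expRN ler_pdivrMr ?expR_gt0//.
  rewrite mulrC -ler_pdivrMr ?exprn_gt0// -expr_div_n//.
have -> : y ^+ k * expR (- y) = y ^+ n * expR (- y) * x ^+ 2.
  rewrite /n (_ : k.+2 = (k + 2)%N); last by rewrite addn2.
  have yx : y * x = 1 by rewrite mulVf// gt_eqF.
  rewrite exprD -[LHS]mulr1 -[X in _ * X](expr1n _ 2) -yx; ring.
by rewrite ler_wpM2r// sqr_ge0.
Qed.

Lemma is_derive_flat k (x : R) :
  is_derive x 1 (flat k) (flat k.+2 x - k%:R * flat k.+1 x).
Proof.
have [x0|x0|->] := ltgtP x 0.
- rewrite !flat_le0 ?ltW// mulr0 subrr.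
  apply: (@near_eq_is_derive _ _ _ (cst 0)) => //.
  near=> y; rewrite flat_le0//.
  have : `|x - y| < - x by near: y; apply: near_dist; rewrite oppr_gt0.
  by rewrite ltr_norml => /andP[h1 h2]; lra.
- pose F := fun t : R => t^-1 ^+ k * expR (- t^-1).
  have xn : x != 0 by rewrite gt_eqF.
  have dF : is_derive x 1 F (flat k.+2 x - k%:R * flat k.+1 x).
    have dV : is_derive x 1 (fun t : R => t^-1) (- x ^- 2 *: 1).
      exact: is_deriveV.
    rewrite /F.
    have d1 : is_derive x 1 (fun t : R => t^-1 ^+ k)
        ((k%:R * x^-1 ^+ k.-1) *: (- x ^- 2 *: 1)).
      rewrite (_ : (fun t : R => t^-1 ^+ k) = (fun t : R => t^-1) ^+ k).
        exact: is_deriveX.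
      by apply/funext => t; rewrite exprfctE.
    have d2 : is_derive x 1 (fun t : R => expR (- t^-1))
        ((- (- x ^- 2 *: 1)) * expR (- x^-1)).
      have := @is_derive1_comp R expR (fun t : R => - t^-1) x
        (expR (- x^-1)) (- (- x ^- 2 *: 1)).
      rewrite mulrC; exact.
    have := @is_deriveM _ _ (fun t : R => t^-1 ^+ k)
      (fun t : R => expR (- t^-1)) x 1 _ _ d1 d2.
    set df := (X in is_derive _ _ _ X -> _).
    suff -> : flat k.+2 x - k%:R * flat k.+1 x = df by [].
    rewrite /df /flat x0 /GRing.scale /= -!exprVn !exprS.
    clear df d1 F; case: k => [|k] /=; first by rewrite expr0; ring.
    by rewrite !exprS; ring.
  apply: (near_eq_is_derive _ dF).
  near=> y.
  have : `|x - y| < x by near: y; exact: near_dist.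
  rewrite ltr_norml => /andP[h1 h2].
  by rewrite /flat /F ifT//; lra.
- rewrite !flat_le0// mulr0 subrr.
  pose C : R := k.+2%:R ^+ k.+2 + 1.
  have C0 : 0 < C by rewrite ltr_wpDl// exprn_ge0.
  apply/is_deriveP => e e0; exists (e / C); first by rewrite divr_gt0.
  move=> h hh; rewrite add0r (@flat_le0 k 0)// subr0 mulr0 subr0.
  rewrite ger0_norm ?flat_ge0//; apply: le_trans (flat_le_sqr k h) _.
  apply: (@le_trans _ _ (C * h ^+ 2)); first by rewrite ler_wpM2r ?sqr_ge0// lerDl.
  rewrite -(real_normK (num_real h)) expr2 mulrA ler_wpM2r//.
  by rewrite mulrC -ler_pdivlMr// ltW.
Unshelve. all: by end_near. Qed.

(** A syntactic class closed under differentiation: derivability at every order follows by iterating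
    [smooth_gen_derive], and the higher derivatives of a quotient never have to be written down. *)
Inductive smooth_gen : (R -> R) -> Prop :=
| smooth_flat k c d : smooth_gen (fun x => flat k (c * x + d))
| smooth_cst c : smooth_gen (fun=> c)
| smooth_add f g : smooth_gen f -> smooth_gen g ->
    smooth_gen (fun x => f x + g x)
| smooth_mul f g : smooth_gen f -> smooth_gen g ->
    smooth_gen (fun x => f x * g x)
| smooth_inv f : smooth_gen f -> (forall x, f x != 0) ->
    smooth_gen (fun x => (f x)^-1).

Lemma smooth_gen_derive f : smooth_gen f ->
  exists2 g, smooth_gen g & forall x : R, is_derive x 1 f (g x).
Proof.
elim=> {f} [k c d|c|f g sf [f' sf' df] sg [g' sg' dg]|
  f g sf [f' sf' df] sg [g' sg' dg]|f sf [f' sf' df] f0].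
- exists (fun x => (flat k.+2 (c * x + d) + (- k%:R) * flat k.+1 (c * x + d)) * c).
    apply: smooth_mul; last exact: smooth_cst.
    apply: smooth_add; first exact: smooth_flat.
    by apply: smooth_mul; [exact: smooth_cst|exact: smooth_flat].
  move=> x; rewrite mulNr.
  apply: (@is_derive1_comp _ (flat k) (fun x => c * x + d)).
    exact: is_derive_flat.
  apply/is_deriveP => e e0; exists 1 => // h _.
  rewrite (_ : _ - _ = 0); last by ring.
  by rewrite normr0 mulr_ge0// ltW.
- exists (fun=> 0); first exact: smooth_cst.
  by move=> x; exact: is_derive_cst.
- exists (fun x => f' x + g' x); first exact: smooth_add.
  by move=> x; exact: is_deriveD.
- exists (fun x => f x * g' x + g x * f' x).
    by apply: smooth_add; exact: smooth_mul.
  by move=> x; exact: is_deriveM.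
- exists (fun x => (-1) * ((f x)^-1 * (f x)^-1) * f' x).
    apply: smooth_mul => //; apply: smooth_mul; first exact: smooth_cst.
    by apply: smooth_mul; exact: smooth_inv.
  move=> x; have := is_deriveV (f0 x) (df x).
  set d := (X in is_derive _ _ _ X -> _).
  suff -> : -1 * ((f x)^-1 * (f x)^-1) * f' x = d by [].
  by rewrite /d /GRing.scale/= mulN1r expr2 invfM.
Qed.

Lemma smooth_gen_derivable f n : smooth_gen f ->
  forall x : R, derivable (derive1n n f) x 1.
Proof.
elim: n f => [|n IH] f sf x.
  by have [g _ dg] := smooth_gen_derive sf; case: (dg x).
have [g sg dg] := smooth_gen_derive sf.
rewrite /derive1n iterSr (_ : derive1 f = g); first exact: IH.
by apply/funext => y; rewrite derive1E; apply: derive_val.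
Qed.

Lemma smooth_gen_continuous f : smooth_gen f -> continuous f.
Proof.
move=> sf x; apply/differentiable_continuous/derivable1_diffP.
by have := @smooth_gen_derivable f 0 sf x.
Qed.

Definition step (x : R) : R := flat 0 x * (flat 0 x + flat 0 (1 - x))^-1.

Lemma step_den_gt0 x : 0 < flat 0 x + flat 0 (1 - x).
Proof.
have [x0|x0] := leP x 0.
  by rewrite flat_le0// add0r flat0_gt0//; lra.
by rewrite ltr_pwDl// ?flat_ge0// flat0_gt0.
Qed.

Lemma smooth_step c d : smooth_gen (fun x => step (c * x + d)).
Proof.
rewrite /step; apply: smooth_mul; first exact: smooth_flat.
have := smooth_inv (f := fun x => flat 0 (c * x + d) + flat 0 (1 - (c * x + d))).
apply; last by move=> x; rewrite gt_eqF// step_den_gt0.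
apply: smooth_add; first exact: smooth_flat.
rewrite (_ : (fun x => _) = (fun x => flat 0 ((- c) * x + (1 - d)))).
  exact: smooth_flat.
by apply/funext => x; congr (flat _ _); ring.
Qed.

Lemma step_le0 x : x <= 0 -> step x = 0.
Proof. by move=> x0; rewrite /step flat_le0// mul0r. Qed.

Lemma step_ge1 x : 1 <= x -> step x = 1.
Proof.
move=> x1; rewrite /step (@flat_le0 _ (1 - x)) ?addr0 ?divff ?subr_le0//.
by rewrite gt_eqF// flat0_gt0// (lt_le_trans ltr01).
Qed.

Lemma step_ge0 x : 0 <= step x.
Proof. by rewrite mulr_ge0 ?flat_ge0// invr_ge0 ltW// step_den_gt0. Qed.

Lemma step_le1 x : step x <= 1.
Proof.
by rewrite /step ler_pdivrMr ?step_den_gt0// mul1r lerDl flat_ge0.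
Qed.

(* Smoothed indicator of [a, b], with transition layers of width 1/n. *)
Definition plateau (n a b x : R) : R := step (n * (x - a)) - step (n * (x - b)).

Lemma smooth_plateau n a b : smooth_gen (plateau n a b).
Proof.
have h c : (fun x => step (n * (x - c))) = (fun x => step (n * x + (- n * c))).
  by apply/funext => x; congr step; ring.
rewrite (_ : plateau n a b =
  (fun x => step (n * (x - a)) + (-1) * step (n * (x - b)))); last first.
  by apply/funext => x; rewrite mulN1r.
apply: smooth_add; first by rewrite h; exact: smooth_step.
apply: smooth_mul; first exact: smooth_cst.
by rewrite h; exact: smooth_step.
Qed.

Lemma plateau_supp n a b x : 0 < n -> a <= b ->
  x <= a \/ b + n^-1 <= x -> plateau n a b x = 0.
Proof.
move=> n0 ab [xa|xb]; rewrite /plateau.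
  by rewrite !step_le0 ?subrr// pmulr_rle0// subr_le0// (le_trans xa).
have h c : c <= b -> 1 <= n * (x - c).
  move=> cb; rewrite mulrC -ler_pdivrMr// mul1r; lra.
by rewrite !step_ge1 ?subrr// h.
Qed.

Lemma plateau_ge0_le1 n a b x : 0 < n -> a + n^-1 <= b -> 0 <= plateau n a b x <= 1.
Proof.
move=> n0 ab; rewrite /plateau.
have n1 : 0 < n^-1 by rewrite invr_gt0.
have [xb|xb] := leP x b.
  rewrite (@step_le0 (n * (x - b))); last by rewrite pmulr_rle0// subr_le0.
  by rewrite subr0 step_ge0 step_le1.
rewrite (@step_ge1 (n * (x - a))); last first.
  by rewrite mulrC -ler_pdivrMr// mul1r; lra.
by rewrite subr_ge0 step_le1 lerBlDr lerDl step_ge0.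
Qed.

Lemma plateau_eq1 n a b x : 0 < n -> a + n^-1 <= x -> x <= b -> plateau n a b x = 1.
Proof.
move=> n0 ax xb; rewrite /plateau step_ge1 ?step_le0 ?subr0//.
  by rewrite pmulr_rle0// subr_le0.
by rewrite mulrC -ler_pdivrMr// mul1r; lra.
Qed.

Lemma plateau_test_function n a b : 0 < n -> a <= b ->
  test_function (plateau n a b).
Proof.
move=> n0 ab; split; first by move=> k; exact/smooth_gen_derivable/smooth_plateau.
apply: (@subclosed_compact _ _ `[a, b + n^-1]%classic).
- exact: closed_closure.
- exact: segment_compact.
- have /closure_id cI : closed (`[a, b + n^-1]%classic : set R) by exact: itv_closed.
  rewrite [X in _ `<=` X]cI.
  apply: closure_subset => x /= /eqP px; rewrite in_itv/=.
  apply/andP; split; rewrite leNgt; apply/negP => /ltW h; apply: px;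
  by apply: plateau_supp => //; auto.
Qed.

End SmoothStep.

(** * Weak derivatives and absolute continuity *)

Section WeakDerivative.
Context {R : realType}.
Implicit Types (f g h u v : R -> R).

Lemma test_function_support (psi : R -> R) : test_function psi ->
  exists A : R, [/\ 0 <= A, continuous (derive1 psi),
    forall t : R, is_derive t 1 psi (derive1 psi t),
    forall x : R, A <= `|x| -> psi x = 0 &
    forall x : R, A < `|x| -> derive1 psi x = 0].
Proof.
move=> [dpsi /compact_bounded[M [_ hM]]].
have psi0 x : `|M| + 1 < `|x| -> psi x = 0.
  move=> xM; apply/eqP; apply: contraT => px.
  have := hM (`|M| + 1); rewrite ltr_pwDr ?ler_norm// => /(_ isT x) H.
  have : `|x| <= `|M| + 1 by apply: H; apply: subset_closure.
  by rewrite leNgt xM.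
(* One unit more than the bound [|M| + 1] beyond which [psi] vanishes, so that [psi] is zero on a
   whole neighbourhood of each point with |x| > A and its derivative vanishes there. *)
exists (`|M| + 2); split.
- by rewrite addr_ge0.
- move=> x; apply/differentiable_continuous/derivable1_diffP.
  exact: (dpsi 1%N).
- move=> t; rewrite derive1E; apply: derivableP; exact: (dpsi 0%N).
- move=> x xM; apply: psi0; apply: lt_le_trans xM; rewrite ltrD2l; lra.
move=> x xM; rewrite derive1E; apply: derive_val.
apply: (@near_eq_is_derive _ _ _ (cst 0)) => //.
near=> y; rewrite psi0//.
have : `|x - y| < 1 by near: y; exact: near_dist.
have := ler_dist_dist x y; have := ler_norm (`|x| - `|y|); lra.
Unshelve. all: by end_near. Qed.

Definition wder u v := forall psi, test_function psi ->
  \int[mu]_x (u x * derive1 psi x) = - \int[mu]_x (v x * psi x).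

Lemma ac2_wder f g : ac2 f g -> wder f g.
Proof.
move=> fg psi /test_function_support[A [A0 cpsi dpsi psi0 dpsi0]].
exact: (ac2_by_parts fg A0 cpsi dpsi psi0 dpsi0).
Qed.

Lemma lebesgue_pt_small f (c : R) : L2r f -> lebesgue_pt f c ->
  forall e : R, 0 < e -> exists2 d : R, 0 < d & forall r : R, 0 < r -> r < d ->
    \int[mu]_(x in `[c, c + r]) `|f x - f c| <= e * r.
Proof.
move=> hf fc e e0.
have e4 : 0 < e / 4 by rewrite divr_gt0.
have : \forall r \near (0:R)^'+, (davg f c r <= (e / 4)%:E)%E.
  move/fine_cvgP : fc => [ffin /cvgrPdist_le /(_ _ e4) h].
  near=> r.
  have fr : davg f c r \is a fin_num by near: r.
  have : `|0 - (fine \o davg f c) r| <= e / 4 by near: r.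
  rewrite sub0r normrN /= -[in X in _ -> X](fineK fr) lee_fin.
  by apply: le_trans; exact: ler_norm.
rewrite near_withinE => /nbhs_ballP[d /= d0 hd].
exists (d / 2); first by rewrite divr_gt0.
move=> r r0 rd.
(* The interval [c, c + r] lies in the open ball of radius 2 r, whose length is 4 r: hence the bound
   [e / 4] on the average. *)
have := hd (2 * r); rewrite /ball/= sub0r normrN gtr0_norm ?mulr_gt0//.
have -> : 2 * r < d by lra.
move=> /(_ isT isT).
have mB : msb (ball c (2 * r) : set R) by exact: measurable_ball.
have mI : msb (`[c, c + r]%classic : set R) by exact: msb_itv.
have mf : mfn setT (fun x => `|f x - f c|).
  apply: measurableT_comp => //; apply: measurable_funB => //; exact: L2r_meas.
rewrite /davg /iavg lebesgue_measure_ball ?mulr_ge0 ?(ltW r0)// => H.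
have H2 : (\int[mu]_(y in ball c (2 * r)) `|f y - f c|%:E <= (e * r)%:E)%E.
  have r4 : 0 < (2 * r) *+ 2 by rewrite pmulrn_lgt0// mulr_gt0.
  move: H; rewrite inver gt_eqF// lee_pdivrMl// -EFinM => H.
  apply: le_trans H _; rewrite lee_fin; rewrite -mulr_natr; lra.
rewrite -lee_fin /Rintegral fineK; last first.
  apply: integrable_fin_num => //.
  apply: itg_norm => //; apply: itgB => //; first exact: itg_L2r_itv.
  exact: itg_cst_itv.
apply: le_trans H2.
apply: ge0_subset_integral => //.
  by apply/measurable_EFinP; exact: measurable_funTS.
move=> x /=; rewrite in_itv/= /ball/= => /andP[cx xc].
by rewrite distrC ger0_norm ?subr_ge0//; lra.
Unshelve. all: by end_near. Qed.

Lemma step_derivative : exists sigma : R -> R, exists S : R,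
  [/\ continuous sigma, forall x : R, is_derive x 1 step (sigma x),
      forall x, x < 0 \/ 1 < x -> sigma x = 0, 0 <= S &
      forall x, `|sigma x| <= S].
Proof.
have [sigma ssig dsig] : exists2 g, smooth_gen g &
    forall x : R, is_derive x 1 (@step R) (g x).
  have := @smooth_step R 1 0; rewrite (_ : (fun x => _) = @step R).
    exact: smooth_gen_derive.
  by apply/funext => x; rewrite mul1r addr0.
have csig : continuous sigma by exact: smooth_gen_continuous.
have sig0 x : x < 0 \/ 1 < x -> sigma x = 0.
  move=> hx; have [_ <-] := dsig x; apply: derive_val.
  case: hx => hx.
    apply: (@near_eq_is_derive _ _ _ (cst 0)) => //.
    near=> y; rewrite step_le0//.
    have : `|x - y| < - x by near: y; apply: near_dist; rewrite oppr_gt0.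
    by rewrite ltr_norml => /andP[h1 h2]; lra.
  apply: (@near_eq_is_derive _ _ _ (cst (1 : R))) => //.
  near=> y; rewrite step_ge1//.
  have : `|x - y| < x - 1 by near: y; apply: near_dist; rewrite subr_gt0.
  by rewrite ltr_norml => /andP[h1 h2]; lra.
have [S S0 hS] := @continuous_bounded_itv R sigma 0 1 csig.
exists sigma, S; split => //; first exact: ltW.
move=> x; have [x0|x0] := ltP x 0; first by rewrite sig0 ?normr0 ?ltW//; left.
have [x1|x1] := ltP 1 x; first by rewrite sig0 ?normr0 ?ltW//; right.
exact: hS.
Unshelve. all: by end_near. Qed.

Lemma is_derive_affine_comp (F F' : R -> R) (c d : R) :
  (forall x : R, is_derive x 1 F (F' x)) ->
  forall x : R, is_derive x 1 (fun x => F (c * (x - d))) (c * F' (c * (x - d))).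
Proof.
move=> dF x; rewrite [X in is_derive _ _ _ X]mulrC.
have := @is_derive1_comp _ F (fun x => c * (x - d)) x (F' (c * (x - d))) c.
apply.
apply/is_deriveP => e e0; exists 1 => // h _.
rewrite (_ : _ - _ = 0); last by ring.
by rewrite normr0 mulr_ge0// ltW.
Qed.

Lemma continuous_rescale (sigma : R -> R) (n c : R) : continuous sigma ->
  continuous (fun x => n * sigma (n * (x - c))).
Proof.
move=> csig x.
apply: (@continuousM R R (fun=> n) (fun x => sigma (n * (x - c))) x).
  exact: cvg_cst.
apply: (@continuous_comp _ _ _ (fun x => n * (x - c)) sigma); last exact: csig.
apply: (@continuousM R R (fun=> n) (fun x => x - c) x); first exact: cvg_cst.
by apply: continuousB; [exact: cvg_id|exact: cvg_cst].
Qed.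

(** The rescaled derivative of [step] has integral 1, is supported in [c, c + 1/n] and has height at
    most [n * S]. The error is therefore at most [S] times the mean deviation of [u] from [u c] over
    [c, c + 1/n], which is small at a Lebesgue point. *)
Lemma approximate_identity u (sigma : R -> R) (S c : R) : L2r u ->
  lebesgue_pt u c ->
  continuous sigma -> (forall x : R, is_derive x 1 step (sigma x)) ->
  (forall x, x < 0 \/ 1 < x -> sigma x = 0) -> 0 <= S ->
  (forall x, `|sigma x| <= S) ->
  forall e : R, 0 < e -> exists2 N : R, 0 < N & forall n, N < n ->
    `|\int[mu]_x (u x * (n * sigma (n * (x - c)))) - u c| <= e.
Proof.
move=> hu uc csig dsig sig0 S0 hS e e0.
have e1 : 0 < e / (S + 1) by rewrite divr_gt0// ltr_wpDl.
have [d d0 hd] := lebesgue_pt_small hu uc e1.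
exists d^-1; rewrite ?invr_gt0// => n Nn.
have n0 : 0 < n by rewrite (lt_trans _ Nn)// invr_gt0.
pose r := n^-1; have r0 : 0 < r by rewrite invr_gt0.
have rd : r < d by rewrite /r -[d]invrK ltf_pV2 ?posrE ?invr_gt0.
have mI : msb (`[c, c + r]%classic : set R) by exact: msb_itv.
pose w x := n * sigma (n * (x - c)).
have cw : continuous w by exact: continuous_rescale.
have w0 x : x < c \/ c + r < x -> w x = 0.
  move=> hx; rewrite /w sig0 ?mulr0//.
  case: hx => h; [left; by rewrite pmulr_rlt0// subr_lt0|right].
  by rewrite mulrC -ltr_pdivrMr// mul1r; rewrite -/r; lra.
have wS x : `|w x| <= n * S by rewrite normrM gtr0_norm// ler_wpM2l// ltW.
rewrite (@Rintegral_supp_itv _ _ c (c + r)); last first.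
  by move=> x /w0; rewrite /w => ->; rewrite mulr0.
have iw : itg `[c, c + r] w by exact: itg_continuous.
have iuc : itg `[c, c + r] (fun x => `|u x - u c|).
  apply: itg_norm => //; apply: itgB => //; first exact: itg_L2r_itv.
  exact: itg_cst_itv.
have iuw : itg `[c, c + r] (fun x => (u x - u c) * w x).
  apply: (itg_le mI _ (g := fun x => (n * S) * `|u x - u c|)).
  - apply: measurable_funTS; apply: measurable_funM.
      by apply: measurable_funB => //; exact: L2r_meas.
    exact: continuous_measurable_fun.
  - exact: itgZ.
  - by move=> x _; rewrite normrM mulrC ler_wpM2r.
have w1 : \int[mu]_(x in `[c, c + r]) w x = 1.
  have cr : c <= c + r by rewrite lerDl ltW.
  rewrite (Rintegral_derive cr cw (is_derive_affine_comp n c dsig)).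
  rewrite subrr mulr0 [step 0]step_le0// subr0 step_ge1//.
  by rewrite addrC addKr mulfV// gt_eqF.
have -> : \int[mu]_(x in `[c, c + r]) (u x * w x) - u c =
    \int[mu]_(x in `[c, c + r]) ((u x - u c) * w x).
  rewrite -[X in _ - X]mulr1 -w1 -RintegralZl// -RintegralB//.
  - by apply: eq_Rintegral => x _; ring.
  - rewrite (_ : (fun x => u x * w x) = fun x => (u x - u c) * w x + u c * w x).
      by apply: itgD => //; exact: itgZ.
    by apply/funext => x; ring.
  - exact: itgZ.
apply: le_trans (le_normr_Rintegral _ _) _ => //.
apply: (@le_trans _ _ (\int[mu]_(x in `[c, c + r]) ((n * S) * `|u x - u c|))).
  apply: le_Rintegral => //; [exact: itg_norm|exact: itgZ|].
  by move=> x _; rewrite normrM mulrC ler_wpM2r.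
rewrite RintegralZl//.
have nS : 0 <= n * S by rewrite mulr_ge0// ltW.
apply: le_trans (ler_wpM2l nS (hd _ r0 rd)) _.
have S1 : S + 1 != 0 by rewrite gt_eqF// ltr_wpDl.
have nn : n != 0 by rewrite gt_eqF.
have -> : n * S * (e / (S + 1) * r) = e * (S / (S + 1)).
  by rewrite /r; field; rewrite nn S1.
by rewrite ger_pMr// ler_pdivrMr ?ltr_wpDl// mul1r lerDl.
Qed.

End WeakDerivative.

(** * From weak derivatives to primitives *)

Section WeakToAC.
Context {R : realType}.
Implicit Types (f g h u v w : R -> R).

Lemma L2r_compact_support w (s t : R) : continuous w ->
  (forall x, x < s \/ t < x -> w x = 0) -> L2r w.
Proof.
move=> cw w0; apply/L2rP; split; first exact: continuous_measurable_fun.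
have mI : msb (`[s, t]%classic : set R) by exact: msb_itv.
have -> : (fun x => w x ^+ 2) = (fun x => w x ^+ 2) \_ `[s, t].
  apply/funext => x; rewrite patchE; case: ifPn => // /negP xA.
  rewrite w0 ?expr0n//.
  have [|sx] := ltP x s; first by left.
  have [|xt] := ltP t x; first by right.
  by exfalso; apply: xA; rewrite inE/= in_itv/= sx.
apply: itg_restrict => //; apply: itg_continuous => x.
by apply: continuousM; exact: cw.
Qed.

Lemma Rintegral_norm_itv_small v (x y e : R) : L2r v -> x <= y -> 0 <= e ->
  (y - x) * \int[mu]_t (v t ^+ 2) <= e ^+ 2 ->
  \int[mu]_(t in `[x, y]) `|v t| <= e.
Proof.
move=> hv xy e0 h; apply: le_trans (ler_norm _) _; apply: normr_le_sqr => //.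
apply: le_trans h; have hv' : L2r (fun x => `|v x|).
  apply: (L2r_le (g := v)) => //; last by move=> z; rewrite normr_id.
  by apply: measurableT_comp => //; exact: L2r_meas.
apply: le_trans (Rintegral_itv_sqr_le xy hv') _.
rewrite ler_wpM2l ?subr_ge0// le_eqVlt; apply/orP; left; apply/eqP.
by apply: eq_Rintegral => z _; rewrite real_normK ?num_real.
Qed.

(** The test function is a plateau over [a, b] with layers of width 1/n. Its derivative is the
    difference of two approximate identities at [a] and [b], so one side of the weak identity tends
    to u a - u b; the other tends to minus the integral of [v], the layers being negligible by
    Cauchy-Schwarz. *)
Lemma wder_lebesgue_pt u v (a b : R) : L2r u -> L2r v -> wder u v -> a < b ->
  lebesgue_pt u a -> lebesgue_pt u b ->
  u b - u a = \int[mu]_(t in `[a, b]) v t.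
Proof.
move=> hu hv uv ab pa pb; apply/eqP; rewrite -subr_eq0 -normr_le0.
apply/ler_addgt0Pr => e' e'0; rewrite add0r.
(* Five errors occur: one at each Lebesgue point, one for [v] times the plateau on each layer, and
   one for [v] alone on the layer at [a]. *)
pose e := e' / 5; have e0 : 0 < e by rewrite divr_gt0.
have [sigma [S [csig dsig sig0 S0 hS]]] := @step_derivative R.
have [Na Na0 hNa] := approximate_identity hu pa csig dsig sig0 S0 hS e0.
have [Nb Nb0 hNb] := approximate_identity hu pb csig dsig sig0 S0 hS e0.
set K := \int[mu]_t (v t ^+ 2).
have K0 : 0 <= K by apply: Rintegral_ge0 => t _; exact: sqr_ge0.
(* Each summand serves one requirement: [n] exceeds both thresholds, 1/n is at most b - a, and K/n
   is at most e^2. *)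
pose n := Na + Nb + (b - a)^-1 + K / e ^+ 2 + 1.
have ba0 : 0 < b - a by rewrite subr_gt0.
have ba1 : 0 < (b - a)^-1 by rewrite invr_gt0.
have Ke : 0 <= K / e ^+ 2 by rewrite divr_ge0// sqr_ge0.
have n0 : 0 < n by rewrite /n; lra.
pose r := n^-1; have r0 : 0 < r by rewrite invr_gt0.
have rab : a + r <= b.
  rewrite -lerBrDl /r -[b - a]invrK lef_pV2 ?posrE//; rewrite /n; lra.
have rK : r * K <= e ^+ 2.
  rewrite /r mulrC ler_pdivrMr// -ler_pdivrMl ?exprn_gt0// mulrC /n; lra.
have ntest : test_function (plateau n a b).
  by apply: plateau_test_function => //; exact: ltW.
pose w (c x : R) : R := n * sigma (n * (x - c)).
have cw c : continuous (w c) by exact: continuous_rescale.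
have w0 c x : x < c \/ c + r < x -> w c x = 0.
  move=> hx; rewrite /w sig0 ?mulr0//.
  case: hx => h; [left; by rewrite pmulr_rlt0// subr_lt0|right].
  by rewrite mulrC -ltr_pdivrMr// mul1r; rewrite -/r; lra.
have L2w c : L2r (w c) by apply: L2r_compact_support (w0 c).
have dpl x : derive1 (plateau n a b) x = w a x - w b x.
  rewrite derive1E; apply: derive_val.
  by apply: is_deriveB; exact: is_derive_affine_comp.
have := uv _ ntest.
rewrite (_ : (fun x => u x * derive1 (plateau n a b) x) = fun x => u x * w a x - u x * w b x);
  last by apply/funext => x; rewrite dpl; ring.
rewrite RintegralB//; try exact: L2rM.
have mI (x y : R) : msb (`[x, y]%classic : set R) by exact: msb_itv.
have ar : a <= a + r by rewrite lerDl ltW.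
have br : b <= b + r by rewrite lerDl ltW.
have pl01 := plateau_ge0_le1 _ n0 rab.
have cpl : continuous (plateau n a b).
  exact/smooth_gen_continuous/smooth_plateau.
have ivp : itg setT (fun x => v x * plateau n a b x).
  apply: L2rM => //; apply: (@L2r_compact_support _ a (b + r)) => // x hx.
  apply: plateau_supp => //; first exact: ltW.
  by case: hx => /ltW; [left|right].
have iv (x y : R) : itg `[x, y] v by exact: itg_L2r_itv.
rewrite (@Rintegral_supp_itv _ (fun x => v x * _) a (b + r)); last first.
  move=> x hx; rewrite (plateau_supp n0 (ltW ab)) ?mulr0//.
  by case: hx => /ltW; [left|right].
have ivp' (x y : R) : itg `[x, y] (fun x => v x * plateau n a b x).
  exact: itg_sub.
rewrite (@Rintegral_itv_split _ _ a (a + r))//; last first.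
  by apply: le_trans rab _.
rewrite (@Rintegral_itv_split _ _ (a + r) b)//.
have -> : \int[mu]_(x in `[a + r, b]) (v x * plateau n a b x) =
    \int[mu]_(x in `[a + r, b]) v x.
  apply: eq_Rintegral => x; rewrite inE/= in_itv/= => /andP[xa xb].
  by rewrite plateau_eq1// mulr1.
rewrite (@Rintegral_itv_split _ v a (a + r))//.
have small (x y : R) : y = x + r ->
    `|\int[mu]_(t in `[x, y]) (v t * plateau n a b t)| <= e /\
    `|\int[mu]_(t in `[x, y]) v t| <= e.
  move=> yE; have xy : x <= y by rewrite yE lerDl ltW.
  have h : \int[mu]_(t in `[x, y]) `|v t| <= e.
    apply: Rintegral_norm_itv_small => //; first exact: ltW.
    by rewrite yE addrC addKr.
  split; apply: le_trans h; apply: le_trans (le_normr_Rintegral _ _) _ => //.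
  apply: le_Rintegral => //; [exact: itg_norm|exact: itg_norm|].
  move=> t _; have /andP[p0 p1] := pl01 t.
  by rewrite normrM ler_piMr// ger0_norm.
have [] := small a (a + r) erefl; have [] := small b (b + r) erefl.
have nNa : Na < n by rewrite /n; lra.
have nNb : Nb < n by rewrite /n; lra.
have h1 : `|\int[mu]_x (u x * w a x) - u a| <= e := hNa n nNa.
have h2 : `|\int[mu]_x (u x * w b x) - u b| <= e := hNb n nNb.
move: h1 h2; rewrite !ler_norml.
set I1 := Rintegral _ _ _; set I2 := Rintegral _ _ _; set I3 := Rintegral _ _ _.
set I4 := Rintegral _ _ _; set I5 := Rintegral _ _ _; set I6 := Rintegral _ _ _.
set I7 := Rintegral _ _ _.
move=> /andP[A1 A2] /andP[A3 A4] /andP[A5 A6] /andP[A7 A8] /andP[A9 A10] /andP[A11 A12] A13.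
have e4 : e' = 5 * e by rewrite /e; field.
clear - A1 A2 A3 A4 A5 A6 A7 A8 A9 A10 A11 A12 A13 e4.
apply/andP; split; lra.
Qed.

Lemma ae_lebesgue_pt f : L2r f -> {ae mu, forall x, lebesgue_pt f x}.
Proof.
move=> hf; apply: lebesgue_differentiation; split.
- exact: L2r_meas.
- exact: openT.
move=> K _ cK; have [M [_ hM]] := compact_bounded cK.
have hK : K `<=` `[- (`|M| + 1), `|M| + 1].
  move=> x Kx /=; rewrite in_itv/= -ler_norml.
  by have := hM (`|M| + 1); rewrite ltr_pwDr ?ler_norm// => /(_ isT x Kx).
have mK : msb (K : set R) by exact: compact_measurable.
have := integrableS (msb_itv `[- (`|M| + 1), `|M| + 1]) mK hK
  (itg_L2r_itv (- (`|M| + 1)) (`|M| + 1) hf).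
by move=> /integrableP[_].
Qed.

Lemma ae_exists (P : R -> Prop) : {ae mu, forall x, P x} -> exists x, P x.
Proof.
move=> [N [mN N0 hN]]; apply: contrapT => nP.
have : (mu (`[0%R, 1%R]%classic : set R) <= 0)%E.
  rewrite -N0; apply: le_measure.
  - by rewrite inE; exact: msb_itv.
  - by rewrite inE.
  - by move=> x _; apply: hN => /= Px; apply: nP; exists x.
by rewrite lebesgue_measure_itv/= lte_fin ltr01 oppr0 adde0 lee_fin ler10.
Qed.

Lemma itg_ae f g : measurable_fun setT f -> itg setT g ->
  {ae mu, forall x, f x = g x} -> itg setT f.
Proof.
move=> mf ig fg; have mg := itg_measurable ig.
apply/integrableP; split; first exact/measurable_EFinP.
move/integrableP : ig => [_]; apply: le_lt_trans; rewrite le_eqVlt.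
apply/orP; left; apply/eqP; apply: ae_eq_integral => //.
- by apply: measurableT_comp => //; exact/measurable_EFinP.
- by apply: measurableT_comp => //; exact/measurable_EFinP.
- by apply: aeS fg => x /= ->.
Qed.

Lemma L2r_ae f g : measurable_fun setT f -> L2r g ->
  {ae mu, forall x, f x = g x} -> L2r f.
Proof.
move=> mf /L2rP[mg ig] fg; apply/L2rP; split => //.
apply: itg_ae ig _; first exact: measurable_funX.
by apply: aeS fg => x ->.
Qed.

(** The primitive of [v] that agrees with [u] at one Lebesgue point of [u] agrees with it at all of
    them, hence almost everywhere. *)
Lemma wder_ac2 u v : L2r u -> L2r v -> wder u v ->
  exists2 f, ac2 f v & {ae mu, forall x, f x = u x}.
Proof.
move=> hu hv uv.
have hl := ae_lebesgue_pt hu.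
have [x0 px0] := ae_exists hl.
pose f y := if x0 <= y then u x0 + \int[mu]_(t in `[x0, y]) v t
            else u x0 - \int[mu]_(t in `[y, x0]) v t.
have iv (x y : R) : itg `[x, y] v by exact: itg_L2r_itv.
have fv (x y : R) : x <= y -> f y - f x = \int[mu]_(t in `[x, y]) v t.
  move=> xy; rewrite /f; have [h1|h1] := leP x0 x.
    rewrite (le_trans h1 xy) (@Rintegral_itv_split _ v x0 x y)//; ring.
  have [h2|h2] := leP x0 y.
    by rewrite (@Rintegral_itv_split _ v x x0 y)// ?ltW//; ring.
  by rewrite (@Rintegral_itv_split _ v x y x0)// ?ltW//; ring.
have fu : {ae mu, forall x, f x = u x}.
  apply: aeS hl => y py; rewrite /f.
  case: (ltgtP x0 y) => [h|h|<-].
  - by rewrite -(wder_lebesgue_pt hu hv uv h px0 py) addrC subrK.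
  - by rewrite -(wder_lebesgue_pt hu hv uv h py px0) opprB addrC subrK.
  - by rewrite set_itv1 Rintegral_set1 addr0.
exists f => //; split => //.
apply: L2r_ae hu fu; apply: continuous_measurable_fun.
exact: (primitive_continuous hv fv).
Qed.

(** The integral of v - w vanishes over every interval, while at a Lebesgue point its derivative
    with respect to the upper end is the value of v - w. *)
Lemma ac2_unique f v w : ac2 f v -> ac2 f w -> {ae mu, forall x, v x = w x}.
Proof.
move=> [hf hv fv] [_ hw fw].
have hd := L2rB hv hw.
have d0 (x y : R) : x <= y -> \int[mu]_(t in `[x, y]) (v t - w t) = 0.
  move=> xy; rewrite RintegralB ?itg_L2r_itv//.
  by rewrite -fv// -fw// subrr.
apply: aeS (ae_lebesgue_pt hd) => x px; apply/eqP; rewrite -subr_eq0; apply/eqP.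
have := @FTC1_lebesgue_pt R (fun t => v t - w t) (BLeft (x - 1)) x (x + 1).
have xx1 : x < x + 1 by rewrite ltrDl.
move=> /(_ xx1 (itg_L2r_itv _ _ hd)) /= H.
have {H}[|//|_ <-] := H; first by rewrite lte_fin gtrBl.
rewrite derive1E; apply: derive_val.
apply: (@near_eq_is_derive _ _ _ (cst 0)) => //.
near=> y; rewrite d0//.
have : `|x - y| < 1 by near: y; exact: near_dist.
by rewrite ltr_norml => /andP[? ?]; lra.
Unshelve. all: by end_near. Qed.

Lemma continuous_ae_eq f g : continuous f -> continuous g ->
  {ae mu, forall x, f x = g x} -> f = g.
Proof.
move=> cf cg [N [mN N0 hN]]; apply/funext => x; apply: contrapT => fgx.
have cfg : continuous (fun y => f y - g y).
  by move=> y; apply: continuousB; [exact: cf|exact: cg].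
have fg0 : 0 < `|f x - g x| by rewrite normr_gt0 subr_eq0; apply/eqP.
have /cvgrPdist_lt/(_ _ fg0)/nbhs_ballP[d /= d0 hd] := cfg x.
have : (mu (ball x d : set R) <= 0)%E.
  rewrite -N0; apply: le_measure.
  - by rewrite inE; exact: (measurable_ball x d : msb _).
  - by rewrite inE.
  move=> y /hd /= h; apply: hN => /= fgy.
  by move: h; rewrite fgy subrr subr0 ltxx.
rewrite lebesgue_measure_ball ?(ltW d0)// lee_fin leNgt.
by rewrite pmulrn_lgt0// d0.
Qed.

(** Both candidates have primitives that agree almost everywhere with [u]. These are continuous,
    hence one and the same function, and [ac2_unique] applies to it. *)
Lemma wder_unique u v w : L2r u -> L2r v -> L2r w -> wder u v -> wder u w ->
  {ae mu, forall x, v x = w x}.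
Proof.
move=> hu hv hw uv uw.
have [f fv fu] := wder_ac2 hu hv uv; have [g gw gu] := wder_ac2 hu hw uw.
apply: (ac2_unique fv); suff -> : f = g by [].
apply: continuous_ae_eq; [exact: ac2_continuous fv|exact: ac2_continuous gw|].
by apply: aeS (aeI fu gu) => x [-> ->].
Qed.

End WeakToAC.

(** * The space H^1 *)

Section ComplexFunctions.
Context {R : realType}.
Implicit Types (u v w : R -> R[i]) (z : R[i]).

Lemma ReD z1 z2 : Re (z1 + z2) = Re z1 + Re z2 :> R.
Proof. by case: z1 z2 => [a b] [c d]. Qed.
Lemma ImD z1 z2 : Im (z1 + z2) = Im z1 + Im z2 :> R.
Proof. by case: z1 z2 => [a b] [c d]. Qed.
Lemma ReB z1 z2 : Re (z1 - z2) = Re z1 - Re z2 :> R.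
Proof. by case: z1 z2 => [a b] [c d]. Qed.
Lemma ImB z1 z2 : Im (z1 - z2) = Im z1 - Im z2 :> R.
Proof. by case: z1 z2 => [a b] [c d]. Qed.
Lemma ReM z1 z2 : Re (z1 * z2) = Re z1 * Re z2 - Im z1 * Im z2 :> R.
Proof. by case: z1 z2 => [a b] [c d]. Qed.
Lemma ImM z1 z2 : Im (z1 * z2) = Re z1 * Im z2 + Im z1 * Re z2 :> R.
Proof. by case: z1 z2 => [a b] [c d]. Qed.

Lemma cabs_sqr z : cabs z ^+ 2 = Re z ^+ 2 + Im z ^+ 2.
Proof. by case: z => a b /=; rewrite sqr_sqrtr// addr_ge0// sqr_ge0. Qed.

Lemma cabs_ge0 z : 0 <= cabs z.
Proof. by case: z => a b /=; exact: sqrtr_ge0. Qed.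

Lemma L2D u w : L2 u -> L2 w -> L2 (fun x => u x + w x).
Proof.
move=> [u1 u2] [w1 w2]; split => /=.
  by under eq_fun do rewrite ReD; exact: L2rD.
by under eq_fun do rewrite ImD; exact: L2rD.
Qed.

Lemma L2Z z u : L2 u -> L2 (fun x => z * u x).
Proof.
move=> [u1 u2]; split => /=.
  by under eq_fun do rewrite ReM; apply: L2rB; exact: L2rZ.
by under eq_fun do rewrite ImM; apply: L2rD; exact: L2rZ.
Qed.

Lemma L2B u w : L2 u -> L2 w -> L2 (fun x => u x - w x).
Proof.
move=> [u1 u2] [w1 w2]; split => /=.
  by under eq_fun do rewrite ReB; exact: L2rB.
by under eq_fun do rewrite ImB; exact: L2rB.
Qed.

Lemma L2_dotE u w :
  L2_dot u w = \int[mu]_x (Re (u x) * Re (w x) + Im (u x) * Im (w x)).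
Proof.
apply: eq_Rintegral => x _; case: (u x) (w x) => [a b] [c d] /=.
by rewrite mulrN opprK.
Qed.

Lemma massE u : mass u = L2_dot u u.
Proof.
by rewrite L2_dotE; apply: eq_Rintegral => x _; rewrite cabs_sqr !expr2.
Qed.

Lemma itg_dot u w : L2 u -> L2 w ->
  itg setT (fun x => Re (u x) * Re (w x) + Im (u x) * Im (w x)).
Proof. by move=> [u1 u2] [w1 w2]; apply: itgD => //; exact: L2rM. Qed.

Lemma L2_dotC u w : L2_dot u w = L2_dot w u.
Proof. by rewrite !L2_dotE; apply: eq_Rintegral => x _; ring. Qed.

Lemma L2_dotDl u v w : L2 u -> L2 v -> L2 w ->
  L2_dot (fun x => u x + v x) w = L2_dot u w + L2_dot v w.
Proof.
move=> hu hv hw; rewrite !L2_dotE -RintegralD//; try exact: itg_dot.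
by apply: eq_Rintegral => x _; rewrite ReD ImD; ring.
Qed.

Lemma L2_dotBl u v w : L2 u -> L2 v -> L2 w ->
  L2_dot (fun x => u x - v x) w = L2_dot u w - L2_dot v w.
Proof.
move=> hu hv hw; rewrite !L2_dotE -RintegralB//; try exact: itg_dot.
by apply: eq_Rintegral => x _; rewrite ReB ImB; ring.
Qed.

Lemma L2_dotBr u v w : L2 u -> L2 v -> L2 w ->
  L2_dot w (fun x => u x - v x) = L2_dot w u - L2_dot w v.
Proof. by move=> hu hv hw; rewrite ![L2_dot w _]L2_dotC L2_dotBl. Qed.

Lemma L2_dotDr u v w : L2 u -> L2 v -> L2 w ->
  L2_dot w (fun x => u x + v x) = L2_dot w u + L2_dot w v.
Proof. by move=> hu hv hw; rewrite ![L2_dot w _]L2_dotC L2_dotDl. Qed.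

Lemma L2_dot_mul_i u w : L2_dot (fun x => Complex 0 1 * u x)
  (fun x => Complex 0 1 * w x) = L2_dot u w.
Proof.
by rewrite !L2_dotE; apply: eq_Rintegral => x _; rewrite !ReM !ImM /=; ring.
Qed.

Lemma L2_dot_i_self u : L2_dot (fun x => Complex 0 1 * u x) u = 0.
Proof.
rewrite L2_dotE (_ : (fun x => _) = cst 0).
  by rewrite /Rintegral integral0.
by apply/funext => x; rewrite ReM ImM /=; ring.
Qed.

Lemma L2_dot_i_antisym u w : L2 u -> L2 w ->
  L2_dot (fun x => Complex 0 1 * u x) w =
  - L2_dot (fun x => Complex 0 1 * w x) u.
Proof.
move=> hu hw; apply/eqP; rewrite -addr_eq0; apply/eqP.
rewrite !L2_dotE -RintegralD//; try by apply: itg_dot => //; exact: L2Z.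
rewrite (_ : (fun x => _) = cst 0); first by rewrite /Rintegral integral0.
by apply/funext => x; rewrite !ReM !ImM /=; ring.
Qed.

Lemma L2_dot_ge0 u : 0 <= L2_dot u u.
Proof.
rewrite -massE; apply: Rintegral_ge0 => x _; exact: sqr_ge0.
Qed.

Lemma mass_ge0 u : 0 <= mass u.
Proof. by rewrite massE L2_dot_ge0. Qed.

Lemma itg_mass u : L2 u -> itg setT (fun x => cabs (u x) ^+ 2).
Proof.
move=> hu; under eq_fun do rewrite cabs_sqr !expr2.
exact: itg_dot.
Qed.

Lemma massD_dot u w : L2 u -> L2 w ->
  mass (fun x => u x + w x) = mass u + 2 * L2_dot u w + mass w.
Proof.
move=> hu hw; rewrite !massE L2_dotDl ?L2_dotDr//; try exact: L2D.
by rewrite (L2_dotC w u); ring.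
Qed.

Lemma massB_dot u w : L2 u -> L2 w ->
  mass (fun x => u x - w x) = mass u - 2 * L2_dot u w + mass w.
Proof.
move=> hu hw; rewrite !massE L2_dotBl ?L2_dotBr//; try exact: L2B.
by rewrite (L2_dotC w u); ring.
Qed.

Lemma massZ z u : L2 u -> mass (fun x => z * u x) = cabs z ^+ 2 * mass u.
Proof.
move=> hu; rewrite /mass -RintegralZl//; last exact: itg_mass.
by apply: eq_Rintegral => x _; rewrite !cabs_sqr ReM ImM; ring.
Qed.

Lemma massD_le u w : L2 u -> L2 w ->
  mass (fun x => u x + w x) <= 2 * mass u + 2 * mass w.
Proof.
move=> hu hw; rewrite massD_dot//.
have := mass_ge0 (fun x => u x - w x); rewrite massB_dot//; lra.
Qed.

Lemma massB_le u w : L2 u -> L2 w ->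
  mass (fun x => u x - w x) <= 2 * mass u + 2 * mass w.
Proof.
move=> hu hw; rewrite massB_dot//.
have := mass_ge0 (fun x => u x + w x); rewrite massD_dot//; lra.
Qed.

Lemma massBC u w : mass (fun x => u x - w x) = mass (fun x => w x - u x).
Proof.
by apply: eq_Rintegral => x _; rewrite !cabs_sqr !ReB !ImB; ring.
Qed.

Lemma L2_cauchy_schwarz u w : L2 u -> L2 w ->
  L2_dot u w ^+ 2 <= mass u * mass w.
Proof.
move=> hu hw.
have key (s t : R) : 0 <= s ^+ 2 * mass u + 2 * s * t * L2_dot u w + t ^+ 2 * mass w.
  have := mass_ge0 (fun x => (Complex s 0) * u x + (Complex t 0) * w x).
  rewrite massD_dot ?massZ//; try exact: L2Z.
  rewrite !cabs_sqr/= expr0n !addr0.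
  rewrite (_ : L2_dot (fun x => Complex s 0 * u x) (fun x => Complex t 0 * w x) =
    s * t * L2_dot u w); first by rewrite !mulrA.
  rewrite !L2_dotE -RintegralZl//; last exact: itg_dot.
  by apply: eq_Rintegral => x _; rewrite !ReM !ImM /=; ring.
set a := mass u; set b := mass w; set c := L2_dot u w.
have a0 : 0 <= a by exact: mass_ge0.
have b0 : 0 <= b by exact: mass_ge0.
have [az|an] := eqVneq a 0.
  have [->|cn] := eqVneq c 0; first by rewrite expr0n mulr_ge0.
  have := key (- (b + 1) / (2 * c)) 1; rewrite -/a -/b -/c az => h.
  exfalso; have : 2 * (- (b + 1) / (2 * c)) * 1 * c = - (b + 1).
    by field; rewrite cn.
  by move: h; rewrite mulr0 expr1n => h h'; lra.
have := key (- c) a; rewrite -/a -/b -/c (_ : _ + _ = a * (a * b - c ^+ 2)); last by ring.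
by rewrite pmulr_rge0 ?lt_def ?an// subr_ge0.
Qed.

Lemma L2_dot_le u w (a b : R) : L2 u -> L2 w -> 0 <= a -> 0 <= b ->
  mass u <= a ^+ 2 -> mass w <= b ^+ 2 -> `|L2_dot u w| <= a * b.
Proof.
move=> hu hw a0 b0 ha hb; apply: normr_le_sqr; first exact: mulr_ge0.
apply: le_trans (L2_cauchy_schwarz hu hw) _.
by rewrite exprMn ler_pM ?mass_ge0.
Qed.

Lemma L2_meas u : L2 u ->
  mfn setT (fun x => Re (u x)) /\ mfn setT (fun x => Im (u x)).
Proof. by move=> [u1 u2]; split; exact: L2r_meas. Qed.

Lemma L2_dot_ae u u' w w' : L2 u -> L2 u' -> L2 w -> L2 w' ->
  {ae mu, forall x, u x = u' x} -> {ae mu, forall x, w x = w' x} ->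
  L2_dot u w = L2_dot u' w'.
Proof.
move=> hu hu' hw hw' uu ww; rewrite !L2_dotE; apply: ae_eq_Rintegral.
- by apply: itg_measurable; exact: itg_dot.
- by apply: itg_measurable; exact: itg_dot.
- by apply: aeS (aeI uu ww) => x [-> ->].
Qed.

Lemma mass_ae u w : L2 u -> L2 w -> {ae mu, forall x, u x = w x} ->
  mass u = mass w.
Proof. by move=> hu hw uw; rewrite !massE; exact: L2_dot_ae. Qed.

Lemma is_weak_derivativeP u v : is_weak_derivative u v <->
  wder (fun x => Re (u x)) (fun x => Re (v x)) /\
  wder (fun x => Im (u x)) (fun x => Im (v x)).
Proof.
have E w (c : R -> R) : cintegral (fun x => w x * Complex (c x) 0) =
    Complex (\int[mu]_x (Re (w x) * c x)) (\int[mu]_x (Im (w x) * c x)).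
  congr Complex; apply: eq_Rintegral => x _; rewrite ?ReM ?ImM /=; ring.
split=> [H|[H1 H2] psi tpsi]; last by rewrite !E H1// H2.
by split=> psi /H; rewrite !E => -[].
Qed.

(** A complex H^1 function through its continuous representative and an explicit derivative. With
    [v] as an argument, sums, rescalings and gluings act on the pair by exact formulas, whereas
    rules for [weak_derivative] hold almost everywhere only. *)
Definition sobolev u v := ac2 (fun x => Re (u x)) (fun x => Re (v x)) /\
                       ac2 (fun x => Im (u x)) (fun x => Im (v x)).

Lemma sobolev_L2 u v : sobolev u v -> L2 u /\ L2 v.
Proof. by move=> [[? ? _] [? ? _]]. Qed.

Lemma weak_derivativeP u : H1 u ->
  L2 (weak_derivative u) /\ is_weak_derivative u (weak_derivative u).
Proof. by move=> [_ [v hv]]; rewrite /weak_derivative; apply: (@xgetPex _ (fun=> 0) [set v | L2 v /\ is_weak_derivative u v]); exists v. Qed.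

Lemma complex_ext z1 z2 : Re z1 = Re z2 -> Im z1 = Im z2 -> z1 = z2.
Proof. by case: z1 z2 => [a b] [c d] /= -> ->. Qed.

Lemma is_weak_derivative_unique u v w : L2 u -> L2 v -> L2 w ->
  is_weak_derivative u v -> is_weak_derivative u w ->
  {ae mu, forall x, v x = w x}.
Proof.
move=> [u1 u2] [v1 v2] [w1 w2] /is_weak_derivativeP[a1 a2] /is_weak_derivativeP[b1 b2].
have e1 := wder_unique u1 v1 w1 a1 b1; have e2 := wder_unique u2 v2 w2 a2 b2.
by apply: aeS (aeI e1 e2) => x [h1 h2]; exact: complex_ext.
Qed.

Lemma sobolev_H1 u v : sobolev u v -> H1 u.
Proof.
move=> uv; have [hu hv] := sobolev_L2 uv; split => //; exists v; split => //.
by case: uv => [/ac2_wder a1 /ac2_wder a2]; apply/is_weak_derivativeP.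
Qed.

Lemma sobolev_weak_derivative u v : sobolev u v ->
  {ae mu, forall x, weak_derivative u x = v x}.
Proof.
move=> uv; have [hu hv] := sobolev_L2 uv.
have [L2w wd] := weak_derivativeP (sobolev_H1 uv).
apply: (is_weak_derivative_unique hu) => //.
by case: uv => [/ac2_wder a1 /ac2_wder a2]; apply/is_weak_derivativeP.
Qed.

Lemma H1_sobolev u : H1 u ->
  exists2 w, sobolev w (weak_derivative u) & {ae mu, forall x, w x = u x}.
Proof.
move=> Hu; have [[v1 v2] /is_weak_derivativeP[d1 d2]] := weak_derivativeP Hu.
have [[u1 u2] _] := Hu.
have [a na ae1] := wder_ac2 u1 v1 d1; have [b nb ae2] := wder_ac2 u2 v2 d2.
exists (fun x => Complex (a x) (b x)); first by split.
by apply: aeS (aeI ae1 ae2) => x [/= -> ->]; case: (u x).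
Qed.

Lemma ac2D (f g f' g' : R -> R) : ac2 f f' -> ac2 g g' ->
  ac2 (fun x => f x + g x) (fun x => f' x + g' x).
Proof.
move=> [f1 f2 fE] [g1 g2 gE]; split; [exact: L2rD|exact: L2rD|] => x y xy.
rewrite RintegralD ?itg_L2r_itv//.
by rewrite -fE// -gE//; ring.
Qed.

Lemma ac2Z (c : R) (f f' : R -> R) : ac2 f f' ->
  ac2 (fun x => c * f x) (fun x => c * f' x).
Proof.
move=> [f1 f2 fE]; split; [exact: L2rZ|exact: L2rZ|] => x y xy.
rewrite RintegralZl ?itg_L2r_itv//.
by rewrite -fE// mulrBr.
Qed.

Lemma sobolevD u v u' v' : sobolev u v -> sobolev u' v' ->
  sobolev (fun x => u x + u' x) (fun x => v x + v' x).
Proof.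
move=> [a1 a2] [b1 b2]; split.
  by under eq_fun do rewrite ReD; under [X in ac2 _ X]eq_fun do rewrite ReD; exact: ac2D.
by under eq_fun do rewrite ImD; under [X in ac2 _ X]eq_fun do rewrite ImD; exact: ac2D.
Qed.

Lemma sobolevZ z u v : sobolev u v -> sobolev (fun x => z * u x) (fun x => z * v x).
Proof.
move=> [a1 a2]; split.
  under eq_fun do rewrite ReM -mulNr; under [X in ac2 _ X]eq_fun do rewrite ReM -mulNr.
  by apply: ac2D; exact: ac2Z.
under eq_fun do rewrite ImM; under [X in ac2 _ X]eq_fun do rewrite ImM.
by apply: ac2D; exact: ac2Z.
Qed.

Lemma sobolevB u v u' v' : sobolev u v -> sobolev u' v' ->
  sobolev (fun x => u x - u' x) (fun x => v x - v' x).
Proof.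
move=> uv /(sobolevZ (-1)) /(sobolevD uv).
by under eq_fun do rewrite mulN1r; under [X in sobolev _ X]eq_fun do rewrite mulN1r.
Qed.

(** The source of all calculation rules for the chosen [weak_derivative]: [v] is also a weak
    derivative of [u'], and two of them agree almost everywhere. *)
Lemma H1_ae u u' v : sobolev u v -> L2 u' -> {ae mu, forall x, u x = u' x} ->
  H1 u' /\ {ae mu, forall x, weak_derivative u' x = v x}.
Proof.
move=> uv hu' uu; have [hu hv] := sobolev_L2 uv.
have wd : is_weak_derivative u' v.
  have [[d1 d2] [m1 m2]] : (wder (fun x => Re (u x)) (fun x => Re (v x)) /\
      wder (fun x => Im (u x)) (fun x => Im (v x))) /\ L2 u.
    by split => //; case: uv => /ac2_wder ? /ac2_wder ?.
  have [[M1 M2] [M3 M4]] := (L2_meas hu, L2_meas hu').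
  apply/is_weak_derivativeP; split=> psi tpsi.
  - have [A [_ cpsi _ _ _]] := test_function_support tpsi.
    have mpsi : mfn setT (derive1 psi) by exact: continuous_measurable_fun.
    rewrite -d1//; apply: ae_eq_Rintegral; try exact: measurable_funM.
    by apply: aeS uu => x ->.
  - have [A [_ cpsi _ _ _]] := test_function_support tpsi.
    have mpsi : mfn setT (derive1 psi) by exact: continuous_measurable_fun.
    rewrite -d2//; apply: ae_eq_Rintegral; try exact: measurable_funM.
    by apply: aeS uu => x ->.
have Hu' : H1 u' by split => //; exists v.
split=> //; have [L2w w] := weak_derivativeP Hu'.
exact: (is_weak_derivative_unique hu').
Qed.

Lemma H1_L2 u : H1 u -> L2 u. Proof. by case. Qed.

Lemma H1_L2' u : H1 u -> L2 (weak_derivative u).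
Proof. by move=> /weak_derivativeP[]. Qed.

Lemma H1D u w : H1 u -> H1 w -> H1 (fun x => u x + w x) /\
  {ae mu, forall x, weak_derivative (fun x => u x + w x) x =
                    weak_derivative u x + weak_derivative w x}.
Proof.
move=> Hu Hw; have [u' nu eu] := H1_sobolev Hu; have [w' nw ew] := H1_sobolev Hw.
apply: (H1_ae (sobolevD nu nw)); first by apply: L2D; exact: H1_L2.
by apply: aeS (aeI eu ew) => x [-> ->].
Qed.

Lemma H1B u w : H1 u -> H1 w -> H1 (fun x => u x - w x) /\
  {ae mu, forall x, weak_derivative (fun x => u x - w x) x =
                    weak_derivative u x - weak_derivative w x}.
Proof.
move=> Hu Hw; have [u' nu eu] := H1_sobolev Hu; have [w' nw ew] := H1_sobolev Hw.
apply: (H1_ae (sobolevB nu nw)); first by apply: L2B; exact: H1_L2.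
by apply: aeS (aeI eu ew) => x [-> ->].
Qed.

Lemma H1Z z u : H1 u -> H1 (fun x => z * u x) /\
  {ae mu, forall x, weak_derivative (fun x => z * u x) x =
                    z * weak_derivative u x}.
Proof.
move=> Hu; have [u' nu eu] := H1_sobolev Hu.
apply: (H1_ae (sobolevZ z nu)); first by apply: L2Z; exact: H1_L2.
by apply: aeS eu => x ->.
Qed.

End ComplexFunctions.

(** * Affine changes of variable *)

Section AffineChange.
Context {R : realType}.
Implicit Types (f g h : R -> R).

Definition affine (c d : R) (x : measurableTypeR R) : measurableTypeR R :=
  c * x + d.

Lemma measurable_affine c d : measurable_fun setT (affine c d).
Proof.
have h : measurable_fun setT (fun x : R => c * x + d).
  by apply: measurable_funD => //; apply: measurable_funM.
exact: h.
Qed.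

Definition affine_push c d : {measure set (measurableTypeR R) -> \bar R} :=
  measure_function_pushforward__canonical__measure_function_Measure
    mu (measurable_affine c d).

(** The preimage of a half-open interval is an interval whose length is divided by [c]; after
    multiplication by [c], uniqueness of the Lebesgue measure applies. *)
Lemma affine_pushE (c d : R) (c0 : 0 < c) (A : set R) : msb A ->
  mscale (NngNum (ltW c0)) (affine_push c d) A = mu A.
Proof.
move=> mA; apply/esym/lebesgue_measure_unique => //= _ [[a b]] _ <-.
rewrite /mscale/= /pushforward.
have -> : affine c d @^-1` `]a, b] = `](a - d) / c, (b - d) / c]%classic.
  apply/seteqP; split => x /=; rewrite !in_itv/= /affine;
  by rewrite ltr_pdivrMr// ler_pdivlMr// ltrBlDr lerBrDr mulrC.
rewrite !lebesgue_measure_itv/= !lte_fin ltr_pM2r ?invr_gt0// ltrD2r.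
case: ifP => _; last by rewrite mule0.
rewrite -!EFinD -EFinM; congr EFin; field.
by rewrite gt_eqF.
Qed.

Lemma ge0_integral_affine (c d : R) (f : R -> \bar R) : 0 < c ->
  measurable_fun setT f -> (forall x, (0 <= f x)%E) ->
  (\int[mu]_x f x = c%:E * \int[mu]_x f (c * x + d)%R)%E.
Proof.
move=> c0 mf f0.
transitivity (\int[mscale (NngNum (ltW c0)) (affine_push c d)]_x f x)%E.
  apply: eq_measure_integral => A mA _; exact/esym/affine_pushE.
rewrite ge0_integral_mscale//; congr (_ * _)%E.
by rewrite ge0_integral_pushforward//; exact: measurable_affine.
Qed.

Lemma itg_affine c d f : 0 < c -> itg setT f -> itg setT (fun x => f (c * x + d)).
Proof.
move=> c0 hf; have mf := itg_measurable hf.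
have mf' : mfn setT (fun x => f (c * x + d)).
  exact: (measurableT_comp mf (measurable_affine c d)).
move: (hf) => /integrableP[_ hf2]; apply/integrableP.
split; first exact/measurable_EFinP.
move: hf2; rewrite (@ge0_integral_affine c d)//; last first.
  by apply: measurableT_comp => //; exact/measurable_EFinP.
move=> h; rewrite ltey; apply/eqP => hy; move: h; rewrite /= hy.
by rewrite gt0_muley ?lte_fin// ltxx.
Qed.

Lemma Rintegral_affine c d f : 0 < c -> itg setT f ->
  \int[mu]_x f x = c * \int[mu]_x f (c * x + d).
Proof.
move=> c0 hf; have hf' := itg_affine d c0 hf.
have ge0 g : itg setT g -> (forall x, 0 <= g x) ->
    \int[mu]_x g x = c * \int[mu]_x g (c * x + d).
  move=> hg g0; rewrite /Rintegral (@ge0_integral_affine c d)//; last first.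
    by apply/measurable_EFinP; exact: itg_measurable.
  rewrite fineM// integrable_fin_num//; exact: itg_affine.
have hn : itg setT (fun x => `|f x|) by exact: itg_norm.
have hn' := itg_affine d c0 hn.
(* The formula for nonnegative functions is applied to f + |f| and to |f|, and the difference is
   taken. *)
have e1 : \int[mu]_x (f x + `|f x|) = c * \int[mu]_x (f (c * x + d) + `|f (c * x + d)|).
  apply: (ge0 (fun x => f x + `|f x|)); first exact: itgD.
  by move=> x; have := ler_norm (- f x); rewrite normrN; lra.
have e2 := ge0 _ hn (fun x => normr_ge0 _).
by move: e1; rewrite !RintegralD// e2 mulrDr => /addIr.
Qed.

Lemma L2r_affine c d f : 0 < c -> L2r f -> L2r (fun x => f (c * x + d)).
Proof.
move=> c0 /L2rP[mf hf]; apply/L2rP; split.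
  exact: (measurableT_comp mf (measurable_affine c d)).
have := itg_affine d c0 hf; exact.
Qed.

Lemma Rintegral_affine_itv c d f (x y : R) : 0 < c -> L2r f -> x <= y ->
  \int[mu]_(t in `[c * x + d, c * y + d]) f t =
  c * \int[mu]_(t in `[x, y]) f (c * t + d).
Proof.
move=> c0 hf xy; rewrite [LHS]Rintegral_mkcond [in RHS]Rintegral_mkcond.
rewrite (@Rintegral_affine c d)//; last first.
  by apply: itg_restrict; [exact: msb_itv|exact: itg_L2r_itv].
congr (_ * _); apply: eq_Rintegral => t _; rewrite !patchE.
by rewrite !mem_setE !in_itv/= !lerD2r !ler_pM2l.
Qed.

Lemma ac2_affine c d f g : 0 < c -> ac2 f g ->
  ac2 (fun x => f (c * x + d)) (fun x => c * g (c * x + d)).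
Proof.
move=> c0 [hf hg fg]; split; first exact: L2r_affine.
  by apply: L2rZ; exact: L2r_affine.
move=> x y xy; rewrite fg ?lerD2r ?ler_pM2l// Rintegral_affine_itv//.
rewrite RintegralZl//; apply: itg_L2r_itv; exact: L2r_affine.
Qed.

End AffineChange.

(** * Gluing two functions at a point *)

Section Glue.
Context {R : realType}.
Implicit Types (f g h : R -> R).

Definition glue {T : Type} (a : R) (f g : R -> T) (x : R) : T :=
  if x <= a then f x else g x.

Lemma itg_glue a f g : itg setT f -> itg setT g -> itg setT (glue a f g).
Proof.
move=> hf hg.
rewrite (_ : glue a f g = fun x => (f \_ `]-oo, a]) x + (g \_ `]a, +oo[) x).
  apply: itgD => //; (apply: itg_restrict; first exact: msb_itv);
  by apply: itg_sub => //; exact: msb_itv.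
apply/funext => x; rewrite /glue !patchE !mem_setE !in_itv/= andbT.
by case: leP; rewrite ?addr0 ?add0r.
Qed.

Lemma mfn_glue a f g : mfn setT f -> mfn setT g -> mfn setT (glue a f g).
Proof.
move=> hf hg.
rewrite (_ : glue a f g = fun x => (f \_ `]-oo, a]) x + (g \_ `]a, +oo[) x).
  apply: measurable_funD; (apply/(measurable_restrictT _ _).1; first exact: msb_itv);
  exact: measurable_funTS.
apply/funext => x; rewrite /glue !patchE !mem_setE !in_itv/= andbT.
by case: leP; rewrite ?addr0 ?add0r.
Qed.

Lemma L2r_glue a f g : L2r f -> L2r g -> L2r (glue a f g).
Proof.
move=> /L2rP[mf hf] /L2rP[mg hg]; apply/L2rP; split; first exact: mfn_glue.
rewrite (_ : (fun x => _) = glue a (fun x => f x ^+ 2) (fun x => g x ^+ 2)).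
  exact: itg_glue.
by apply/funext => x; rewrite /glue; case: ifP.
Qed.

Lemma ac2_glue a f g f' g' : ac2 f f' -> ac2 g g' -> f a = g a ->
  ac2 (glue a f g) (glue a f' g').
Proof.
move=> [hf hf' fE] [hg hg' gE] fga.
have L2g := L2r_glue a hf' hg'.
split => //; first exact: L2r_glue.
have iG (x y : R) : itg `[x, y] (glue a f' g') by exact: itg_L2r_itv.
have left_ x y : x <= y -> y <= a ->
    f y - f x = \int[mu]_(t in `[x, y]) glue a f' g' t.
  move=> xy ya; rewrite fE//; apply: eq_Rintegral => t.
  by rewrite inE/= in_itv/= /glue => /andP[_ ty]; rewrite (le_trans ty ya).
have right_ x y : x <= y -> a <= x ->
    g y - g x = \int[mu]_(t in `[x, y]) glue a f' g' t.
  move=> xy ax; rewrite gE//.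
  have itv_sub (h : R -> R) : itg `[x, y] h -> itg `]x, y] h.
    move=> hh; apply: integrableS hh; [exact: msb_itv|exact: msb_itv|].
    by move=> t /=; rewrite !in_itv/= => /andP[/ltW -> ->].
  rewrite -[RHS]Rintegral_itv_obnd_cbnd; last exact: itv_sub.
  rewrite -[LHS]Rintegral_itv_obnd_cbnd; last by apply: itv_sub; exact: itg_L2r_itv.
  apply: eq_Rintegral => t; rewrite inE/= in_itv/= /glue => /andP[xt _].
  by rewrite leNgt (le_lt_trans ax xt).
move=> x y xy; rewrite /glue -/(glue a f' g').
have [xa|ax] := leP x a; have [ya|ay] := leP y a.
- exact: left_.
- rewrite (@Rintegral_itv_split _ _ x a y)// ?ltW//.
  by rewrite -left_// -right_// ?ltW// fga; ring.
- by move: (lt_le_trans ax xy); rewrite ltNge ya.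
- by apply: right_ => //; exact: ltW.
Qed.

Lemma Rintegral_tail_small f (e : R) : itg setT f -> (forall x, 0 <= f x) ->
  0 < e -> exists2 N : R, 0 <= N &
    \int[mu]_x f x - e <= \int[mu]_(x in `[- N, N]) f x.
Proof.
move=> hf f0 e0.
pose F (n : nat) : set (measurableTypeR R) := `[- (n%:R : R), n%:R]%classic.
have mF i : measurable (F i) by exact: msb_itv.
have ndF : nondecreasing_seq F.
  move=> m n mn; apply/subsetPset => x; rewrite /F /= !in_itv/= => /andP[h1 h2].
  have : m%:R <= n%:R :> R by rewrite ler_nat.
  by move=> ?; apply/andP; split; lra.
have FT : \bigcup_i F i = setT.
  apply/seteqP; split=> // x _; exists (Num.truncn `|x|).+1 => //.
  rewrite /F/= in_itv/= -ler_norml ltW//; exact: Num.Theory.truncnS_gt.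
have mf : measurable_fun setT (EFin \o f) by apply/measurable_EFinP; exact: itg_measurable.
have := @ge0_nondecreasing_set_cvg_integral _ (measurableTypeR R) R F (EFin \o f)
  mu ndF mF (fun i => measurable_funTS mf).
move=> /(_ _)/wrap[]; first by move=> i x _; rewrite lee_fin.
rewrite FT => h.
have hfin : (\int[mu]_x (EFin \o f) x \is a fin_num)%E by exact: integrable_fin_num.
move: h; rewrite -(fineK hfin) => /fine_cvgP[_ /cvgrPdist_le /(_ _ e0)[N _ hN]].
exists N%:R => //; have := hN N (leqnn _).
by rewrite /= ler_distlC => /andP[h _]; exact: h.
Qed.

End Glue.

(** * Potential and energy *)

Section SupBounds.
Context {R : realType}.
Implicit Types (u v w : R -> R[i]) (z : R[i]).

Lemma mass_ReIm u : L2 u ->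
  mass u = \int[mu]_x (Re (u x) ^+ 2) + \int[mu]_x (Im (u x) ^+ 2).
Proof.
move=> [h1 h2]; rewrite -RintegralD//; try exact: L2r_sq.
by apply: eq_Rintegral => x _; rewrite cabs_sqr.
Qed.

Lemma sobolev_holder u v (x y : R) : sobolev u v ->
  cabs (u y - u x) ^+ 2 <= `|y - x| * mass v.
Proof.
move=> uv; have [_ hv] := sobolev_L2 uv; case: uv => n1 n2.
rewrite cabs_sqr ReB ImB mass_ReIm// mulrDr.
exact: lerD (ac2_holder x y n1) (ac2_holder x y n2).
Qed.

Lemma sobolev_continuous u v : sobolev u v ->
  continuous (fun x => Re (u x)) /\ continuous (fun x => Im (u x)).
Proof. by move=> [n1 n2]; split; [exact: ac2_continuous n1|exact: ac2_continuous n2]. Qed.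

Lemma sobolev_sqr_continuous u v : sobolev u v -> continuous (fun x => cabs (u x) ^+ 2).
Proof.
move=> /sobolev_continuous[c1 c2] x.
rewrite (_ : (fun x => _) = fun x => Re (u x) * Re (u x) + Im (u x) * Im (u x)).
  have e1 := @continuousM R R _ _ x (c1 x) (c1 x).
  have e2 := @continuousM R R _ _ x (c2 x) (c2 x).
  exact: (continuousD e1 e2).
by apply/funext => y; rewrite cabs_sqr !expr2.
Qed.

(** The minimum of |u|^2 over an interval of length [h] is at most its mean there. Besides the sup
    bound, this supplies the cutting points in [tightness]. *)
Lemma sobolev_small_point u v (x h : R) : sobolev u v -> 0 < h ->
  exists a, [/\ x <= a, a <= x + h & cabs (u a) ^+ 2 <= mass u / h].
Proof.
move=> uv h0; have [hu _] := sobolev_L2 uv.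
have cu := sobolev_sqr_continuous uv.
have xh : x <= x + h by rewrite lerDl ltW.
have [a ax ha] := EVT_min xh (continuous_subspaceT cu).
move: ax; rewrite in_itv/= => /andP[xa axh]; exists a; split=> //.
rewrite ler_pdivlMr//.
apply: (@le_trans _ _ (\int[mu]_(t in `[x, x + h]) (cabs (u t) ^+ 2))).
  have {1}-> : h = x + h - x by ring.
  rewrite -Rintegral_cst_itv//; apply: le_Rintegral => //.
  - exact: itg_cst_itv.
  - exact: itg_continuous.
apply: Rintegral_le_setT; [exact: msb_itv|exact: itg_mass|].
by move=> t; exact: sqr_ge0.
Qed.

Lemma cabsD_sqr z z' : cabs (z + z') ^+ 2 <= 2 * cabs z ^+ 2 + 2 * cabs z' ^+ 2.
Proof.
rewrite !cabs_sqr ReD ImD.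
have := sqr_ge0 (Re z - Re z'); have := sqr_ge0 (Im z - Im z'); nra.
Qed.

(** Compare [u x] with the small value found within distance [h]. The length stays free because its
    choice matters: 1 gives the embedding into bounded functions, a value adapted to mass and
    kinetic energy gives [en_coercive], and a large value gives [pot_ge_small]. *)
Lemma sobolev_sup u v (x h : R) : sobolev u v -> 0 < h ->
  cabs (u x) ^+ 2 <= 2 * (mass u / h) + 2 * (h * mass v).
Proof.
move=> uv h0; have [a [xa axh ha]] := sobolev_small_point x uv h0.
rewrite -[u x](subrK (u a)) addrC.
apply: le_trans (cabsD_sqr _ _) _; rewrite lerD// ler_wpM2l//.
apply: le_trans (sobolev_holder _ _ uv) _; rewrite ler_wpM2r ?mass_ge0//.
by rewrite distrC ger0_norm ?subr_ge0//; lra.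
Qed.

Lemma H1_dotE u : H1_dot u u = mass u + mass (weak_derivative u).
Proof. by rewrite /H1_dot !massE. Qed.

Lemma H1_bounded u : H1 u ->
  {ae mu, forall x, cabs (u x) ^+ 2 <= 2 * H1_dot u u}.
Proof.
move=> Hu; have [w nw wu] := H1_sobolev Hu.
have [hw _] := sobolev_L2 nw; have hu := H1_L2 Hu.
have mE := mass_ae hw hu wu.
apply: aeS wu => x <-; have := sobolev_sup x nw ltr01.
by rewrite mE divr1 mul1r H1_dotE mulrDr.
Qed.

Lemma cabs_dot_le z z' : Re z * Re z' + Im z * Im z' <= cabs z * cabs z'.
Proof.
apply: le_trans (ler_norm _) _; apply: normr_le_sqr.
  by rewrite mulr_ge0 ?cabs_ge0.
rewrite exprMn !cabs_sqr; have := sqr_ge0 (Re z * Im z' - Im z * Re z'); nra.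
Qed.

Lemma cabs_dist_sqr z z' : (cabs z - cabs z') ^+ 2 <= cabs (z - z') ^+ 2.
Proof.
rewrite cabs_sqr ReB ImB sqrrB !cabs_sqr; have := cabs_dot_le z z'; nra.
Qed.

Lemma cabs_dist z z' : `|cabs z - cabs z'| <= cabs (z - z').
Proof. by apply: normr_le_sqr; rewrite ?cabs_ge0// cabs_dist_sqr. Qed.

Lemma mfn_cabs u : L2 u -> mfn setT (fun x => cabs (u x)).
Proof.
move=> /L2_meas[m1 m2].
rewrite (_ : (fun x => _) = fun x => Num.sqrt (Re (u x) ^+ 2 + Im (u x) ^+ 2)).
  have ms : mfn setT (@Num.sqrt R).
    by apply: continuous_measurable_fun; exact: sqrt_continuous.
  apply: (measurableT_comp ms); apply: measurable_funD; exact: measurable_funX.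
by apply/funext => x; case: (u x).
Qed.

Lemma ae_le_Rintegral (f g : R -> R) : itg setT f -> itg setT g ->
  {ae mu, forall x, f x <= g x} -> \int[mu]_x f x <= \int[mu]_x g x.
Proof.
move=> hf hg fg; have mf := itg_measurable hf; have mg := itg_measurable hg.
have mm : mfn setT (fun x => Num.min (f x) (g x)) by exact: measurable_minr.
have em : {ae mu, forall x, Num.min (f x) (g x) = f x}.
  by apply: aeS fg => x; exact: min_l.
have hm := itg_ae mm hf em.
rewrite -(ae_eq_Rintegral mm mf em); apply: le_Rintegral => // x _.
by rewrite ge_min lexx orbT.
Qed.

Lemma ae_itg_le (f g : R -> R) : mfn setT f -> itg setT g ->
  {ae mu, forall x, `|f x| <= g x} -> itg setT f.
Proof.
move=> mf hg fg; have mg := itg_measurable hg.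
(* The truncation of [f] at height |g| is dominated everywhere and equals [f] almost everywhere. *)
pose f' x := Num.min (Num.max (f x) (- `|g x|)) `|g x|.
have mg' : mfn setT (fun x => `|g x|) by exact: measurableT_comp.
have mf' : mfn setT f'.
  apply: measurable_minr => //; apply: measurable_maxr => //.
  exact: measurable_funN.
apply: (@itg_ae _ f f') => //.
  apply: (itg_le measurableT mf' (itg_norm measurableT hg)) => x _.
  rewrite /f' ler_norml ge_min lexx orbT andbT le_min le_max lexx orbT/=.
  by have := normr_ge0 (g x); lra.
apply: aeS fg => x fg; have gg := ler_norm (g x).
have : `|f x| <= `|g x| by exact: le_trans gg.
by rewrite ler_norml => /andP[h1 h2]; rewrite /f' max_l// min_l.
Qed.

End SupBounds.

(** The form in which the assumptions on [f] and [G] enter. [nl_lip] comes from the C^1 regularity;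
    [nl_small] from p > 2, and it excludes vanishing; [nl_low] from p_* < 6, which makes the sextic
    coefficient as small as desired at the price of a quadratic term; [nl_neg] is G1 moved to the
    half-line by evenness of [G]. *)
Record nonlinearity {R : realType} (G g : R -> R) : Prop := {
  nl_derive : forall s : R, is_derive s 1 G (g s);
  nl_G0 : G 0 = 0;
  nl_g0 : g 0 = 0;
  nl_lip : forall B : R, 0 <= B -> exists2 L : R, 0 <= L &
    forall x y, 0 <= x <= B -> 0 <= y <= B -> `|g x - g y| <= L * `|x - y|;
  nl_small : forall e : R, 0 < e -> exists2 d : R, 0 < d &
    forall s, 0 <= s <= d -> `|G s| <= e * s ^+ 2;
  nl_low : forall e : R, 0 < e -> exists2 K : R, 0 <= K &
    forall s, 0 <= s -> - K * s ^+ 2 - e * s ^+ 6 <= G s;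
  nl_neg : exists2 s : R, 0 <= s & G s < 0 }.

Section Potential.
Context {R : realType}.
Variables G g : R -> R.
Hypothesis nl : nonlinearity G g.
Let dG := nl_derive nl.
Let G0 := nl_G0 nl.
Let g0 := nl_g0 nl.
Let gLip := nl_lip nl.
Let Gsmall := nl_small nl.
Let Glow := nl_low nl.
Implicit Types (u v w : R -> R[i]) (z : R[i]).

Definition pot u := \int[mu]_x G (cabs (u x)).

Lemma G_continuous : continuous G.
Proof.
move=> x; apply/differentiable_continuous/derivable1_diffP; by case: (dG x).
Qed.

Lemma g_bound (B : R) : 0 <= B -> exists2 L : R, 0 <= L &
  forall x, 0 <= x <= B -> `|g x| <= L * x.
Proof.
move=> B0; have [L L0 hL] := gLip B0; exists L => // x xB.
have := hL x 0 xB; rewrite lexx B0 => /(_ isT); rewrite g0 !subr0.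
by rewrite [`|x|]ger0_norm//; case/andP: xB.
Qed.

Lemma G_dist (B : R) : 0 <= B -> exists2 L : R, 0 <= L &
  forall x y, 0 <= x <= B -> 0 <= y <= B ->
    `|G x - G y| <= L * ((x + y) * `|x - y|).
Proof.
move=> B0; have [L L0 hL] := g_bound B0; exists L => // x y.
wlog yx : x y / y <= x.
  move=> H xB yB; have [/H|/ltW/H] := leP y x; first exact.
  by rewrite distrC [`|y - x|]distrC [y + x]addrC; apply.
move=> /andP[x0 xB] /andP[y0 yB]; have [c /andP[yc cx] ->] := MVT_all yx dG.
rewrite normrM mulrA ler_wpM2r//; apply: le_trans (hL _ _) _.
  by apply/andP; split; lra.
by rewrite ler_wpM2l//; lra.
Qed.

Lemma G_quad (B : R) : 0 <= B -> exists2 L : R, 0 <= L &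
  forall x, 0 <= x <= B -> `|G x| <= L * x ^+ 2.
Proof.
move=> B0; have [L L0 hL] := G_dist B0; exists L => // x xB.
have := hL x 0 xB; rewrite lexx B0 => /(_ isT); rewrite G0 !subr0 addr0.
by rewrite [`|x|]ger0_norm ?expr2//; case/andP: xB.
Qed.

Lemma mfn_pot u : L2 u -> mfn setT (fun x => G (cabs (u x))).
Proof.
move=> hu; apply: measurableT_comp; last exact: mfn_cabs.
by apply: continuous_measurable_fun; exact: G_continuous.
Qed.

Lemma itg_pot u (B : R) : L2 u -> 0 <= B -> {ae mu, forall x, cabs (u x) <= B} ->
  itg setT (fun x => G (cabs (u x))).
Proof.
move=> hu B0 uB; have [L L0 hL] := G_quad B0.
apply: (ae_itg_le (g := fun x => L * cabs (u x) ^+ 2)); first exact: mfn_pot.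
  by apply: itgZ => //; exact: itg_mass.
by apply: aeS uB => x xB; apply: hL; rewrite cabs_ge0.
Qed.

(** By the mean value theorem the integrand is at most a constant times (|u| + |w|) |u - w|. The
    weight [e] in the splitting of this product stays free: chosen small first, it leaves a bound
    that tends to 0 with the L^2 distance. *)
Lemma pot_dist (B : R) : 0 <= B -> exists2 L : R, 0 <= L & forall u w (e : R),
  L2 u -> L2 w -> {ae mu, forall x, cabs (u x) <= B} ->
  {ae mu, forall x, cabs (w x) <= B} -> 0 < e ->
  `|pot u - pot w| <=
    L * (e * (mass u + mass w) + mass (fun x => u x - w x) / e).
Proof.
move=> B0; have [L L0 hL] := G_dist B0; exists L => // u w e hu hw uB wB e0.
have iu := itg_pot hu B0 uB; have iw := itg_pot hw B0 wB.
rewrite /pot -RintegralB//; apply: le_trans (le_normr_Rintegral _ _) _ => //.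
  exact: itgB.
have mu1 := itg_mass hu; have mw1 := itg_mass hw; have md := itg_mass (L2B hu hw).
have E : L * (e * (mass u + mass w) + mass (fun x => u x - w x) / e) =
    \int[mu]_x (L * (e * (cabs (u x) ^+ 2 + cabs (w x) ^+ 2) +
                e^-1 * cabs (u x - w x) ^+ 2)).
  rewrite RintegralZl//; last first.
    by apply: itgD => //; [apply: itgZ => //; exact: itgD|exact: itgZ].
  rewrite RintegralD//; last 2 first.
  - by apply: itgZ => //; exact: itgD.
  - exact: itgZ.
  by rewrite !RintegralZl//; [rewrite RintegralD// /mass; ring|exact: itgD].
rewrite E; apply: ae_le_Rintegral.
- by apply: itg_norm => //; exact: itgB.
- apply: itgZ => //; apply: itgD => //; first by apply: itgZ => //; exact: itgD.
  exact: itgZ.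
apply: aeS (aeI uB wB) => x [ux wx].
apply: le_trans (hL _ _ _ _) _; rewrite ?cabs_ge0//.
rewrite ler_wpM2l//; set a := cabs (u x); set b := cabs (w x).
have d := cabs_dist (u x) (w x); rewrite -/a -/b in d.
set c := cabs (u x - w x) in d *.
have a0 : 0 <= a by exact: cabs_ge0.
have b0 : 0 <= b by exact: cabs_ge0.
apply: (@le_trans _ _ ((a + b) * c)); first by rewrite ler_wpM2l// addr_ge0.
(* AM-GM with weight e *)
have t1 : 0 <= e * (a - b) ^+ 2 by rewrite mulr_ge0 ?sqr_ge0// ltW.
have t2 : 0 <= e^-1 * c ^+ 2 by rewrite mulr_ge0 ?sqr_ge0// invr_ge0 ltW.
have : 0 <= e / 2 * ((a + b) - e^-1 * c) ^+ 2.
  by rewrite mulr_ge0 ?sqr_ge0// divr_ge0// ltW.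
have -> : e / 2 * (a + b - e^-1 * c) ^+ 2 =
    e / 2 * (a + b) ^+ 2 - (a + b) * c + e^-1 * c ^+ 2 / 2.
  by field; rewrite gt_eqF.
lra.
Qed.

Lemma pot_ge u (c B : R) : L2 u -> 0 <= B -> (forall x, cabs (u x) <= B) ->
  (forall s, 0 <= s <= B -> - c * s ^+ 2 <= G s) -> - c * mass u <= pot u.
Proof.
move=> hu B0 uB hc.
have iu : itg setT (fun x => G (cabs (u x))).
  by apply: (itg_pot hu B0); exact: aeT.
rewrite /mass -RintegralZl//; last exact: itg_mass.
apply: le_Rintegral => //; first by apply: itgZ => //; exact: itg_mass.
by move=> x _; apply: hc; rewrite cabs_ge0 uB.
Qed.

Lemma sobolev_bounded u v : sobolev u v ->
  exists2 B : R, 0 <= B & forall x, cabs (u x) <= B.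
Proof.
move=> uv; pose S := 2 * mass u + 2 * mass v + 1.
have S1 : 1 <= S by have := mass_ge0 u; have := mass_ge0 v; rewrite /S; lra.
exists S; first by lra.
move=> x; have := sobolev_sup x uv ltr01; rewrite divr1 mul1r => h.
apply: le_trans (ler_norm _) _; apply: normr_le_sqr; first by lra.
by rewrite /S; move: S1 h; rewrite /S; nra.
Qed.

Lemma itg_pot_sobolev u v : sobolev u v -> itg setT (fun x => G (cabs (u x))).
Proof.
move=> uv; have [B B0 uB] := sobolev_bounded uv; have [hu _] := sobolev_L2 uv.
by apply: (itg_pot hu B0); exact: aeT.
Qed.

Definition en u v := 2^-1 * mass v + pot u.

(* Subcriticality: the sextic term is controlled via the sup bound with
   h = sqrt (lambda / (K + 1)), which yields |u|^4 <= 16 lambda (K + 1). *)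
Lemma en_coercive (lambda : R) : 0 < lambda ->
  exists2 C : R, 0 <= C & forall u v, sobolev u v -> mass u <= lambda ->
    mass v / 4 - C <= en u v.
Proof.
(* With the bound 16 lambda (k + 1) on |u|^4 and mass at most lambda, this coefficient makes the
   sextic term at most (k + 1) / 4, which is half of the kinetic energy up to a constant. *)
move=> l0; pose e := (64 * lambda ^+ 2)^-1.
have e0 : 0 < e by rewrite invr_gt0 mulr_gt0// exprn_gt0.
have [K K0 hK] := Glow e0.
exists (K * lambda + 4^-1); first by rewrite addr_ge0// ?mulr_ge0// ltW.
move=> u v uv ul; have [hu hv] := sobolev_L2 uv.
have m0 := mass_ge0 u; have k0 := mass_ge0 v.
set k := mass v in k0 *; set m := mass u in ul m0 *.
have k1 : 0 < k + 1 by rewrite ltr_wpDl.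
pose h := Num.sqrt (lambda / (k + 1)).
have h0 : 0 < h by rewrite sqrtr_gt0 divr_gt0.
have hh : h ^+ 2 = lambda / (k + 1) by rewrite sqr_sqrtr// divr_ge0// ltW.
have hk : h * (k + 1) = lambda / h.
  have hn : h != 0 by rewrite gt_eqF.
  apply: (mulIf hn); rewrite divfK// mulrAC -expr2 hh divfK// gt_eqF//.
pose B2 := 4 * (lambda / h).
have uB x : cabs (u x) ^+ 2 <= B2.
  have := sobolev_sup x uv h0; rewrite -/k -/m => H; apply: le_trans H _.
  have : m / h <= lambda / h by rewrite ler_pM2r ?invr_gt0.
  have : h * k <= lambda / h by rewrite -hk ler_pM2l// lerDl.
  rewrite /B2; lra.
have B22 : B2 ^+ 2 = 16 * lambda * (k + 1).
  rewrite /B2 exprMn expr_div_n hh; field.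
  by rewrite !gt_eqF.
have B20 : 0 <= B2 by apply: mulr_ge0 => //; apply: divr_ge0; exact: ltW.
have pu : - (K + e * B2 ^+ 2) * m <= pot u.
  apply: (@pot_ge u _ (Num.sqrt B2)) => //.
    move=> x; rewrite -[cabs _]ger0_norm ?cabs_ge0//; apply: normr_le_sqr.
      exact: sqrtr_ge0.
    by rewrite sqr_sqrtr.
  move=> s /andP[s0 sB]; apply: le_trans (hK _ s0).
  have s2 : s ^+ 2 <= B2.
    by rewrite -(sqr_sqrtr B20) lerXn2r ?nnegrE// sqrtr_ge0.
  have : e * s ^+ 6 <= e * (B2 ^+ 2 * s ^+ 2).
    rewrite ler_pM2l// (_ : s ^+ 6 = (s ^+ 2) ^+ 2 * s ^+ 2); last by ring.
    by rewrite ler_wpM2r ?sqr_ge0// lerXn2r ?nnegrE ?sqr_ge0.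
  nra.
have : e * B2 ^+ 2 * m <= (k + 1) / 4.
  rewrite B22.
  have l1 : 0 <= lambda by exact: ltW.
  have k2 : 0 <= k + 1 by exact: ltW.
  apply: (@le_trans _ _ (e * (16 * lambda * (k + 1)) * lambda)).
    by rewrite ler_wpM2l// mulr_ge0 ?(ltW e0)// mulr_ge0// mulr_ge0.
  rewrite le_eqVlt; apply/orP; left; apply/eqP; rewrite /e; field.
  by rewrite gt_eqF.
have : K * m <= K * lambda by rewrite ler_wpM2l.
rewrite /en -/k; move: pu; rewrite mulNr mulrDl; lra.
Qed.

(** A spread-out function of small kinetic energy is small everywhere: [sobolev_sup] with a large
    [h] gives |u| <= d, and below [d] the potential is at least -e s^2. *)
Lemma pot_ge_small (lambda e : R) : 0 < lambda -> 0 < e ->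
  exists2 k : R, 0 < k & forall u v, sobolev u v -> mass u <= lambda ->
    mass v <= k -> - e * mass u <= pot u.
Proof.
move=> l0 e0; have [d d0 hd] := Gsmall e0.
pose h := 4 * lambda / d ^+ 2.
have d2 : 0 < d ^+ 2 by rewrite exprn_gt0.
have h0 : 0 < h by rewrite divr_gt0// mulr_gt0.
exists (d ^+ 2 / (4 * h)); first by rewrite divr_gt0// mulr_gt0.
move=> u v uv ul vk; have [hu _] := sobolev_L2 uv.
apply: (@pot_ge u e d) => //; first exact: ltW.
  move=> x; rewrite -[cabs _]ger0_norm ?cabs_ge0//; apply: normr_le_sqr.
    exact: ltW.
  apply: le_trans (sobolev_sup x uv h0) _.
  have : mass u / h <= d ^+ 2 / 4.
    have -> : d ^+ 2 / 4 = lambda / h by rewrite /h; field; rewrite !gt_eqF.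
    by rewrite ler_pM2r ?invr_gt0.
  have : h * mass v <= d ^+ 2 / 4.
    have -> : d ^+ 2 / 4 = h * (d ^+ 2 / (4 * h)) by field; rewrite gt_eqF.
    by rewrite ler_pM2l.
  lra.
move=> s /hd; rewrite ler_norml => /andP[h1 _]; by rewrite mulNr.
Qed.

End Potential.

(** * Scaling and strict subadditivity *)

Section Rescaling.
Context {R : realType}.
Variables G g : R -> R.
Hypothesis nl : nonlinearity G g.
Implicit Types (u v w : R -> R[i]) (z : R[i]).

Lemma sobolev_rescale c d u v : 0 < c -> sobolev u v ->
  sobolev (fun x => u (c * x + d)) (fun x => Complex c 0 * v (c * x + d)).
Proof.
move=> c0 [n1 n2]; split.
  under [X in ac2 _ X]eq_fun do rewrite ReM /= mul0r subr0.
  exact: (ac2_affine d c0 n1).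
under [X in ac2 _ X]eq_fun do rewrite ImM /= mul0r addr0.
exact: (ac2_affine d c0 n2).
Qed.

Lemma mass_rescale c d u : 0 < c -> L2 u ->
  mass (fun x => u (c * x + d)) = mass u / c.
Proof.
move=> c0 hu; rewrite [in RHS]/mass (Rintegral_affine d c0 (itg_mass hu)).
by rewrite mulrC mulKf// gt_eqF.
Qed.

Lemma mass_rescale_deriv c d v : 0 < c -> L2 v ->
  mass (fun x => Complex c 0 * v (c * x + d)) = c * mass v.
Proof.
move=> c0 hv.
have hv' : L2 (fun x => v (c * x + d)).
  by case: hv => v1 v2; split; [exact: (L2r_affine d c0 v1)|exact: (L2r_affine d c0 v2)].
rewrite massZ// mass_rescale// cabs_sqr /= expr0n addr0; field; by rewrite gt_eqF.
Qed.

Lemma pot_rescale c d u v : 0 < c -> sobolev u v ->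
  pot G (fun x => u (c * x + d)) = pot G u / c.
Proof.
move=> c0 uv; rewrite [in RHS]/pot (Rintegral_affine d c0 (itg_pot_sobolev nl uv)).
by rewrite mulrC mulKf// gt_eqF.
Qed.

(** [L] depends on [u] through its sup bound. The use is for zero mass, where the potential energy
    is thus nonnegative. *)
Lemma pot_ge_quad u v : sobolev u v -> exists L, - L * mass u <= pot G u.
Proof.
move=> uv; have [B B0 uB] := sobolev_bounded uv; have [hu _] := sobolev_L2 uv.
have [L L0 hL] := G_quad nl B0; exists L.
apply: (pot_ge nl hu B0) => // s sB; have := hL s sB.
by rewrite ler_norml mulNr => /andP[].
Qed.

Variables lambda m : R.
Hypothesis lambda0 : 0 < lambda.
Hypothesis en_ge : forall u v, sobolev u v -> mass u = lambda -> m <= en G u v.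

(* Spreading [u] out until it has mass [lambda] gains kinetic energy. *)
Lemma en_ge_scaled u v : sobolev u v -> mass u <= lambda ->
  mass u / lambda * m + 2^-1 * (1 - (mass u / lambda) ^+ 2) * mass v <= en G u v.
Proof.
move=> uv ul; have [hu hv] := sobolev_L2 uv.
have := mass_ge0 u; rewrite le_eqVlt => /predU1P[m0|m0].
  have [L] := pot_ge_quad uv; rewrite -m0 mulr0 /en => h.
  by rewrite !mul0r expr0n subr0 mulr1 add0r lerDl.
pose c := mass u / lambda.
have c0 : 0 < c by rewrite divr_gt0.
have := en_ge (sobolev_rescale 0 c0 uv); rewrite mass_rescale// /en.
rewrite mass_rescale_deriv// (pot_rescale _ c0 uv).
have -> : mass u / c = lambda.
  by rewrite /c; field; rewrite !gt_eqF.
move=> /(_ erefl); rewrite -/c => h.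
have : c * m <= c * (2^-1 * (c * mass v) + pot G u / c) by rewrite ler_pM2l.
have -> : c * (2^-1 * (c * mass v) + pot G u / c) =
  2^-1 * c ^+ 2 * mass v + pot G u by field; rewrite gt_eqF.
lra.
Qed.

Hypothesis m0 : m < 0.

Lemma en_ge_le u v : sobolev u v -> mass u <= lambda -> mass u / lambda * m <= en G u v.
Proof.
move=> uv ul; apply: le_trans (en_ge_scaled uv ul); rewrite lerDl.
have := mass_ge0 u; have := mass_ge0 v => h1 h2.
apply: mulr_ge0 => //; apply: mulr_ge0 => //; rewrite subr_ge0.
by rewrite expr_le1// ?divr_ge0 ?ler_pdivrMr ?mul1r// ltW.
Qed.

(** There are two ways to beat the linear bound. If the kinetic energy is at most [k], the potential
    is at least -e times the mass, and by the choice of [e] the linear bound is twice that.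
    Otherwise the kinetic gain of [en_ge_scaled] is bounded below, since the mass stays away from
    lambda. *)
Lemma en_gap (eta : R) : 0 < eta -> exists2 gam : R, 0 < gam &
  forall u v, sobolev u v -> eta <= mass u -> mass u <= lambda - eta ->
    mass u / lambda * m + gam <= en G u v.
Proof.
move=> eta0; pose e := - m / (2 * lambda).
have e0 : 0 < e by rewrite divr_gt0 ?oppr_gt0// mulr_gt0.
have [k k0 hk] := pot_ge_small nl lambda0 e0.
have el : 0 < eta / lambda by rewrite divr_gt0.
pose gam := Num.min (e * eta) (2^-1 * (eta / lambda) * k).
have gam0 : 0 < gam.
  rewrite lt_min (mulr_gt0 e0 eta0)/=; apply: mulr_gt0 => //.
  by apply: mulr_gt0 => //; rewrite invr_gt0.
exists gam => // u v uv Mlo Mhi; have v0 := mass_ge0 v.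
have ul : mass u <= lambda by lra.
have [vk|kv] := leP (mass v) k.
  have := hk u v uv ul vk => hp.
  have : gam <= e * mass u.
    by apply: (@le_trans _ _ (e * eta)); rewrite ?ge_min ?lexx// ler_pM2l.
  have -> : mass u / lambda * m = - (2 * (e * mass u)).
    by rewrite /e; field; rewrite gt_eqF.
  rewrite /en; lra.
have := en_ge_scaled uv ul; set M := mass u / lambda.
have M0 : 0 <= M by rewrite divr_ge0 ?mass_ge0// ltW.
have M1 : M <= 1 - eta / lambda.
  rewrite /M ler_pdivrMr// mulrBl mul1r divfK ?gt_eqF//.
have gk : gam <= 2^-1 * (eta / lambda) * k by rewrite ge_min lexx orbT.
have MM : eta / lambda <= 1 - M ^+ 2 by nra.
have a0 : 0 <= 2^-1 * (eta / lambda) by lra.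
have a1 : 2^-1 * (eta / lambda) <= 2^-1 * (1 - M ^+ 2) by lra.
have := ler_pM a0 (ltW k0) a1 (ltW kv).
lra.
Qed.

End Rescaling.

Lemma piece_bounds {R : realType} (M1 M2 I1 I2 eta q l : R) : 0 < eta ->
  eta <= I1 -> I1 <= M1 -> eta <= I2 -> I2 <= M2 -> M1 + M2 = l + q -> q <= eta / 2 ->
  (eta / 2 <= M1 /\ M1 <= l - eta / 2) /\ (eta / 2 <= M2 /\ M2 <= l - eta / 2).
Proof. by move=> *; split; split; lra. Qed.

(** * Cutting almost minimizers, and tightness *)

Section Cutting.
Context {R : realType}.
Variables G g : R -> R.
Hypothesis nl : nonlinearity G g.
Implicit Types (u v w : R -> R[i]) (z : R[i]).

Lemma ac2_compact_C1 (f f' : R -> R) (s t : R) : continuous f' ->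
  (forall x : R, is_derive x 1 f (f' x)) ->
  (forall x, x < s \/ t < x -> f x = 0) ->
  (forall x, x < s \/ t < x -> f' x = 0) -> ac2 f f'.
Proof.
move=> cf' df f0 f'0.
have cf : continuous f.
  by move=> x; apply/differentiable_continuous/derivable1_diffP; case: (df x).
split; [exact: L2r_compact_support f0|exact: L2r_compact_support f'0|].
by move=> x y xy; rewrite (Rintegral_derive xy cf' df).
Qed.

Lemma ac2_0 : ac2 (fun _ : R => 0 : R) (fun=> 0).
Proof.
split; [exact: L2r0|exact: L2r0|] => x y xy.
by rewrite Rintegral_cst_itv// mul0r subrr.
Qed.

Lemma plateau_sobolev (n a b : R) : 0 < n -> a <= b ->
  exists v, sobolev (fun x => Complex (plateau n a b x) 0) v.
Proof.
move=> n0 ab; have [f' sf' df'] := smooth_gen_derive (smooth_plateau n a b).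
have pl0 x : x < a \/ b + n^-1 < x -> plateau n a b x = 0.
  by move=> hx; apply: plateau_supp => //; case: hx => /ltW; auto.
exists (fun x => Complex (f' x) 0); split; last exact: ac2_0.
apply: (@ac2_compact_C1 _ _ a (b + n^-1)) => //.
  exact: smooth_gen_continuous.
move=> x hx; have [_ <-] := df' x; apply: derive_val.
apply: (@near_eq_is_derive _ _ _ (cst (0 : R))) => //.
case: hx => hx; near=> y; apply/esym/pl0.
  left; have : `|x - y| < a - x by near: y; apply: near_dist; rewrite subr_gt0.
  by rewrite ltr_norml => /andP[? ?]; lra.
right; have : `|x - y| < x - (b + n^-1).
  by near: y; apply: near_dist; rewrite subr_gt0.
by rewrite ltr_norml => /andP[? ?]; lra.
Unshelve. all: by end_near. Qed.

Lemma sobolev_glue (a : R) u w v v' : sobolev u v -> sobolev w v' -> u a = w a ->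
  sobolev (glue a u w) (glue a v v').
Proof.
move=> [u1 u2] [w1 w2] uw.
have gRe (f h : R -> R[i]) : (fun x => Re (glue a f h x)) =
    glue a (fun x => Re (f x)) (fun x => Re (h x)).
  by apply/funext => x; rewrite /glue; case: ifP.
have gIm (f h : R -> R[i]) : (fun x => Im (glue a f h x)) =
    glue a (fun x => Im (f x)) (fun x => Im (h x)).
  by apply/funext => x; rewrite /glue; case: ifP.
by split; rewrite ?gRe ?gIm; apply: ac2_glue; rewrite ?uw.
Qed.

Lemma Rintegral_glueD (F : R[i] -> R) (a : R) u w :
  itg setT (fun x => F (u x)) -> itg setT (fun x => F (w x)) ->
  \int[mu]_x F (glue a u w x) + \int[mu]_x F (glue a w u x) =
  \int[mu]_x F (u x) + \int[mu]_x F (w x).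
Proof.
move=> hu hw.
have gF (f h : R -> R[i]) : (fun x => F (glue a f h x)) =
    glue a (fun x => F (f x)) (fun x => F (h x)).
  by apply/funext => x; rewrite /glue; case: ifP.
have i1 : itg setT (fun x => F (glue a u w x)) by rewrite gF; exact: itg_glue.
have i2 : itg setT (fun x => F (glue a w u x)) by rewrite gF; exact: itg_glue.
rewrite -!RintegralD//; apply: eq_Rintegral => x _; rewrite /glue.
by case: ifP => // _; rewrite addrC.
Qed.

Lemma pot_le u (c B : R) : L2 u -> 0 <= B -> (forall x, cabs (u x) <= B) ->
  (forall s, 0 <= s <= B -> G s <= c * s ^+ 2) -> pot G u <= c * mass u.
Proof.
move=> hu B0 uB hc.
have iu : itg setT (fun x => G (cabs (u x))).
  by apply: (itg_pot nl hu B0); exact: aeT.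
rewrite /mass -RintegralZl//; last exact: itg_mass.
apply: le_Rintegral => //; first by apply: itgZ => //; exact: itg_mass.
by move=> x _; apply: hc; rewrite cabs_ge0 uB.
Qed.

Lemma bump_exists : exists b bv : R -> R[i],
  [/\ sobolev b bv, b 0 = 1 & forall x, cabs (b x) <= 1].
Proof.
have N10 : (-1 : R) <= 0 by rewrite lerN10.
have [bv nb] := plateau_sobolev ltr01 N10.
exists (fun x => Complex (plateau 1 (-1) 0 x) 0), bv; split => //.
  by rewrite (@plateau_eq1 R 1 (-1) 0 0)// invr1 addNr.
move=> x; have := @plateau_ge0_le1 R 1 (-1) 0 x ltr01.
rewrite invr1 addNr lexx => /(_ isT) /andP[p0 p1].
rewrite -[cabs _]ger0_norm ?cabs_ge0//.
by apply: normr_le_sqr => //; rewrite cabs_sqr /= expr0n addr0 lerXn2r ?nnegrE.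
Qed.

(* The two pieces are [u] on one side of [a], continued by a multiple of a fixed
   bump; what each piece adds, the other one misses. *)
Lemma cut_at : exists T C : R, [/\ 0 <= T, 0 <= C & forall u v (a : R),
  sobolev u v -> cabs (u a) <= 1 ->
  exists u1 v1 u2 v2, [/\ sobolev u1 v1, sobolev u2 v2,
    mass u1 + mass u2 = mass u + T * cabs (u a) ^+ 2,
    en G u1 v1 + en G u2 v2 <= en G u v + C * cabs (u a) ^+ 2 &
    \int[mu]_(x in `]-oo, a]) (cabs (u x) ^+ 2) <= mass u1 /\
    \int[mu]_(x in `]a, +oo[) (cabs (u x) ^+ 2) <= mass u2]].
Proof.
have [b [bv [nb b0 b1]]] := bump_exists.
have [hb hbv] := sobolev_L2 nb.
(* Since |u a| <= 1, the inserted multiple of the bump has modulus at most 1, and one quadratic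
   bound on [G] serves all [u]. *)
have [L L0 hL] := G_quad nl ler01.
exists (mass b), (2^-1 * mass bv + L * mass b); split.
- exact: mass_ge0.
- by rewrite addr_ge0 ?mulr_ge0 ?mass_ge0// invr_ge0.
move=> u v a uv ua; have [hu hv] := sobolev_L2 uv.
set z := u a in ua *.
have nba := sobolev_rescale (- a) ltr01 nb.
pose w x := z * b (1 * x + - a); pose wv x := z * (Complex 1 0 * bv (1 * x + - a)).
have nw : sobolev w wv by exact: sobolevZ nba.
have [hw hwv] := sobolev_L2 nw; have [hba hbva] := sobolev_L2 nba.
have wa : w a = u a.
  by rewrite /w mul1r subrr b0 mulr1.
have w1 x : cabs (w x) <= 1.
  rewrite -[cabs _]ger0_norm ?cabs_ge0//; apply: normr_le_sqr => //.
  have -> : cabs (w x) ^+ 2 = cabs z ^+ 2 * cabs (b (1 * x + - a)) ^+ 2.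
    by rewrite /w !cabs_sqr ReM ImM; ring.
  by rewrite expr1n mulr_ile1 ?sqr_ge0// expr_le1 ?cabs_ge0.
have mw : mass w = cabs z ^+ 2 * mass b.
  by rewrite (massZ z hba) (mass_rescale (- a) ltr01 hb) divr1.
have mwv : mass wv = cabs z ^+ 2 * mass bv.
  by rewrite (massZ z hbva) (mass_rescale_deriv (- a) ltr01 hbv) mul1r.
have pw : pot G w <= L * mass w.
  apply: (@pot_le w L 1) => // s /hL; apply: le_trans; exact: ler_norm.
have n1 := sobolev_glue uv nw (esym wa).
have n2 := sobolev_glue nw uv wa.
have [hg1 _] := sobolev_L2 n1; have [hg2 _] := sobolev_L2 n2.
have mE : mass (glue a u w) + mass (glue a w u) = mass u + mass w.
  by apply: (@Rintegral_glueD (fun z => cabs z ^+ 2)); exact: itg_mass.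
exists (glue a u w), (glue a v wv), (glue a w u), (glue a wv v); split => //.
- by rewrite mE mw mulrC.
- have kE : mass (glue a v wv) + mass (glue a wv v) = mass v + mass wv.
    by apply: (@Rintegral_glueD (fun z => cabs z ^+ 2)); exact: itg_mass.
  have pE : pot G (glue a u w) + pot G (glue a w u) = pot G u + pot G w.
    apply: (@Rintegral_glueD (fun z => G (cabs z))).
      exact: itg_pot_sobolev nl _ _ uv.
    exact: itg_pot_sobolev nl _ _ nw.
  rewrite /en mw in pw *; rewrite mwv in kE.
  have : 2^-1 * mass (glue a v wv) + 2^-1 * mass (glue a wv v) =
     2^-1 * mass v + 2^-1 * (cabs z ^+ 2 * mass bv) by rewrite -!mulrDr kE.
  lra.
split.
- rewrite (_ : Rintegral _ _ _ =
    \int[mu]_(x in `]-oo, a]) (cabs (glue a u w x) ^+ 2)).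
    apply: Rintegral_le_setT; [exact: msb_itv|exact: itg_mass|].
    by move=> x; exact: sqr_ge0.
  apply: eq_Rintegral => x; rewrite inE/= in_itv/= => xa.
  by rewrite /glue xa.
rewrite (_ : Rintegral _ _ _ =
  \int[mu]_(x in `]a, +oo[) (cabs (glue a w u x) ^+ 2)).
  apply: Rintegral_le_setT; [exact: msb_itv|exact: itg_mass|].
  by move=> x; exact: sqr_ge0.
apply: eq_Rintegral => x; rewrite inE/= in_itv/= andbT => xa.
by rewrite /glue leNgt xa.
Qed.

Variables lambda m : R.
Hypothesis lambda0 : 0 < lambda.
Hypothesis en_ge : forall u v, sobolev u v -> mass u = lambda -> m <= en G u v.
Hypothesis m0 : m < 0.

(* An almost minimizer cannot be cut into two pieces of mass at least [eta]:
   this would violate strict subadditivity. *)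
Lemma no_splitting (eta : R) : 0 < eta -> eta <= lambda -> exists s d : R,
  [/\ 0 < s, 0 < d & forall u v a, sobolev u v -> mass u = lambda ->
    en G u v <= m + d -> cabs (u a) ^+ 2 <= s ->
    \int[mu]_(x in `]-oo, a]) (cabs (u x) ^+ 2) < eta \/
    \int[mu]_(x in `]a, +oo[) (cabs (u x) ^+ 2) < eta].
Proof.
move=> eta0 etal; have [T [C [T0 C0 cut]]] := cut_at.
have eta2 : 0 < eta / 2 by rewrite divr_gt0.
have [gam gam0 gap] := en_gap nl lambda0 en_ge m0 eta2.
(* [A] dominates the coefficients of |u a|^2 in the excess of mass, in the excess of energy, and in
   the change of the linear bound that the excess of mass causes. With [s] as below each of these is
   at most eta / 2 and gam / 2, too little to compensate the gain [gam] of each piece. *)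
pose A := T + C + T * (- m / lambda) + 1.
have ml : 0 < - m / lambda by rewrite divr_gt0 ?oppr_gt0.
have Tm : 0 <= T * (- m / lambda) by rewrite mulr_ge0// ltW.
have A0 : 0 < A by rewrite /A; lra.
have [TA CA TmA] : [/\ T <= A, C <= A & T * (- m / lambda) <= A] by rewrite /A; split; lra.
pose s := Num.min 1 (Num.min (eta / (2 * A)) (gam / (2 * A))).
have A2 : 0 < 2 * A by rewrite mulr_gt0.
have s0 : 0 < s by rewrite !lt_min ltr01 !divr_gt0.
have s1 : s <= 1 by rewrite ge_min lexx.
have se : s * (2 * A) <= eta.
  by rewrite -ler_pdivlMr// !ge_min lexx orbT.
have sg : s * (2 * A) <= gam.
  by rewrite -ler_pdivlMr// !ge_min lexx !orbT.
exists s, (gam / 2); split => // [|u v a uv ul ule ua]; first by rewrite divr_gt0.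
have [|h1] := ltP (\int[mu]_(x in `]-oo, a]) (cabs (u x) ^+ 2)) eta; first by left.
have [|h2] := ltP (\int[mu]_(x in `]a, +oo[) (cabs (u x) ^+ 2)) eta; first by right.
exfalso.
have ua1 : cabs (u a) <= 1.
  rewrite -[cabs _]ger0_norm ?cabs_ge0//; apply: normr_le_sqr => //.
  by rewrite expr1n (le_trans ua).
have [u1 [v1 [u2 [v2 [n1 n2 mE eE [H1 H2]]]]]] := cut u v a uv ua1.
set q := cabs (u a) ^+ 2 in ua mE eE.
have q0 : 0 <= q by exact: sqr_ge0.
have Tq : T * q <= A * s by apply: ler_pM.
have Cq : C * q <= A * s by apply: ler_pM.
have Tmq : T * (- m / lambda) * q <= A * s by apply: ler_pM.
have As : A * s <= eta / 2.
  by rewrite ler_pdivlMr//; apply: le_trans se; apply: eq_ler; ring.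
rewrite ul in mE.
have [[b1 b2] [b3 b4]] := piece_bounds eta0 h1 H1 h2 H2 mE (le_trans Tq As).
have g1 := gap u1 v1 n1 b1 b2; have g2 := gap u2 v2 n2 b3 b4.
have E : mass u1 / lambda * m + mass u2 / lambda * m = m - T * (- m / lambda) * q.
  rewrite -mulrDl -mulrDl mE; field; by rewrite gt_eqF.
lra.
Qed.

(** On either side of the median [y], within distance [L = lambda / s], there is a point where |u|^2
    <= s. By [no_splitting] one side of such a cut carries less than [eta]; the side containing the
    half-line beyond [y] carries at least lambda / 2, so it is the outer side that is light. *)
Lemma tightness (eta : R) : 0 < eta -> eta <= lambda / 2 -> exists L d : R,
  [/\ 0 < L, 0 < d & forall u v y, sobolev u v -> mass u = lambda ->
    en G u v <= m + d ->
    \int[mu]_(x in `]-oo, y]) (cabs (u x) ^+ 2) = lambda / 2 ->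
    lambda - 2 * eta <= \int[mu]_(x in `[y - L, y + L]) (cabs (u x) ^+ 2)].
Proof.
move=> eta0 etal; have etal' : eta <= lambda by lra.
have [s [d [s0 d0 nosplit]]] := no_splitting eta0 etal'.
pose L := lambda / s; have L0 : 0 < L by rewrite divr_gt0.
exists L, d; split => // u v y uv ul ule uy.
have [hu _] := sobolev_L2 uv; have iu := itg_mass hu.
have sq0 x : 0 <= cabs (u x) ^+ 2 by exact: sqr_ge0.
have lL : lambda / L = s by rewrite /L; field; rewrite !gt_eqF.
have [a [ya ayL ha]] := sobolev_small_point y uv L0.
have [b [yb byL hb]] := sobolev_small_point (y - L) uv L0.
rewrite ul lL in ha hb; rewrite subrK in byL.
have mono (D E : set R) : msb D -> msb E -> D `<=` E ->
    \int[mu]_(x in D) (cabs (u x) ^+ 2) <= \int[mu]_(x in E) (cabs (u x) ^+ 2).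
  move=> mD mE DE; rewrite [leLHS]Rintegral_mkcond [leRHS]Rintegral_mkcond.
  apply: le_Rintegral => //.
  - by apply: itg_restrict => //; exact: itg_sub.
  - by apply: itg_restrict => //; exact: itg_sub.
  - move=> x _; rewrite !patchE; case: ifPn => [|_]; last by case: ifP.
    by rewrite inE => /DE xE; rewrite mem_set.
have spl c := Rintegral_split c iu; rewrite -/(mass u) ul in spl.
have tail_r : \int[mu]_(x in `]a, +oo[) (cabs (u x) ^+ 2) < eta.
  have [h|//] := nosplit u v a uv ul ule ha.
  have : \int[mu]_(x in `]-oo, y]) (cabs (u x) ^+ 2) <=
         \int[mu]_(x in `]-oo, a]) (cabs (u x) ^+ 2).
    apply: mono; [exact: msb_itv|exact: msb_itv|].
    by move=> x /=; rewrite !in_itv/= => xy; exact: le_trans xy ya.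
  rewrite uy; lra.
have tail_l : \int[mu]_(x in `]-oo, b]) (cabs (u x) ^+ 2) < eta.
  have [//|h] := nosplit u v b uv ul ule hb.
  have : \int[mu]_(x in `]y, +oo[) (cabs (u x) ^+ 2) <=
         \int[mu]_(x in `]b, +oo[) (cabs (u x) ^+ 2).
    apply: mono; [exact: msb_itv|exact: msb_itv|].
    by move=> x /=; rewrite !in_itv/= !andbT => xy; exact: le_lt_trans xy.
  have := spl y; rewrite uy; lra.
have : lambda <= \int[mu]_(x in `]-oo, b]) (cabs (u x) ^+ 2) +
    \int[mu]_(x in `]a, +oo[) (cabs (u x) ^+ 2) +
    \int[mu]_(x in `[y - L, y + L]) (cabs (u x) ^+ 2).
  rewrite -ul /mass.
  rewrite [X in _ <= X + _ + _]Rintegral_mkcond [X in _ <= _ + X + _]Rintegral_mkcond.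
  rewrite [X in _ <= _ + _ + X]Rintegral_mkcond.
  have itgp (i : interval R) :
      itg setT ((fun x => cabs (u x) ^+ 2) \_ [set` i]).
    apply: itg_restrict; first exact: msb_itv.
    by apply: itg_sub => //; exact: msb_itv.
  rewrite -RintegralD// -RintegralD//; last by apply: itgD.
  apply: le_Rintegral => //; first by apply: itgD => //; exact: itgD.
  move=> x _; rewrite !patchE !mem_setE !in_itv/= andbT.
  have [xb|bx] := leP x b.
    by rewrite -addrA lerDl addr_ge0//; case: ifP.
  have [xa|ax] := ltP a x.
    by rewrite add0r lerDl; case: ifP.
  by rewrite (ltW (le_lt_trans yb bx)) (le_trans ax ayL) !add0r.
lra.
Qed.

End Cutting.

(** * Compactness of minimizing sequences *)

Section Precompactness.
Context {R : realType}.
Implicit Types (u v w : R -> R[i]) (z : R[i]).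

Lemma Rintegral_le_subset (f : R -> R) (D E : set R) : msb D -> msb E ->
  D `<=` E -> itg setT f -> (forall x, 0 <= f x) ->
  \int[mu]_(x in D) f x <= \int[mu]_(x in E) f x.
Proof.
move=> mD mE DE hf f0; rewrite [leLHS]Rintegral_mkcond [leRHS]Rintegral_mkcond.
apply: le_Rintegral => //.
- by apply: itg_restrict => //; exact: itg_sub.
- by apply: itg_restrict => //; exact: itg_sub.
- move=> x _; rewrite !patchE; case: ifPn => [|_]; last by case: ifP.
  by rewrite inE => /DE xE; rewrite mem_set.
Qed.

Lemma L2r_nice_sqr u v : sobolev u v -> L2r (fun x => cabs (u x) ^+ 2).
Proof.
move=> uv; have [hu _] := sobolev_L2 uv; have iu := itg_mass hu.
pose f x := cabs (u x) ^+ 2.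
have f0 x : 0 <= f x by exact: sqr_ge0.
have [B B0 uB] := sobolev_bounded uv.
apply/L2rP; split; first exact: itg_measurable iu.
apply: (itg_le measurableT _ (itgZ (B ^+ 2) measurableT iu)).
  by apply: measurable_funX; exact: itg_measurable iu.
move=> x _; rewrite ger0_norm ?sqr_ge0//.
have h : f x <= B ^+ 2 by rewrite lerXn2r ?nnegrE ?cabs_ge0.
have -> : f x ^+ 2 = f x * f x by rewrite expr2.
exact: ler_wpM2r.
Qed.

(** The cumulative mass is a primitive of |u|^2, which is in L^2 because [u] is bounded; it is thus
    continuous and the intermediate value theorem applies. *)
Lemma median u v (lambda : R) : sobolev u v -> 0 < lambda -> mass u = lambda ->
  exists y, \int[mu]_(x in `]-oo, y]) (cabs (u x) ^+ 2) = lambda / 2.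
Proof.
move=> uv l0 ul; have [hu _] := sobolev_L2 uv; have iu := itg_mass hu.
pose f x := cabs (u x) ^+ 2.
have f0 x : 0 <= f x by exact: sqr_ge0.
have L2f : L2r f by exact: L2r_nice_sqr uv.
pose Phi y := \int[mu]_(x in `]-oo, y]) f x.
have ifI (i : interval R) : itg [set` i] f.
  by apply: itg_sub => //; exact: msb_itv.
have PhiE (x y : R) : x <= y -> Phi y - Phi x = \int[mu]_(t in `[x, y]) f t.
  move=> xy; rewrite /Phi -[in RHS]Rintegral_itv_obnd_cbnd; last exact: ifI.
  by apply: Rintegral_itvB => //; exact: ifI.
have cPhi : continuous Phi by exact: (primitive_continuous L2f PhiE).
have l4 : 0 < lambda / 4 by rewrite divr_gt0.
have [N N0 hN] := Rintegral_tail_small iu f0 l4.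
rewrite -/(mass u) ul in hN.
have hi : lambda / 2 <= Phi N.
  have : \int[mu]_(x in `[- N, N]) f x <= Phi N.
    apply: Rintegral_le_subset => //.
    by move=> x /=; rewrite !in_itv/= => /andP[].
  by move=> h; apply: le_trans h; apply: le_trans hN; lra.
have lo : Phi (- N - 1) <= lambda / 2.
  have := Rintegral_split (- N - 1) iu; rewrite -/(mass u) ul -/(Phi (- N - 1)).
  have : \int[mu]_(x in `[- N, N]) f x <= \int[mu]_(x in `]- N - 1, +oo[) f x.
    apply: Rintegral_le_subset => //.
    by move=> x /=; rewrite !in_itv/= => /andP[h _]; apply/andP; split=> //; lra.
  move: hN; rewrite /f; lra.
have NN : - N - 1 <= N by lra.
have [|y _ yE] := IVT NN (continuous_subspaceT cPhi) (v := lambda / 2).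
  by rewrite ge_min lo/= le_max hi orbT.
by exists y.
Qed.

(** Along a single ultrafilter all bounded sequences converge at once, which takes the place of
    diagonal extraction of subsequences. *)
Lemma ultra_bounded_cvg (U : set_system nat) (a : nat -> R) (B : R) :
  UltraFilter U -> (forall n, `|a n| <= B) ->
  exists l : R, forall e, 0 < e -> U [set n | `|a n - l| < e].
Proof.
move=> UU aB.
have UP : ProperFilter U := ultra_proper.
have FA : (a @ U) (`[- B, B]%classic : set R).
  apply: (@filterS _ U _ setT); last exact: filterT.
  by move=> n _ /=; rewrite in_itv/= -ler_norml.
have [l [_ hl]] := @segment_compact R (- B) B (a @ U) _ FA.
exists l => e e0.
have [//|hC] := in_ultra_setVsetC [set n | `|a n - l| < e] UU.
have hb : nbhs l (ball l e) by exact: nbhsx_ballx.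
have FC : (a @ U) (~` ball l e).
  apply: (@filterS _ U _ _ _ _ hC) => n /= h xb; apply: h.
  by move: xb; rewrite /ball/= distrC.
by have [x [xC xb]] := hl _ _ FC hb.
Qed.

Lemma ultra_cauchy_points (U : set_system nat) (w : nat -> R -> R[i]) (B : R)
    (s : seq R) : UltraFilter U -> (forall n x, cabs (w n x) <= B) ->
  forall e, 0 < e -> exists2 A, U A & forall n p x, A n -> A p -> x \in s ->
    cabs (w n x - w p x) ^+ 2 <= e.
Proof.
move=> UU wB e e0; have UP : ProperFilter U := ultra_proper.
elim: s => [|x s [A UA hA]].
  by exists setT; [exact: filterT|move=> n p x _ _; rewrite in_nil].
have [l hl] : exists l : R, forall e, 0 < e -> U [set n | `|Re (w n x) - l| < e].
  apply: (ultra_bounded_cvg (B := B)) => // n; apply: le_trans (wB n x).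
  apply: normr_le_sqr; rewrite ?cabs_ge0// cabs_sqr lerDl; exact: sqr_ge0.
have [k hk] : exists l : R, forall e, 0 < e -> U [set n | `|Im (w n x) - l| < e].
  apply: (ultra_bounded_cvg (B := B)) => // n; apply: le_trans (wB n x).
  apply: normr_le_sqr; rewrite ?cabs_ge0// cabs_sqr lerDr; exact: sqr_ge0.
(* Two values within [d] of the same limit differ by at most 2 d, and (2 d)^2 <= 4 d <= e / 2 since
   d <= 1. *)
pose d := Num.min 1 (e / 8); have d0 : 0 < d by rewrite lt_min ltr01 divr_gt0.
have d1 : d <= 1 by rewrite ge_min lexx.
have d8 : d <= e / 8 by rewrite ge_min lexx orbT.
exists (A `&` ([set n | `|Re (w n x) - l| < d] `&` [set n | `|Im (w n x) - k| < d])).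
  by apply: filterI => //; apply: filterI; [exact: hl|exact: hk].
move=> n p y [An [/= n1 n2]] [Ap [/= p1 p2]]; rewrite in_cons => /predU1P[->|]; last first.
  exact: hA.
have small (b c t : R) : `|b - t| < d -> `|c - t| < d -> (b - c) ^+ 2 <= e / 2.
  rewrite !ltr_norml => /andP[b1 b2] /andP[c1 c2].
  have h : (b - c) ^+ 2 <= (2 * d) ^+ 2.
    suff : 0 <= (2 * d - (b - c)) * (2 * d + (b - c)) by lra.
    by apply: mulr_ge0; lra.
  apply: le_trans h _; rewrite exprMn; nra.
have := small _ _ _ n1 p1; have := small _ _ _ n2 p2.
rewrite cabs_sqr ReB ImB; lra.
Qed.

(** Every point of [-L, L] lies within one mesh of a grid point to its left, and the Holder bound
    controls the change in between. This pointwise bound is integrated over a length 2 L. *)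
Lemma mass_on_grid w wv (L e : R) (N : nat) : sobolev w wv -> 0 < L -> (0 < N)%N ->
  (forall j : nat, (j <= N)%N -> cabs (w (- L + j%:R * (2 * L / N%:R))) ^+ 2 <= e) ->
  \int[mu]_(x in `[- L, L]) (cabs (w x) ^+ 2) <=
    (2 * e + 2 * (2 * L / N%:R) * mass wv) * (2 * L).
Proof.
move=> nw L0 N0 hj; have [hw hwv] := sobolev_L2 nw.
have N0' : 0 < (N%:R : R) by rewrite ltr0n.
pose t := 2 * L / N%:R; have t0 : 0 < t by rewrite divr_gt0// mulr_gt0.
have LL : - L <= L by lra.
have -> : 2 * L = L - - L by ring.
rewrite -Rintegral_cst_itv//; apply: le_Rintegral.
- exact: msb_itv.
- by apply: itg_sub; [exact: msb_itv|exact: itg_mass].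
- exact: itg_cst_itv.
move=> x /=; rewrite in_itv/= => /andP[Lx xL].
have -> : L - - L = 2 * L by ring.
rewrite -/t; have xL0 : 0 <= (x + L) / t by apply: divr_ge0; [lra|exact: ltW].
pose j := Num.truncn ((x + L) / t).
have /andP[j1 j2] : j%:R <= (x + L) / t < j.+1%:R by exact: Num.Theory.truncn_itv.
have jN : (j <= N)%N.
  rewrite -(@ler_nat R); apply: le_trans j1 _.
  have Nt : N%:R * t = 2 * L by rewrite /t; field; rewrite gt_eqF.
  by rewrite ler_pdivrMr// Nt; lra.
have h1 : j%:R * t <= x + L by rewrite -ler_pdivlMr.
have h2 : x + L < (j%:R + 1) * t by rewrite -ltr_pdivrMr// natr1.
pose a := - L + j%:R * t.
rewrite -[w x](subrK (w a)) addrC; apply: le_trans (cabsD_sqr _ _) _.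
rewrite lerD ?ler_wpM2l ?hj// -mulrA ler_wpM2l//.
apply: le_trans (sobolev_holder a x nw) _; rewrite ler_wpM2r ?mass_ge0//.
by rewrite /a ger0_norm; lra.
Qed.

(** Inside [-L, L] the values at finitely many grid points become close along [U], and the uniform
    Holder bound extends this to the interval; outside, both functions have mass at most e / 8. *)
Lemma ultra_L2_cauchy (U : set_system nat) (w wv : nat -> R -> R[i])
    (lambda kap : R) : UltraFilter U -> (forall n, sobolev (w n) (wv n)) ->
  (forall n, mass (w n) = lambda) -> (forall n, mass (wv n) <= kap) ->
  (forall eta, 0 < eta -> exists2 L : R, 0 < L &
    U [set n | lambda - eta <= \int[mu]_(x in `[- L, L]) (cabs (w n x) ^+ 2)]) ->
  forall e, 0 < e -> exists2 A, U A & forall n p, A n -> A p ->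
    mass (fun x => w n x - w p x) <= e.
Proof.
move=> UU nw wl wk tight e e0; have UP : ProperFilter U := ultra_proper.
have l0 : 0 <= lambda by rewrite -(wl 0%N) mass_ge0.
have k0 : 0 <= kap by apply: le_trans (mass_ge0 _) (wk 0%N).
have e8 : 0 < e / 8 by rewrite divr_gt0.
have [L L0 UL] := tight _ e8.
pose q := 2 * L; have q0 : 0 < q by rewrite mulr_gt0.
(* The derivatives differ by mass at most 4 kap, so this mesh keeps the contribution of the Holder
   bound over [-L, L] below e / 4. *)
pose N := (Num.truncn (8 * q * (kap + 1) * q * 4 / e)).+1.
have NR : 8 * q * (kap + 1) * q * 4 / e < N%:R by exact: Num.Theory.truncnS_gt.
have N0' : 0 < (N%:R : R) by rewrite ltr0n.
pose e1 := e / (8 * q); have e10 : 0 < e1 by rewrite divr_gt0// mulr_gt0.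
pose B := Num.sqrt (2 * lambda + 2 * kap).
have wB n x : cabs (w n x) <= B.
  rewrite -[cabs _]ger0_norm ?cabs_ge0//; apply: normr_le_sqr.
    exact: sqrtr_ge0.
  rewrite sqr_sqrtr; last by rewrite addr_ge0// mulr_ge0.
  have := sobolev_sup x (nw n) ltr01; rewrite divr1 mul1r wl.
  by have := wk n; lra.
have [A UA hA] := ultra_cauchy_points
  [seq (- L + j%:R * (2 * L / N%:R)) | j <- iota 0 N.+1] UU wB e10.
exists (A `&` [set n | lambda - e / 8 <=
    \int[mu]_(x in `[- L, L]) (cabs (w n x) ^+ 2)]); first exact: filterI.
move=> n p [An /= tn] [Ap /= tp].
have [hn hnv] := sobolev_L2 (nw n); have [hp hpv] := sobolev_L2 (nw p).
have nd := sobolevB (nw n) (nw p); have [hd hdv] := sobolev_L2 nd.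
have md := massB_le hnv hpv.
have inner := @mass_on_grid _ _ L e1 N nd L0 isT.
have {}inner : \int[mu]_(x in `[- L, L]) (cabs (w n x - w p x) ^+ 2) <= e / 2.
  apply: le_trans (inner _) _.
    move=> j jN; apply: hA => //; apply/mapP; exists j => //.
    by rewrite mem_iota.
  rewrite -/q.
  have t1 : 2 * e1 * q = e / 4 by rewrite /e1; field; rewrite gt_eqF.
  have t2 : 2 * (q / N%:R) * mass (fun x => wv n x - wv p x) * q <= e / 4.
    apply: (@le_trans _ _ (2 * (q / N%:R) * (4 * (kap + 1)) * q)).
      apply: ler_wpM2r; first exact: ltW.
      apply: ler_wpM2l; first by apply: mulr_ge0 => //; apply: divr_ge0; exact: ltW.
      by have := wk n; have := wk p; lra.
    have -> : 2 * (q / N%:R) * (4 * (kap + 1)) * q =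
        (8 * q * (kap + 1) * q) / N%:R by field; rewrite gt_eqF.
    rewrite ler_pdivrMr//; have := ltW NR; rewrite ler_pdivrMr//; lra.
  by rewrite mulrDl t1; lra.
(* The integrand is |w n + w p|^2, hence nonnegative. Its integral over [-L, L] being at most that
   over the line is the tail estimate |a - b|^2 <= 2 |a|^2 + 2 |b|^2, without integrals over the
   complement. *)
have := Rintegral_le_setT (msb_itv `[- L, L])
  (f := fun x => 2 * cabs (w n x) ^+ 2 + 2 * cabs (w p x) ^+ 2 - cabs (w n x - w p x) ^+ 2).
have i1 := itg_mass hn; have i2 := itg_mass hp; have i3 := itg_mass hd.
have mI := msb_itv `[- L, L].
have i1' := itgZ 2 measurableT i1; have i2' := itgZ 2 measurableT i2.
rewrite !RintegralB//; try (by exact: itgD); try (by exact: itg_sub);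
  last by apply: itgD => //; exact: itg_sub.
rewrite !RintegralD//; try (by exact: itg_sub).
rewrite !RintegralZl//; try (by exact: itg_sub).
rewrite -/(mass (w n)) -/(mass (w p)) -/(mass (fun x => w n x - w p x)) !wl.
move=> /(_ _ _)/wrap[].
- by apply: itgB => //; exact: itgD.
- move=> x; rewrite !cabs_sqr !ReB !ImB.
  have := sqr_ge0 (Re (w n x) + Re (w p x)); have := sqr_ge0 (Im (w n x) + Im (w p x)).
  lra.
lra.
Qed.

End Precompactness.

(** * Completeness of L^2 and of Sobolev pairs *)

Section Completeness.
Context {R : realType}.

Lemma expr_inv_ge0 (a : R) n : 0 <= a -> 0 <= a^-1 ^+ n.
Proof. by move=> a0; rewrite exprn_ge0 ?invr_ge0. Qed.

Lemma geometric_small (e : R) : 0 < e ->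
  exists N : nat, forall n, (N <= n)%N -> 2^-1 ^+ n < e.
Proof.
move=> e0.
have h : (2^-1 ^+ n : R) @[n --> \oo] --> (0 : R).
  by apply: cvg_expr; rewrite ger0_norm ?invr_ge0// invf_lt1// ltr1n.
move/cvgrPdist_lt : h => /(_ _ e0)[N _ hN]; exists N => n /hN.
by rewrite /= sub0r normrN ger0_norm// ?expr_inv_ge0.
Qed.

(** Riesz-Fischer with a rate. Increments of size 8^(-n) stay summable after multiplication by 4^n,
    so the sum of the 4^k d_k^2 has a limit [H] with integral at most 2; where [H] is finite, |d_k|
    <= sqrt(H) 2^(-k). *)
Lemma L2r_complete (f : nat -> R -> R) : (forall n, L2r (f n)) ->
  (forall n, \int[mu]_x ((f n.+1 x - f n x) ^+ 2) <= 8^-1 ^+ n) ->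
  exists2 F, L2r F &
    forall n, \int[mu]_x ((F x - f n x) ^+ 2) <= 8 * 4^-1 ^+ n.
Proof.
move=> hf fd.
pose d n x := f n.+1 x - f n x.
have hd n : L2r (d n) by exact: L2rB.
(* Geometric weights turn the summability of the increments in L^2 into
   pointwise geometric decay almost everywhere. *)
pose S n x := \sum_(k < n) 4 ^+ k * d k x ^+ 2.
have S_S n x : S n.+1 x = S n x + 4 ^+ n * d n x ^+ 2 by rewrite /S big_ord_recr.
have itgd n : itg setT (fun x => 4 ^+ n * d n x ^+ 2).
  by apply: itgZ => //; exact: L2r_sq.
have itgS n : itg setT (S n).
  elim: n => [|n IH].
    rewrite (_ : EFin \o S 0%N = cst 0%E); first exact: integrable0.
    by apply/funext => x; rewrite /S/= big_ord0.
  rewrite (_ : S n.+1 = fun x => S n x + 4 ^+ n * d n x ^+ 2).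
    exact: itgD.
  by apply/funext => x.
have IS n : \int[mu]_x S n x <= 2 - 2 * 2^-1 ^+ n.
  elim: n => [|n IH].
    rewrite (_ : S 0%N = cst 0); last by apply/funext => x; rewrite /S big_ord0.
    by rewrite /Rintegral integral0 expr0 mulr1 subrr.
  under eq_Rintegral do rewrite S_S.
  rewrite RintegralD// RintegralZl//; last exact: L2r_sq.
  have : 4 ^+ n * \int[mu]_x (d n x ^+ 2) <= 2^-1 ^+ n.
    have -> : (2^-1 ^+ n : R) = 4 ^+ n * 8^-1 ^+ n.
      by rewrite -exprMn; congr (_ ^+ _); field.
    by apply: ler_wpM2l (fd n); rewrite exprn_ge0.
  have -> : 2 - 2 * 2^-1 ^+ n.+1 = (2 - 2 * 2^-1 ^+ n) + 2^-1 ^+ n :> R.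
    by rewrite exprS; field.
  exact: lerD.
have S0 n x : 0 <= S n x.
  by apply: sumr_ge0 => k _; rewrite mulr_ge0 ?sqr_ge0// ?exprn_ge0.
have ndS x : {homo (fun n => S n x) : n p / (n <= p)%N >-> n <= p}.
  apply/nondecreasing_seqP => n; by rewrite S_S lerDl mulr_ge0 ?sqr_ge0// ?exprn_ge0.
pose H x := limn (fun n => (S n x)%:E).
have cH x : cvgn (fun n => (S n x)%:E).
  apply: ereal_nondecreasing_is_cvgn => n p np; rewrite lee_fin; exact: ndS.
have SH n x : ((S n x)%:E <= H x)%E.
  apply: lime_ge => //; exists n => // p /= np; rewrite lee_fin; exact: ndS.
have H0 x : (0 <= H x)%E by apply: le_trans (SH 0%N x); rewrite lee_fin.
have mS n : measurable_fun setT (fun x => (S n x)%:E : \bar R).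
  by apply/measurable_EFinP; exact: itg_measurable.
have mH : measurable_fun setT H by exact: (emeasurable_fun_cvg _ _ mS (fun x _ => cH x)).
have IH : (\int[mu]_x H x <= 2%:E)%E.
  have MC := @cvg_monotone_convergence _ (measurableTypeR R) R mu setT measurableT
    (fun n x => (S n x)%:E) (fun n => mS n) (fun n x _ => S0 n x).
  have {}MC := MC (fun x _ n p np => ndS x n p np).
  rewrite -(cvg_lim _ MC)//; apply: lime_le; first by apply/cvg_ex; eexists; exact: MC.
  near=> n; have fS : (\int[mu]_x (S n x)%:E)%E \is a fin_num.
    by apply: integrable_fin_num => //; exact: itgS.
  rewrite -(fineK fS) lee_fin; apply: le_trans (IS n) _.
  by rewrite gerBl mulr_ge0// ?expr_inv_ge0.
have iH : mu.-integrable setT H.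
  apply/integrableP; split => //.
  under eq_integral do rewrite gee0_abs//.
  by apply: le_lt_trans IH _; rewrite ltry.
have [N [mN N0 hN]] := integrable_ae measurableT iH.
have dec x : ~ N x -> exists2 s : R, 0 <= s & s ^+ 2 = fine (H x) /\
    forall n j, `|f (n + j)%N x - f n x| <= 2 * s * (2^-1 ^+ n - 2^-1 ^+ (n + j)%N).
  move=> Nx; have Hf : H x \is a fin_num.
    by apply: contrapT => h; apply: Nx; apply: hN => /= hh; exact: h (hh I).
  have H0' : 0 <= fine (H x) by exact: fine_ge0.
  exists (Num.sqrt (fine (H x))); first exact: sqrtr_ge0.
  rewrite sqr_sqrtr//; split => // n.
  set s := Num.sqrt _.
  have s0 : 0 <= s by exact: sqrtr_ge0.
  have dk k : `|d k x| <= s * 2^-1 ^+ k.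
    have p0 : (0 : R) <= 2^-1 ^+ k by exact: expr_inv_ge0.
    apply: normr_le_sqr; first exact: mulr_ge0.
    rewrite exprMn sqr_sqrtr//.
    have : S k.+1 x <= fine (H x) by rewrite -lee_fin fineK//.
    rewrite S_S => h.
    have : 4 ^+ k * d k x ^+ 2 <= fine (H x) by have := S0 k x; lra.
    rewrite -ler_pdivlMl ?exprn_gt0// => h2; apply: le_trans h2 _.
    rewrite mulrC ler_wpM2l// -exprM mulnC exprM -exprVn.
    by rewrite le_eqVlt; apply/orP; left; apply/eqP; congr (_ ^+ _); field.
  elim=> [|j IHj]; first by rewrite addn0 !subrr normr0 mulr0.
  rewrite addnS; apply: le_trans (ler_distD (f (n + j)%N x) _ _) _.
  have := dk (n + j)%N; rewrite /d => h; move: IHj => IHj.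
  have -> : 2 * s * (2^-1 ^+ n - 2^-1 ^+ (n + j).+1) =
     s * 2^-1 ^+ (n + j) + 2 * s * (2^-1 ^+ n - 2^-1 ^+ (n + j)).
    by rewrite exprS; field.
  exact: lerD.
pose D : set R := ~` N.
have mD : msb D by exact: measurableC.
(* Setting the functions to 0 on the exceptional null set makes the sequence converge at every
   point, so that the limit is measurable. *)
pose gg n x := (f n \_ D) x.
have cg x : cvgn (fun n => gg n x).
  rewrite /gg; case: (pselect (N x)) => Nx.
    rewrite (_ : (fun n => _) = cst 0); first exact: is_cvg_cst.
    by apply/funext => n; rewrite patchE memNset// => /(_ Nx).
  have [s s0 [_ hs]] := dec x Nx.
  rewrite (_ : (fun n => _) = fun n => f n x); last first.
    by apply/funext => n; rewrite patchE mem_set.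
  apply/cauchy_cvgP; apply: cauchy_exP => e e0.
  have e1 : 0 < e / (2 * s + 1) by rewrite divr_gt0// ltr_wpDl// mulr_ge0.
  have [K hK] := geometric_small e1; exists (f K x); exists K => // n /= Kn.
  rewrite /ball/= distrC -(subnKC Kn); apply: le_lt_trans (hs _ _) _.
  have p0 m : (0 : R) <= 2^-1 ^+ m by exact: expr_inv_ge0.
  have s1 : 0 < 2 * s + 1 by lra.
  apply: (@le_lt_trans _ _ ((2 * s + 1) * 2^-1 ^+ K)).
    by have := p0 K; have := p0 (K + (n - K))%N; nra.
  by rewrite mulrC -ltr_pdivlMr// hK.
pose F x := limn (fun n => gg n x).
have mF : mfn setT F.
  apply: (measurable_fun_cvg (h := gg)) => [n|x _]; last exact: cg.
  apply/(measurable_restrictT _ _).1 => //.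
  by apply: measurable_funTS; exact: L2r_meas.
have bound x n : ~ N x -> (F x - f n x) ^+ 2 <= 4 * 4^-1 ^+ n * fine (H x).
  move=> Nx; have [s s0 [<- hs]] := dec x Nx.
  have p0 : (0 : R) <= 2^-1 ^+ n by exact: expr_inv_ge0.
  have : `|F x - f n x| <= 2 * s * 2^-1 ^+ n.
    have gE p : gg p x = f p x by rewrite /gg patchE mem_set.
    have cF : (fun p => `|gg p x - f n x|) @ \oo --> `|F x - f n x|.
      by apply: cvg_norm; apply: cvgB; [exact: cg|exact: cvg_cst].
    rewrite -(cvg_lim _ cF)//; apply: limr_le; first by apply/cvg_ex; eexists; exact: cF.
    exists n => // p /= np; rewrite gE -(subnKC np); apply: le_trans (hs _ _) _.
    by rewrite ler_wpM2l ?mulr_ge0// gerBl ?expr_inv_ge0.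
  move=> h; have h2 := lerXn2r 2 (normr_ge0 _) (le_trans (normr_ge0 _) h) h.
  move: h2; rewrite real_normK ?num_real// => h2; apply: le_trans h2 _.
  rewrite le_eqVlt; apply/orP; left; apply/eqP.
  have -> : (4^-1 ^+ n : R) = (2^-1 ^+ n) ^+ 2.
    by rewrite -exprM mulnC exprM; congr (_ ^+ _); field.
  by ring.
have IF n : (\int[mu]_x ((F x - f n x) ^+ 2)%:E <= (8 * 4^-1 ^+ n)%:E)%E.
  have p0 : (0 : R) <= 4 * 4^-1 ^+ n by rewrite mulr_ge0// ?expr_inv_ge0.
  apply: (@le_trans _ _ (\int[mu]_x ((4 * 4^-1 ^+ n)%:E * H x))%E).
    apply: ae_ge0_le_integral => //.
    - by move=> x _; rewrite lee_fin sqr_ge0.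
    - apply/measurable_EFinP; apply: measurable_funX; apply: measurable_funB => //.
      exact: L2r_meas.
    - by move=> x _; apply: mule_ge0 => //; rewrite ?lee_fin.
    - exact: measurable_funeM.
    exists N; split => // x /= hx; apply: contrapT => Nx; apply: hx => _.
    have Hf : H x \is a fin_num.
      by apply: contrapT => h; apply: Nx; apply: hN => /= hh; exact: h (hh I).
    by rewrite -(fineK Hf) -EFinM lee_fin; exact: bound.
  rewrite ge0_integralZl//.
  have -> : (8 * 4^-1 ^+ n)%:E = ((4 * 4^-1 ^+ n)%:E * 2%:E)%E :> \bar R.
    by rewrite -EFinM; congr EFin; ring.
  by rewrite lee_wpmul2l// ?lee_fin.
have L2d n : L2r (fun x => F x - f n x).
  have mFf : mfn setT (fun x => F x - f n x).
    by apply: measurable_funB => //; exact: L2r_meas.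
  apply/L2rP; split=> //; apply/integrableP; split.
    by apply/measurable_EFinP; exact: (measurable_funX 2 mFf).
  under eq_integral do rewrite /= ger0_norm ?sqr_ge0//.
  by apply: le_lt_trans (IF n) _; rewrite ltry.
exists F.
  have -> : F = fun x => (F x - f 0%N x) + f 0%N x.
    by apply/funext => x; rewrite subrK.
  exact: L2rD.
move=> n; rewrite -lee_fin /Rintegral fineK//.
by apply: integrable_fin_num => //; exact: L2r_sq.
Unshelve. all: by end_near. Qed.

End Completeness.

Section Compactness.
Context {R : realType}.
Implicit Types (u v w : R -> R[i]).

Lemma L2_complete (u : nat -> R -> R[i]) : (forall n, L2 (u n)) ->
  (forall n, mass (fun x => u n.+1 x - u n x) <= 8^-1 ^+ n) ->
  exists2 U, L2 U & forall n, mass (fun x => U x - u n x) <= 16 * 4^-1 ^+ n.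
Proof.
move=> hu du.
have E n : mass (fun x => u n.+1 x - u n x) =
    \int[mu]_x ((Re (u n.+1 x) - Re (u n x)) ^+ 2) +
    \int[mu]_x ((Im (u n.+1 x) - Im (u n x)) ^+ 2).
  rewrite mass_ReIm; last exact: L2B.
  by congr (_ + _); apply: eq_Rintegral => x _; rewrite ?ReB ?ImB.
have i0 (f : R -> R) : 0 <= \int[mu]_x (f x ^+ 2).
  by apply: Rintegral_ge0 => x _; exact: sqr_ge0.
have [F hF FE] := @L2r_complete R (fun n x => Re (u n x)) (fun n => (hu n).1)
  (fun n => le_trans (ler_wpDr (i0 (fun x => Im (u n.+1 x) - Im (u n x))) (lexx _))
     (eq_rect _ (fun t => t <= _) (du n) _ (E n))).
have [G hG GE] := @L2r_complete R (fun n x => Im (u n x)) (fun n => (hu n).2)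
  (fun n => le_trans (ler_wpDl (i0 (fun x => Re (u n.+1 x) - Re (u n x))) (lexx _))
     (eq_rect _ (fun t => t <= _) (du n) _ (E n))).
have hU : L2 (fun x => Complex (F x) (G x)) by split.
exists (fun x => Complex (F x) (G x)) => // n.
rewrite mass_ReIm; last exact: L2B.
have -> : 16 * 4^-1 ^+ n = 8 * 4^-1 ^+ n + 8 * 4^-1 ^+ n :> R by ring.
apply: lerD.
  by under eq_Rintegral do rewrite ReB; exact: FE.
by under eq_Rintegral do rewrite ImB; exact: GE.
Qed.

Lemma geometric_small4 (C e : R) : 0 <= C -> 0 < e ->
  exists N : nat, forall n, (N <= n)%N -> C * 4^-1 ^+ n <= e.
Proof.
move=> C0 e0; have e1 : 0 < e / (C + 1) by rewrite divr_gt0// ltr_wpDl.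
have [N hN] := geometric_small e1; exists N => n /hN h.
have q0 : (0 : R) <= 2^-1 ^+ n by exact: expr_inv_ge0.
have q1 : (2^-1 ^+ n : R) <= 1 by rewrite exprn_ile1// ?invr_ge0// invf_le1 ?ler1n.
have -> : (4^-1 ^+ n : R) = 2^-1 ^+ n * 2^-1 ^+ n.
  by rewrite -exprMn; congr (_ ^+ _); field.
have h2 : 2^-1 ^+ n * 2^-1 ^+ n <= e / (C + 1).
  by apply: le_trans (ltW h); rewrite ler_piMr.
apply: le_trans (ler_wpM2l C0 h2) _.
by rewrite mulrA ler_pdivrMr ?ltr_wpDl// mulrC ler_wpM2l ?lerDl// ltW.
Qed.

(** The defect of the weak identity for the limit is a fixed number. Each approximant has defect 0,
    so by Cauchy-Schwarz the square of that number is at most a constant times 4^(-n) for every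
    [n]. *)
Lemma wder_closed (f f' : nat -> R -> R) (F F' : R -> R) (C : R) :
  (forall n, L2r (f n)) -> (forall n, L2r (f' n)) -> L2r F -> L2r F' -> 0 <= C ->
  (forall n, wder (f n) (f' n)) ->
  (forall n, \int[mu]_x ((F x - f n x) ^+ 2) <= C * 4^-1 ^+ n) ->
  (forall n, \int[mu]_x ((F' x - f' n x) ^+ 2) <= C * 4^-1 ^+ n) -> wder F F'.
Proof.
move=> hf hf' hF hF' C0 hw hc hc' psi tpsi.
have [A [A0 cchi dpsi psi0 chi0]] := test_function_support tpsi.
set chi := derive1 psi in cchi dpsi chi0 *.
have out x : x < - A \/ A < x -> A < `|x|.
  by rewrite lter_normr; case=> h; rewrite ?h ?orbT// ltrNr h orbT.
have hchi : L2r chi.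
  by apply: (@L2r_compact_support _ _ (- A) A) => // x /out; exact: chi0.
have hpsi : L2r psi.
  apply: (@L2r_compact_support _ _ (- A) A) => [t|x /out /ltW]; last exact: psi0.
  by apply/differentiable_continuous/derivable1_diffP; case: (dpsi t).
apply/eqP; rewrite -addr_eq0; apply/eqP.
set X := _ + _; pose a := \int[mu]_x (chi x ^+ 2); pose b := \int[mu]_x (psi x ^+ 2).
have a0 : 0 <= a by apply: Rintegral_ge0 => x _; exact: sqr_ge0.
have b0 : 0 <= b by apply: Rintegral_ge0 => x _; exact: sqr_ge0.
have key n : X ^+ 2 <= (2 * (a + b) * C) * 4^-1 ^+ n.
  have -> : X = \int[mu]_x ((F x - f n x) * chi x) +
                \int[mu]_x ((F' x - f' n x) * psi x).
    have e1 : \int[mu]_x ((F x - f n x) * chi x) =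
        \int[mu]_x (F x * chi x) - \int[mu]_x (f n x * chi x).
      rewrite -RintegralB//; try exact: L2rM.
      by apply: eq_Rintegral => x _; ring.
    have e2 : \int[mu]_x ((F' x - f' n x) * psi x) =
        \int[mu]_x (F' x * psi x) - \int[mu]_x (f' n x * psi x).
      rewrite -RintegralB//; try exact: L2rM.
      by apply: eq_Rintegral => x _; ring.
    rewrite e1 e2 (hw n psi tpsi) /X; ring.
  have cs (p q : R -> R) : L2r p -> L2r q -> (\int[mu]_x (p x * q x)) ^+ 2 <=
      \int[mu]_x (p x ^+ 2) * \int[mu]_x (q x ^+ 2).
    move=> hp hq; apply: Rintegral_cauchy_schwarz => //.
    - exact: L2r_sq.
    - exact: L2r_sq.
    - exact: L2rM.
  have s1 := cs _ _ (L2rB hF (hf n)) hchi; have s2 := cs _ _ (L2rB hF' (hf' n)) hpsi.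
  have t1 := ler_wpM2r a0 (hc n); have t2 := ler_wpM2r b0 (hc' n).
  move: (le_trans s1 t1) (le_trans s2 t2).
  set p := Rintegral _ _ _; set q := Rintegral _ _ _ => h1 h2.
  have h3 : (p + q) ^+ 2 <= 2 * p ^+ 2 + 2 * q ^+ 2.
    rewrite -subr_ge0 (_ : _ - _ = (p - q) ^+ 2); last by ring.
    exact: sqr_ge0.
  apply: le_trans h3 _.
  have -> : 2 * (a + b) * C * 4^-1 ^+ n =
    2 * (C * 4^-1 ^+ n * a) + 2 * (C * 4^-1 ^+ n * b) by ring.
  by apply: lerD; rewrite ler_wpM2l.
apply/eqP; rewrite -sqrf_eq0 eq_le sqr_ge0 andbT.
apply/ler_addgt0Pr => e e0; rewrite add0r.
have c0 : 0 <= 2 * (a + b) * C by rewrite !mulr_ge0// addr_ge0.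
have [N hN] := geometric_small4 c0 e0.
by apply: le_trans (key N) (hN N _).
Qed.

(** The L^2 limits are linked by a weak derivative only; [wder_ac2] replaces the limit of the
    functions by its continuous representative, which changes no distance. *)
Lemma sobolev_complete (u v : nat -> R -> R[i]) : (forall n, sobolev (u n) (v n)) ->
  (forall n, mass (fun x => u n.+1 x - u n x) <= 8^-1 ^+ n) ->
  (forall n, mass (fun x => v n.+1 x - v n x) <= 8^-1 ^+ n) ->
  exists U V, sobolev U V /\ forall n, mass (fun x => u n x - U x) <= 16 * 4^-1 ^+ n /\
    mass (fun x => v n x - V x) <= 16 * 4^-1 ^+ n.
Proof.
move=> nuv du dv.
have hu n := (sobolev_L2 (nuv n)).1; have hv n := (sobolev_L2 (nuv n)).2.
have [U hU UE] := L2_complete hu du; have [V hV VE] := L2_complete hv dv.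
have i0 (f : R -> R) : 0 <= \int[mu]_x (f x ^+ 2).
  by apply: Rintegral_ge0 => x _; exact: sqr_ge0.
have comp (W : R -> R[i]) (w : nat -> R -> R[i]) : L2 W -> (forall n, L2 (w n)) ->
    (forall n, mass (fun x => W x - w n x) <= 16 * 4^-1 ^+ n) -> forall n,
    \int[mu]_x ((Re (W x) - Re (w n x)) ^+ 2) <= 16 * 4^-1 ^+ n /\
    \int[mu]_x ((Im (W x) - Im (w n x)) ^+ 2) <= 16 * 4^-1 ^+ n.
  move=> hW hw WE n; have := WE n; rewrite mass_ReIm; last exact: L2B.
  under eq_Rintegral do rewrite ReB; under [X in _ + X <= _]eq_Rintegral do rewrite ImB.
  by move=> h; split; apply: le_trans h; rewrite ?lerDl ?lerDr; exact: i0.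
have cU := comp U u hU hu UE; have cV := comp V v hV hv VE.
have C0 : 0 <= (16 : R) by [].
have w1 : wder (fun x => Re (U x)) (fun x => Re (V x)).
  apply: (@wder_closed (fun n x => Re (u n x)) (fun n x => Re (v n x)) _ _ 16) => //.
  - by move=> n; case: (hu n).
  - by move=> n; case: (hv n).
  - by case: hU.
  - by case: hV.
  - by move=> n; case: (nuv n) => /ac2_wder.
  - by move=> n; case: (cU n).
  - by move=> n; case: (cV n).
have w2 : wder (fun x => Im (U x)) (fun x => Im (V x)).
  apply: (@wder_closed (fun n x => Im (u n x)) (fun n x => Im (v n x)) _ _ 16) => //.
  - by move=> n; case: (hu n).
  - by move=> n; case: (hv n).
  - by case: hU.
  - by case: hV.
  - by move=> n; case: (nuv n) => _ /ac2_wder.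
  - by move=> n; case: (cU n).
  - by move=> n; case: (cV n).
have [a na ae1] := wder_ac2 hU.1 hV.1 w1; have [b nb ae2] := wder_ac2 hU.2 hV.2 w2.
have nn : sobolev (fun x => Complex (a x) (b x)) V by split.
exists (fun x => Complex (a x) (b x)), V; split => // n; split; last first.
  by rewrite massBC; exact: VE.
rewrite massBC; apply: le_trans (UE n); rewrite le_eqVlt; apply/orP; left; apply/eqP.
apply: mass_ae; [by apply: L2B => //; exact: (sobolev_L2 nn).1|exact: L2B|].
apply: aeS (aeI ae1 ae2) => x [-> ->].
by congr (_ - _); case: (U x).
Qed.

Lemma L2_dot_amgm u w (t : R) : L2 u -> L2 w -> 0 < t ->
  `|L2_dot u w| <= mass u / (2 * t) + t / 2 * mass w.
Proof.
move=> hu hw t0; have a0 := mass_ge0 u; have b0 := mass_ge0 w.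
apply: normr_le_sqr.
  by apply: addr_ge0; apply: mulr_ge0 => //; rewrite ?invr_ge0 ltW// ?mulr_gt0// divr_gt0.
apply: le_trans (L2_cauchy_schwarz hu hw) _.
have -> : mass u * mass w = 4 * (mass u / (2 * t)) * (t / 2 * mass w).
  by field; rewrite gt_eqF.
by have := sqr_ge0 (mass u / (2 * t) - t / 2 * mass w); lra.
Qed.

Lemma mass_dist u w (t : R) : L2 u -> L2 w -> 0 < t ->
  `|mass u - mass w| <= mass (fun x => u x - w x) / (2 * t) + t * (mass u + mass w).
Proof.
move=> hu hw t0; have hd := L2B hu hw; have hs := L2D hu hw.
have -> : mass u - mass w = L2_dot (fun x => u x - w x) (fun x => u x + w x).
  rewrite L2_dotBl ?L2_dotDr// !massE (L2_dotC w u); ring.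
apply: le_trans (L2_dot_amgm hd hs t0) _; rewrite lerD2l.
have -> : t * (mass u + mass w) = t / 2 * (2 * mass u + 2 * mass w) by field.
by apply: ler_wpM2l; [rewrite divr_ge0// ltW|exact: massD_le].
Qed.

End Compactness.

Lemma le_quarter_half {R : realType} (x y e : R) :
  0 <= e -> x <= e / 4 -> y <= e / 2 -> x + y <= e.
Proof. lra. Qed.

Lemma kinetic_arith {R : realType} (m a b k P Pu Pw X : R) :
  m <= 2^-1 * (2^-1 * a + 2^-1 * b - 4^-1 * k) + P -> P - Pu <= X -> P - Pw <= X ->
  k <= 4 * (2^-1 * a + Pu - m) + 4 * (2^-1 * b + Pw - m) + 8 * X.
Proof. lra. Qed.

(** * Continuity of the energy and closeness of derivatives *)

Section MinimizingSequences.
Context {R : realType}.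
Variables G g : R -> R.
Hypothesis nl : nonlinearity G g.
Implicit Types (u v w : R -> R[i]).

Lemma sobolev_sup_sqrt u v (D : R) : sobolev u v -> mass u + mass v <= D ->
  forall x, cabs (u x) <= Num.sqrt (2 * D).
Proof.
move=> uv uvD x; rewrite -[cabs _]ger0_norm ?cabs_ge0//; apply: normr_le_sqr.
  exact: sqrtr_ge0.
have D0 : 0 <= D by apply: le_trans uvD; rewrite addr_ge0 ?mass_ge0.
rewrite sqr_sqrtr ?mulr_ge0//; apply: le_trans (sobolev_sup x uv ltr01) _.
by rewrite divr1 mul1r -mulrDr ler_wpM2l.
Qed.

(** On an H^1 ball the sup bound confines all values to one interval, where the constants for [G]
    are fixed; the modulus [d] thus depends on [D] and [e] alone. *)
Lemma en_close (D e : R) : 0 <= D -> 0 < e -> exists2 d : R, 0 < d &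
  forall u v w wv, sobolev u v -> sobolev w wv -> mass u + mass v <= D ->
    mass w + mass wv <= D -> mass (fun x => u x - w x) <= d ->
    mass (fun x => v x - wv x) <= d ->
    `|mass u - mass w| <= e /\ `|en G u v - en G w wv| <= e.
Proof.
move=> D0 e0; pose B := Num.sqrt (2 * D).
have [L L0 hL] := pot_dist nl (sqrtr_ge0 (2 * D) : 0 <= B).
have L1 : 0 < L + 1 by rewrite ltr_wpDl.
have D1 : 0 < D + 1 by rewrite ltr_wpDl.
have A0 : 0 < 8 * (L + 1) * (D + 1) by apply: mulr_gt0 => //; apply: mulr_gt0.
(* The weight [t] makes the terms proportional to the total masses at most e / 4; [d] then does the
   same for the distances divided by [t]. *)
pose t := e / (8 * (L + 1) * (D + 1)).
have t0 : 0 < t by rewrite divr_gt0.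
pose d := t * e / (4 * (L + 1)).
have d0 : 0 < d by apply: divr_gt0; apply: mulr_gt0.
exists d => // u v w wv nu nw uD wD du dv.
have [hu hv] := sobolev_L2 nu; have [hw hwv] := sobolev_L2 nw.
have u0 := mass_ge0 u; have v0 := mass_ge0 v; have w0 := mass_ge0 w.
have wv0 := mass_ge0 wv.
have uB := aeT (sobolev_sup_sqrt nu uD); have wB := aeT (sobolev_sup_sqrt nw wD).
have tD : (L + 1) * (t * (2 * D)) <= e / 4.
  have -> : (L + 1) * (t * (2 * D)) = e / 4 * (D / (D + 1)).
    by rewrite /t; field; rewrite !gt_eqF// ltr_wpDl.
  rewrite ger_pMr ?divr_gt0// ler_pdivrMr ?ltr_wpDl// mul1r lerDl//.
have L11 : 1 <= L + 1 by rewrite lerDr.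
have tD0 : 0 <= t * (2 * D) by apply: mulr_ge0; [exact: ltW|exact: mulr_ge0].
have dt0 : 0 <= d / t by apply: divr_ge0; exact: ltW.
have dt : (L + 1) * (d / t) = e / 4.
  by rewrite /d; field; rewrite !gt_eqF.
clearbody d; clearbody t.
have t2 : 0 < 2 * t by apply: mulr_gt0.
have md (p q : R -> R[i]) : L2 p -> L2 q -> mass p <= D -> mass q <= D ->
    mass (fun x => p x - q x) <= d -> `|mass p - mass q| <= e / 2.
  move=> hp hq pD qD pq; apply: le_trans (mass_dist hp hq t0) _.
  have s1 : t * (mass p + mass q) <= (L + 1) * (t * (2 * D)).
    have : t * (mass p + mass q) <= t * (2 * D).
      by rewrite ler_pM2l// mulr_natl mulr2n; exact: lerD.
    by move=> h; apply: le_trans h _; rewrite ler_peMl.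
  have s2 : mass (fun x => p x - q x) / (2 * t) <= (L + 1) * (d / t).
    apply: (@le_trans _ _ (d / t)).
      apply: ler_pM => //; first exact: mass_ge0.
        by rewrite invr_ge0 mulr_ge0// ltW.
      by rewrite lef_pV2 ?posrE// ler_peMl ?(ltW t0)// ler1n.
    by rewrite ler_peMl.
  apply: le_trans (lerD s2 (le_trans s1 tD)) _; rewrite dt.
  by apply: eq_ler; field.
have uD1 : mass u <= D by apply: le_trans uD; rewrite lerDl.
have vD1 : mass v <= D by apply: le_trans uD; rewrite lerDr.
have wD1 : mass w <= D by apply: le_trans wD; rewrite lerDl.
have wvD1 : mass wv <= D by apply: le_trans wD; rewrite lerDr.
have m1 := md u w hu hw uD1 wD1 du; have m2 := md v wv hv hwv vD1 wvD1 dv.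
have pd : `|pot G u - pot G w| <= e / 2.
  apply: le_trans (hL _ _ _ hu hw uB wB t0) _.
  have s1 : L * (t * (mass u + mass w)) <= (L + 1) * (t * (2 * D)).
    apply: ler_pM => //; [by rewrite mulr_ge0 ?addr_ge0// ltW|by rewrite lerDl|].
    by rewrite ler_pM2l// mulr_natl mulr2n; exact: lerD.
  have s2 : L * (mass (fun x => u x - w x) / t) <= (L + 1) * (d / t).
    apply: ler_pM => //; [by rewrite divr_ge0 ?mass_ge0// ltW|by rewrite lerDl|].
    by rewrite ler_pM2r ?invr_gt0.
  rewrite mulrDr; apply: le_trans (lerD (le_trans s1 tD) s2) _; rewrite dt.
  by apply: eq_ler; field.
split.
  by apply: le_trans m1 _; rewrite ler_pdivrMr// ler_peMr ?(ltW e0)// ler1n.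
have -> : en G u v - en G w wv =
    2^-1 * (mass v - mass wv) + (pot G u - pot G w) by rewrite /en; ring.
apply: le_trans (ler_normD _ _) _.
have : `|2^-1 * (mass v - mass wv)| <= e / 4.
  rewrite normrM [`|2^-1|]ger0_norm ?invr_ge0//.
  have -> : e / 4 = 2^-1 * (e / 2) by field.
  by rewrite ler_pM2l.
move=> h; exact: le_quarter_half (ltW e0) h pd.
Qed.

Variables lambda m : R.
Hypothesis lambda0 : 0 < lambda.
Hypothesis en_ge : forall u v, sobolev u v -> mass u = lambda -> m <= en G u v.
Hypothesis m0 : m < 0.

(* Apply the lower bound to the midpoint (u + w) / 2: its mass is at most
   lambda, and its kinetic energy falls short of the average of the two kinetic
   energies by |u' - w'|^2 / 8. *)
Lemma kinetic_close (kap : R) : 0 <= kap -> exists2 L : R, 0 <= L &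
  forall u v w wv t, sobolev u v -> sobolev w wv -> mass u = lambda -> mass w = lambda ->
    mass v <= kap -> mass wv <= kap -> 0 < t ->
    mass (fun x => v x - wv x) <= 4 * (en G u v - m) + 4 * (en G w wv - m) +
      L * (t + mass (fun x => u x - w x) / t).
Proof.
have c4 : 4^-1 <= 2 * lambda + 1 by have := lambda0; lra.
move=> k0; pose D := lambda + kap; pose B := Num.sqrt (2 * D).
have D0 : 0 <= D by rewrite addr_ge0// ltW.
have [L L0 hL] := pot_dist nl (sqrtr_ge0 (2 * D) : 0 <= B).
exists (8 * L * (2 * lambda + 1)).
  by rewrite !mulr_ge0// addr_ge0// mulr_ge0// ltW.
move=> u v w wv t nu nw ul wl vk wk t0.
have [hu hv] := sobolev_L2 nu; have [hw hwv] := sobolev_L2 nw.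
pose h : R[i] := Complex 2^-1 0.
have hh : cabs h ^+ 2 = 4^-1 by rewrite cabs_sqr /= expr0n addr0; field.
pose p x := h * (u x + w x); pose pv x := h * (v x + wv x).
have np : sobolev p pv by apply: sobolevZ; exact: sobolevD.
have [hp hpv] := sobolev_L2 np.
have half (a b : R -> R[i]) : L2 a -> L2 b -> mass (fun x => h * (a x + b x)) =
    2^-1 * mass a + 2^-1 * mass b - 4^-1 * mass (fun x => a x - b x).
  move=> ha hb; rewrite massZ; last exact: L2D.
  by rewrite hh massD_dot// massB_dot//; field.
have mp : mass p = lambda - 4^-1 * mass (fun x => u x - w x).
  by rewrite half// ul wl; field.
have mpv := half _ _ hv hwv; rewrite -/pv in mpv.
set q := mass (fun x => u x - w x) in mp *.
set k := mass (fun x => v x - wv x) in mpv *.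
have q0 : 0 <= q by exact: mass_ge0.
have kk0 : 0 <= k by exact: mass_ge0.
have pl : mass p <= lambda by rewrite mp gerBl mulr_ge0.
have ep := en_ge_le nl lambda0 en_ge np pl.
(* The level [m] is negative, so the linear lower bound at a smaller mass is at least [m]. *)
have em : m <= en G p pv.
  apply: le_trans ep; rewrite -[leLHS]mul1r ler_wnM2r ?(ltW m0)//.
  by rewrite ler_pdivrMr// mul1r.
have bnd (a av : R -> R[i]) : sobolev a av -> mass a <= lambda -> mass av <= kap ->
    {ae mu, forall x, cabs (a x) <= B}.
  by move=> na al avk; apply: aeT; apply: (sobolev_sup_sqrt na); rewrite /D lerD.
have uB := bnd _ _ nu (eq_ler ul) vk.
have wB := bnd _ _ nw (eq_ler wl) wk.
have pvk : mass pv <= kap by rewrite mpv; lra.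
have pB := bnd _ _ np pl pvk.
have diff (a b : R -> R[i]) : L2 a -> L2 b ->
    mass (fun x => h * (a x + b x) - a x) = 4^-1 * mass (fun x => a x - b x).
  move=> ha hb; rewrite massBC -hh -massZ; last exact: L2B.
  apply: eq_Rintegral => x _.
  by rewrite !(cabs_sqr, ReB, ImB, ReM, ImM, ReD, ImD) /=; field.
have pu := hL _ _ _ hp hu pB uB t0; have pw := hL _ _ _ hp hw pB wB t0.
have e1 : mass (fun x => p x - u x) = 4^-1 * q by exact: diff.
have e2 : mass (fun x => p x - w x) = 4^-1 * q.
  rewrite /q massBC -diff//; apply: eq_Rintegral => x _.
  by rewrite !(cabs_sqr, ReB, ImB, ReM, ImM, ReD, ImD) /=; ring.
rewrite e1 ul in pu; rewrite e2 wl in pw.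
have bound : L * (t * (mass p + lambda) + 4^-1 * q / t) <=
    L * (2 * lambda + 1) * (t + q / t).
  rewrite -[leRHS]mulrA; apply: ler_wpM2l => //.
  rewrite [leRHS]mulrDr; apply: lerD.
    rewrite [leLHS]mulrC ler_pM2r//; apply: le_trans (lerD pl (lexx _)) _.
    by rewrite mulr_natl mulr2n lerDl.
  have qt : 0 <= q / t by apply: divr_ge0 => //; exact: ltW.
  have -> : 4^-1 * q / t = 4^-1 * (q / t) by rewrite mulrA.
  by apply: ler_wpM2r.
move: (le_trans pu bound) (le_trans pw bound).
rewrite !ler_norml => /andP[_ {}pu] /andP[_ {}pw].
have -> : 8 * L * (2 * lambda + 1) * (t + q / t) =
  8 * (L * (2 * lambda + 1) * (t + q / t)) by ring.
set X := L * _ * _ in pu pw *.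
move: em; rewrite /en mpv => em; exact: kinetic_arith em pu pw.
Qed.

End MinimizingSequences.

(** * Convergence of almost minimizers *)

Section CompactMinimizing.
Context {R : realType}.
Variables G g : R -> R.
Hypothesis nl : nonlinearity G g.
Implicit Types (u v w : R -> R[i]).

Variables lambda m : R.
Hypothesis lambda0 : 0 < lambda.
Hypothesis en_ge : forall u v, sobolev u v -> mass u = lambda -> m <= en G u v.
Hypothesis m0 : m < 0.

(** Proved by contradiction: a sequence of almost minimizers far from every minimizer, recentred at
    medians, would have members arbitrarily close to some minimizer. Translating that minimizer back
    contradicts the choice of the sequence. *)
Lemma minimizing_close (e : R) : 0 < e -> exists2 d : R, 0 < d &
  forall u v, sobolev u v -> mass u = lambda -> en G u v <= m + d ->
    exists w wv, [/\ sobolev w wv, mass w = lambda, en G w wv = m,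
      mass (fun x => u x - w x) <= e & mass (fun x => v x - wv x) <= e].
Proof.
have l0 : 0 < lambda by exact: lambda0.
have mneg : m < 0 by exact: m0.
move=> e0; apply: contrapT => hno.
have far (n : nat) : exists p : (R -> R[i]) * (R -> R[i]),
    [/\ sobolev p.1 p.2, mass p.1 = lambda, en G p.1 p.2 <= m + n.+1%:R^-1 &
    ~ exists w wv, [/\ sobolev w wv, mass w = lambda, en G w wv = m,
      mass (fun x => p.1 x - w x) <= e & mass (fun x => p.2 x - wv x) <= e]].
  apply: contrapT => hn; apply: hno; exists n.+1%:R^-1; first by rewrite invr_gt0.
  move=> u v uv ul ule; apply: contrapT => hw; apply: hn.
  by exists (u, v).
have [P hP] := choice far.
have med n : exists y, \int[mu]_(x in `]-oo, y]) (cabs ((P n).1 x) ^+ 2) = lambda / 2.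
  by have [n1 n2 _ _] := hP n; exact: (median n1).
have [y hy] := choice med.
pose w n x := (P n).1 (1 * x + y n).
pose wv n x := Complex 1 0 * (P n).2 (1 * x + y n).
have nw n : sobolev (w n) (wv n).
  by have [n1 _ _ _] := hP n; exact: (sobolev_rescale (y n) ltr01 n1).
have wl n : mass (w n) = lambda.
  have [n1 ul _ _] := hP n; have [hu _] := sobolev_L2 n1.
  by rewrite (mass_rescale (y n) ltr01 hu) divr1.
have mwv n : mass (wv n) = mass (P n).2.
  have [n1 ul _ _] := hP n; have [_ hv] := sobolev_L2 n1.
  by rewrite (mass_rescale_deriv (y n) ltr01 hv) mul1r.
have ewE n : en G (w n) (wv n) = en G (P n).1 (P n).2.
  have [n1 _ _ _] := hP n.
  by rewrite /en mwv (pot_rescale nl (y n) ltr01 n1) divr1.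
have ew n : en G (w n) (wv n) <= m + n.+1%:R^-1.
  by rewrite ewE; have [_ _ h _] := hP n.
have [C C0 hC] := en_coercive nl lambda0.
pose kap := 4 * (C + 1).
have kap0 : 0 <= kap by rewrite mulr_ge0// addr_ge0.
have in1 n : n.+1%:R^-1 <= 1 :> R by rewrite invf_le1// ler1n.
have wk n : mass (wv n) <= kap.
  have h1 := hC _ _ (nw n) (eq_ler (wl n)).
  have h2 := le_trans (ew n) (lerD (lexx m) (in1 n)).
  have h3 : mass (wv n) / 4 - C <= m + 1 := le_trans h1 h2.
  rewrite /kap; clear - h3 mneg; lra.
(* [U] refines the filter of neighbourhoods of infinity, so the energies tend to [m] along it. *)
have [U [UU Uoo]] := @ultraFilterLemma nat (\oo) _.
have UP : ProperFilter U := ultra_proper.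
have Utail N : U [set n | (N <= n)%N] by apply: Uoo; exists N.
have Usmall (r : R) : 0 < r -> U [set n : nat | n.+1%:R^-1 <= r].
  move=> r0; have := Utail (Num.truncn r^-1).
  apply: (@filterS _ U _) => n /= hn.
  rewrite -[r]invrK lef_pV2 ?posrE ?invr_gt0//.
  apply/ltW/(lt_le_trans (Num.Theory.truncnS_gt _)).
  by rewrite ler_nat ltnS.
have tight eta : 0 < eta -> exists2 L : R, 0 < L &
    U [set n | lambda - eta <= \int[mu]_(x in `[- L, L]) (cabs (w n x) ^+ 2)].
  move=> eta0; pose et := Num.min (eta / 2) (lambda / 2).
  have et0 : 0 < et by rewrite lt_min !divr_gt0.
  have et1 : et <= lambda / 2 by rewrite ge_min lexx orbT.
  have et2 : et <= eta / 2 by rewrite ge_min lexx.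
  have [L [d [L0 d0 hL]]] := tightness nl lambda0 en_ge m0 et0 et1.
  exists L => //; have := Usmall d d0; apply: (@filterS _ U _) => n /= hn.
  have [n1 ul ule _] := hP n.
  have ule' : en G (P n).1 (P n).2 <= m + d by apply: le_trans ule _; rewrite lerD2l.
  have := hL _ _ (y n) n1 ul ule' (hy n).
  have L2f := L2r_nice_sqr n1.
  have LL : - L <= L by lra.
  have := Rintegral_affine_itv (y n) ltr01 L2f LL.
  rewrite !mul1r [- L + y n]addrC [L + y n]addrC => -> h.
  by apply: le_trans h; rewrite lerD2l lerN2 mulrC -ler_pdivlMr.
have cau := ultra_L2_cauchy UU nw wl wk tight.
have [L L0 hK] := kinetic_close nl lambda0 en_ge m0 kap0.
have cau2 (r : R) : 0 < r -> exists2 A, U A & forall n p, A n -> A p ->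
    mass (fun x => w n x - w p x) <= r /\ mass (fun x => wv n x - wv p x) <= r.
  (* With L^2 distance at most t^2 the last term of [kinetic_close] is at most 2 L t <= r / 2, and
     two energy excesses of at most r / 16, each with factor 4, use up the other half. *)
  move=> r0; pose t := r / (4 * (L + 1)).
  have L1 : 0 < L + 1 by rewrite ltr_wpDl.
  have t0 : 0 < t by rewrite divr_gt0// mulr_gt0.
  pose s := Num.min r (t ^+ 2).
  have s0 : 0 < s by rewrite lt_min r0 exprn_gt0.
  have sr : s <= r by rewrite ge_min lexx.
  have st : s <= t ^+ 2 by rewrite ge_min lexx orbT.
  have [A UA hA] := cau s s0.
  have r16 : 0 < r / 16 by rewrite divr_gt0.
  exists (A `&` [set n : nat | n.+1%:R^-1 <= r / 16]).
    by apply: filterI => //; exact: Usmall.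
  move=> n p [An /= rn] [Ap /= rp]; have h := hA _ _ An Ap.
  split; first exact: le_trans h sr.
  apply: le_trans (hK _ _ _ _ t (nw n) (nw p) (wl n) (wl p) (wk n) (wk p) t0) _.
  have qt : mass (fun x => w n x - w p x) / t <= t.
    by rewrite ler_pdivrMr// -expr2 (le_trans h).
  have : L * (t + mass (fun x => w n x - w p x) / t) <= r / 2.
    apply: (@le_trans _ _ (L * (2 * t))); first by rewrite ler_wpM2l// mulr_natl mulr2n lerD2l.
    have -> : L * (2 * t) = r / 2 * (L / (L + 1)) by rewrite /t; field; rewrite gt_eqF.
    by rewrite ger_pMr ?divr_gt0// ler_pdivrMr// mul1r lerDl.
  have e1 := le_trans (ew n) (lerD (lexx m) rn).
  have e2 := le_trans (ew p) (lerD (lexx m) rp).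
  move: e1 e2; set a := en G (w n) _; set b := en G (w p) _.
  set c := L * _; move=> e1 e2 e3.
  clearbody a b c; lra.
have g8 k : 0 < 8^-1 ^+ k :> R by rewrite exprn_gt0// invr_gt0.
have cau8 (k : nat) : exists A, U A /\ forall n p, A n -> A p ->
    mass (fun x => w n x - w p x) <= 8^-1 ^+ k /\
    mass (fun x => wv n x - wv p x) <= 8^-1 ^+ k.
  by have [A UA hA] := cau2 _ (g8 k); exists A.
have [A hA] := choice cau8.
(* Belonging to all earlier sets puts the choices of index [k] and [k + 1] into the common set
   [A k], so consecutive distances are at most 8^(-k); the condition k <= n drives the energies to
   [m]. *)
pose BB k := [set n | forall j, (j <= k)%N -> A j n] `&` [set n | (k <= n)%N].
have UB k : U (BB k).
  apply: filterI; last exact: Utail.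
  elim: k => [|k IH].
    apply: (@filterS _ U _ _ _ _ (hA 0%N).1) => n An j.
    by rewrite leqn0 => /eqP ->.
  apply: (@filterS _ U _ _ _ _ (filterI IH (hA k.+1).1)) => n [h1 h2] j.
  by rewrite leq_eqVlt => /predU1P[->//|]; rewrite ltnS; exact: h1.
have neB k : exists n, BB k n by have [n] := filter_ex (UB k); exists n.
have [nk hnk] := choice neB.
pose W k := w (nk k); pose WV k := wv (nk k).
have step k : mass (fun x => W k.+1 x - W k x) <= 8^-1 ^+ k /\
              mass (fun x => WV k.+1 x - WV k x) <= 8^-1 ^+ k.
  by apply: (hA k).2; [apply: (hnk k.+1).1|apply: (hnk k).1].
have [V [VV [nV hV]]] := sobolev_complete (fun k => nw (nk k))
  (fun k => (step k).1) (fun k => (step k).2).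
have [hVL hVVL] := sobolev_L2 nV.
(* [V] and [VV] are within 16 of the first terms, whose masses are at most lambda and kap, so
   doubling bounds them; the last two summands bound the sequence itself. *)
pose D := 2 * (lambda + kap) + 2 * 32 + lambda + kap.
have D0 : 0 <= D by rewrite /D; lra.
have V_le : mass V + mass VV <= D.
  have [hw hwv] := sobolev_L2 (nw (nk 0%N)).
  have [h1 h2] := hV 0%N; rewrite expr0 mulr1 in h1 h2.
  have b1 := massD_le hw (L2B hVL hw); have b2 := massD_le hwv (L2B hVVL hwv).
  have E1 : (fun x => w (nk 0%N) x + (V x - w (nk 0%N) x)) = V.
    by apply/funext => x; rewrite addrC subrK.
  have E2 : (fun x => wv (nk 0%N) x + (VV x - wv (nk 0%N) x)) = VV.
    by apply/funext => x; rewrite addrC subrK.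
  rewrite E1 massBC in b1; rewrite E2 [mass (fun x => VV x - _)]massBC in b2.
  have := wl (nk 0%N); have := wk (nk 0%N); rewrite /D; lra.
have W_le k : mass (W k) + mass (WV k) <= D.
  by have := wl (nk k); have := wk (nk k); rewrite /W /WV /D; lra.
have close r : 0 < r -> exists N : nat, forall k, (N <= k)%N ->
    `|mass (W k) - mass V| <= r /\ `|en G (W k) (WV k) - en G V VV| <= r.
  move=> r0; have [d d0 hd] := en_close nl D0 r0.
  have [N hN] := geometric_small4 (ler0n R 16) d0.
  exists N => k /hN h; have [h1 h2] := hV k.
  by apply: hd => //; [exact: nw|exact: le_trans h|exact: le_trans h].
have Vl : mass V = lambda.
  apply/eqP; rewrite -subr_eq0 -normr_le0; apply/ler_addgt0Pr => r r0.
  have [N hN] := close r r0; have [h _] := hN N (leqnn _).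
  by rewrite add0r distrC -(wl (nk N)).
have Ve : en G V VV = m.
  apply/eqP; rewrite eq_le en_ge// andbT; apply/ler_addgt0Pr => r r0.
  have r2 : 0 < r / 2 by rewrite divr_gt0.
  have [N hN] := close _ r2.
  pose k := maxn N (Num.truncn (r / 2)^-1).
  have [_] := hN k (leq_maxl _ _); rewrite ler_norml => /andP[h3 _].
  have h2 : (nk k).+1%:R^-1 <= r / 2.
    rewrite -[r / 2]invrK lef_pV2 ?posrE ?invr_gt0//.
    apply/ltW/(lt_le_trans (Num.Theory.truncnS_gt _)).
    by rewrite ler_nat ltnS; apply: leq_trans (leq_maxr _ _) _; exact: (hnk k).2.
  have := le_trans (ew (nk k)) (lerD (lexx m) h2).
  rewrite -/(W k) -/(WV k); move: h3.
  set a := en G (W k) _; set b := en G V _; clearbody a b => h3 h4; lra.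
have [N hN] := geometric_small4 (ler0n R 16) e0.
have [h1 h2] := hV N; have {}hN := hN N (leqnn _).
have [n1 _ _ nfar] := hP (nk N); apply: nfar.
(* The minimizer is moved back by the median of the member of the original sequence that it
   approximates. *)
pose yy := y (nk N).
have nT := sobolev_rescale (- yy) ltr01 nV.
exists (fun x => V (1 * x + - yy)), (fun x => Complex 1 0 * VV (1 * x + - yy)).
have [hu hv] := sobolev_L2 n1; have [hw hwv] := sobolev_L2 (nw (nk N)).
split => //.
- by rewrite (mass_rescale (- yy) ltr01 hVL) divr1.
- rewrite /en (mass_rescale_deriv (- yy) ltr01 hVVL) mul1r.
  by rewrite (pot_rescale nl (- yy) ltr01 nV) divr1.
- have := mass_rescale (- yy) ltr01 (L2B hw hVL); rewrite divr1 => E.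
  apply: le_trans hN; apply: le_trans h1; rewrite -E le_eqVlt; apply/orP; left.
  apply/eqP; congr mass; apply/funext => x; rewrite /w; congr ((P (nk N)).1 _ - _).
  by rewrite -/yy; ring.
- have := mass_rescale (- yy) ltr01 (L2B hwv hVVL); rewrite divr1 => E.
  apply: le_trans hN; apply: le_trans h2; rewrite -E le_eqVlt; apply/orP; left.
  apply/eqP; congr mass; apply/funext => x; rewrite /wv -/yy.
  have -> : Complex 1 0 = 1 :> R[i] by [].
  rewrite !mul1r; congr ((P (nk N)).2 _ - _); by ring.
Qed.

End CompactMinimizing.

(** * Conservation of mass and energy *)

Section StaticEstimates.
Context {R : realType}.
Variables (G g : R -> R) (f : R[i] -> R[i]).
Hypothesis nl : nonlinearity G g.
Hypothesis g_cont : continuous g.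
Hypothesis fE : forall z, f z = Complex (g (cabs z) / cabs z) 0 * z.
Implicit Types (u v w : R -> R[i]) (z : R[i]).

(** The radial factor in [f z = k |z| z]. The default value [k 0 = 0] of the division is harmless,
    as it multiplies z = 0. *)
Let k (r : R) := g r / r.

Lemma g_div_mul (r : R) : k r * r = g r.
Proof.
have [->|r0] := eqVneq r 0; first by rewrite mulr0 (nl_g0 nl).
by rewrite /k divfK.
Qed.

Lemma Re_f z : Re (f z) = k (cabs z) * Re z.
Proof. by rewrite fE ReM /= mul0r subr0. Qed.

Lemma Im_f z : Im (f z) = k (cabs z) * Im z.
Proof. by rewrite fE ImM /= mul0r addr0. Qed.

Lemma k_bound (B : R) : 0 <= B -> exists2 L : R, 0 <= L &
  forall r, 0 <= r <= B -> `|k r| <= L.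
Proof.
move=> B0; have [L L0 hL] := g_bound nl B0; exists L => // r /andP[r0 rB].
have [->|rn] := eqVneq r 0; first by rewrite /k invr0 mulr0 normr0.
rewrite /k normrM normfV [`|r|]ger0_norm// ler_pdivrMr ?lt_def ?rn//.
by apply: hL; rewrite r0.
Qed.

(** The inverse is discontinuous at 0, but it is the pointwise limit of the continuous functions r /
    (r^2 + 1 / (n + 1)), also at 0 where both sides are 0. *)
Lemma measurable_inv : mfn setT (fun r : R => r^-1).
Proof.
pose h (n : nat) (r : R) : R := r / (r ^+ 2 + n.+1%:R^-1).
apply: (@measurable_fun_cvg _ (measurableTypeR R) R setT h) => [n|r _].
  apply: continuous_measurable_fun => r; rewrite /h.
  have d0 : 0 < r ^+ 2 + n.+1%:R^-1 by rewrite ltr_wpDl ?sqr_ge0// invr_gt0.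
  apply: (@continuousM R R (fun r => r)); first exact: cvg_id.
  apply: (@continuousV _ _ (fun r : R => r ^+ 2 + n.+1%:R^-1)).
    by rewrite gt_eqF.
  apply: continuousD; last exact: cvg_cst.
  by apply: exprn_continuous.
have [->|r0] := eqVneq r 0.
  by rewrite invr0 (_ : h ^~ 0 = cst 0); [exact: cvg_cst|apply/funext => n; rewrite /h mul0r].
have -> : r^-1 = r / (r ^+ 2 + 0) by rewrite addr0 expr2 invfM mulrA mulfV// mul1r.
apply: cvgM; first exact: cvg_cst.
apply: cvgV; first by rewrite addr0 sqrf_eq0.
by apply: cvgD; [exact: cvg_cst|exact: cvg_harmonic].
Qed.

Lemma L2_f u (B : R) : 0 <= B -> L2 u -> {ae mu, forall x, cabs (u x) <= B} ->
  L2 (fun x => f (u x)).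
Proof.
move=> B0 hu uB; have [L L0 hL] := k_bound B0.
have mc := mfn_cabs hu; have [m1 m2] := L2_meas hu.
have mk : mfn setT (fun x => k (cabs (u x))).
  apply: measurable_funM.
    by apply: (measurableT_comp _ mc); exact: continuous_measurable_fun.
  exact: (measurableT_comp measurable_inv mc).
have key (h : R -> R) : L2r h -> L2r (fun x => k (cabs (u x)) * h x).
  move=> hh; apply/L2rP; split.
    by apply: measurable_funM => //; exact: L2r_meas.
  apply: (ae_itg_le (g := fun x => L ^+ 2 * h x ^+ 2)).
  - by apply: measurable_funX; apply: measurable_funM => //; exact: L2r_meas.
  - by apply: itgZ => //; exact: L2r_sq.
  - apply: aeS uB => x xB; rewrite ger0_norm ?sqr_ge0// exprMn ler_wpM2r ?sqr_ge0//.
    rewrite -(real_normK (num_real (k _))) lerXn2r ?nnegrE//.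
    by apply: hL; rewrite cabs_ge0.
case: hu => h1 h2; split => /=.
  by under eq_fun do rewrite Re_f; exact: key.
by under eq_fun do rewrite Im_f; exact: key.
Qed.

(* With k = g r / r, |f a - f b|^2 = (g |a| - g |b|)^2 + 2 k k' (|a||b| - a.b)
   and 2 (|a||b| - a.b) = |a - b|^2 - (|a| - |b|)^2. *)
Lemma f_lipschitz (B : R) : 0 <= B -> exists2 L : R, 0 <= L & forall a b : R[i],
  cabs a <= B -> cabs b <= B -> cabs (f a - f b) ^+ 2 <= L ^+ 2 * cabs (a - b) ^+ 2.
Proof.
move=> B0; have [L1 L10 h1] := nl_lip nl B0; have [L2 L20 h2] := k_bound B0.
exists (L1 + L2); first exact: addr_ge0.
move=> a b aB bB.
have ha := cabs_ge0 a; have hb := cabs_ge0 b.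
have ka := h2 (cabs a); rewrite ha aB in ka; have {}ka := ka isT.
have kb := h2 (cabs b); rewrite hb bB in kb; have {}kb := kb isT.
have gg := h1 (cabs a) (cabs b); rewrite ha hb aB bB in gg; have {}gg := gg isT isT.
have ga := g_div_mul (cabs a); have gb := g_div_mul (cabs b).
have dt := cabs_dot_le a b; have ds := cabs_dist_sqr a b.
have sa := cabs_sqr a; have sb := cabs_sqr b; have sab := cabs_sqr (a - b).
rewrite ReB ImB in sab.
set al := cabs a in ha aB ka gg ga dt ds sa *; set be := cabs b in hb bB kb gg gb dt ds sb *.
set P := Re a * Re b + Im a * Im b in dt.
have E1 : cabs (a - b) ^+ 2 = al ^+ 2 + be ^+ 2 - 2 * P.
  by rewrite sab sa sb /P; ring.
have E2 : cabs (f a - f b) ^+ 2 =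
    (g al - g be) ^+ 2 + 2 * (k al * k be) * (al * be - P).
  rewrite cabs_sqr ReB ImB !Re_f !Im_f -/al -/be -ga -gb.
  have -> : (k al * Re a - k be * Re b) ^+ 2 + (k al * Im a - k be * Im b) ^+ 2 =
    k al ^+ 2 * (Re a ^+ 2 + Im a ^+ 2) + k be ^+ 2 * (Re b ^+ 2 + Im b ^+ 2)
    - 2 * (k al * k be) * P by rewrite /P; ring.
  by rewrite -sa -sb; ring.
have g2 : (g al - g be) ^+ 2 <= L1 ^+ 2 * (al - be) ^+ 2.
  rewrite -exprMn -[leLHS](real_normK (num_real _)) -[leRHS](real_normK (num_real _)).
  by rewrite lerXn2r ?nnegrE// normrM [`|L1|]ger0_norm.
have kk : k al * k be <= L2 ^+ 2.
  apply: le_trans (ler_norm _) _; rewrite normrM expr2.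
  by apply: ler_pM.
have D0 : 0 <= al * be - P by rewrite subr_ge0.
have DE : 2 * (al * be - P) = cabs (a - b) ^+ 2 - (al - be) ^+ 2 by rewrite E1; ring.
have s0 : 0 <= (al - be) ^+ 2 by exact: sqr_ge0.
rewrite E2; apply: (@le_trans _ _ (L1 ^+ 2 * (al - be) ^+ 2 + L2 ^+ 2 * (2 * (al * be - P)))).
  rewrite lerD// [2 * (k al * k be)]mulrC -mulrA; apply: ler_wpM2r => //.
  by rewrite mulr_ge0.
rewrite DE; set Q := cabs (a - b) ^+ 2 in ds *.
have Q0 : 0 <= Q by exact: sqr_ge0.
have c1 : L1 ^+ 2 * (al - be) ^+ 2 <= L1 ^+ 2 * Q by rewrite ler_wpM2l ?sqr_ge0.
have c2 : L2 ^+ 2 * (Q - (al - be) ^+ 2) <= L2 ^+ 2 * Q.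
  by rewrite ler_wpM2l ?sqr_ge0// gerBl.
have c3 : 0 <= L1 * L2 * Q by apply: mulr_ge0 => //; exact: mulr_ge0.
have -> : (L1 + L2) ^+ 2 * Q = L1 ^+ 2 * Q + L2 ^+ 2 * Q + 2 * (L1 * L2 * Q) by ring.
apply: le_trans (lerD c1 c2) _; rewrite lerDl; exact: mulr_ge0.
Qed.

Definition cdot (z z' : R[i]) : R := Re z * Re z' + Im z * Im z'.

(** [f] is the gradient of G(|z|), and this is its first order expansion with quadratic remainder.
    The radial part follows from the mean value theorem and the Lipschitz bound on [g], the angular
    part from 2 (|a| |b| - a.b) <= |a - b|^2. *)
Lemma potential_taylor (B : R) : 0 <= B -> exists2 L : R, 0 <= L & forall a b : R[i],
  cabs a <= B -> cabs b <= B ->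
  `|G (cabs b) - G (cabs a) - (cdot (f a) b - cdot (f a) a)| <=
    L * cabs (a - b) ^+ 2.
Proof.
move=> B0; have [L1 L10 h1] := nl_lip nl B0; have [L2 L20 h2] := k_bound B0.
exists (L1 + L2); first exact: addr_ge0.
move=> a b aB bB.
have ha := cabs_ge0 a; have hb := cabs_ge0 b.
have ka := h2 (cabs a); rewrite ha aB in ka; have {}ka := ka isT.
have ga := g_div_mul (cabs a).
have dt := cabs_dot_le a b; have ds := cabs_dist_sqr a b.
have sa := cabs_sqr a; have sb := cabs_sqr b; have sab := cabs_sqr (a - b).
rewrite ReB ImB in sab.
have -> : cdot (f a) b - cdot (f a) a =
    k (cabs a) * (cdot a b - cabs a ^+ 2).
  by rewrite /cdot !Re_f !Im_f sa; ring.
have mvt : exists c, [/\ 0 <= c <= B, `|c - cabs a| <= `|cabs b - cabs a| &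
    G (cabs b) - G (cabs a) = g c * (cabs b - cabs a)].
  have [ab|ba] := leP (cabs a) (cabs b).
    have [c /andP[c1 c2] E] := MVT_all ab (nl_derive nl); exists c; split => //.
      by apply/andP; split; lra.
    by rewrite !ger0_norm ?subr_ge0// lerD2r.
  have [c /andP[c1 c2] E] := MVT_all (ltW ba) (nl_derive nl); exists c; split => //.
  - by apply/andP; split; lra.
  - by rewrite distrC [`|cabs b - _|]distrC !ger0_norm ?subr_ge0// ?(ltW ba)//; lra.
  - by rewrite -opprB E -mulrN opprB.
have [c [cB cab ->]] := mvt.
have gg := h1 c (cabs a) cB; rewrite ha aB in gg; have {}gg := gg isT.
set al := cabs a in ha aB ka gg ga dt ds sa cab *; set be := cabs b in hb bB dt ds sb cab *.
set P := cdot a b; rewrite -[Re a * Re b + _]/P in dt.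
have E1 : cabs (a - b) ^+ 2 = al ^+ 2 + be ^+ 2 - 2 * P.
  by rewrite sab sa sb /P /cdot; ring.
have -> : g c * (be - al) - k al * (P - al ^+ 2) =
    (g c - g al) * (be - al) + k al * (al * be - P) by rewrite -ga; ring.
apply: le_trans (ler_normD _ _) _; rewrite [leRHS]mulrDl.
have D0 : 0 <= al * be - P by rewrite subr_ge0.
apply: lerD; rewrite normrM.
  apply: (@le_trans _ _ (L1 * (`|be - al| * `|be - al|))).
    by rewrite mulrA ler_wpM2r// (le_trans gg)// ler_wpM2l.
  by rewrite -expr2 real_normK ?num_real// ler_wpM2l// -sqrrN opprB.
rewrite [`|al * be - P|]ger0_norm//; apply: ler_pM => //.
rewrite E1; have := sqr_ge0 (al - be); nra.
Qed.

(** Subtracting the expansions of the potential at [a] and at [b] leaves an exact increment up to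
    second order. This is the pointwise identity behind the conservation of energy. *)
Lemma trapezoid (B : R) : 0 <= B -> exists2 L : R, 0 <= L & forall a b : R[i],
  cabs a <= B -> cabs b <= B ->
  `|cdot (f b) a - cdot (f a) b -
    ((cdot (f b) b - 2 * G (cabs b)) - (cdot (f a) a - 2 * G (cabs a)))| <=
  L * cabs (a - b) ^+ 2.
Proof.
move=> B0; have [L L0 hL] := potential_taylor B0.
exists (2 * L); first exact: mulr_ge0.
move=> a b aB bB; have h1 := hL a b aB bB; have h2 := hL b a bB aB.
have sy : cabs (b - a) ^+ 2 = cabs (a - b) ^+ 2.
  by rewrite !cabs_sqr !ReB !ImB; ring.
rewrite sy in h2; set Q := cabs (a - b) ^+ 2 in h1 h2 *.
have -> : cdot (f b) a - cdot (f a) b -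
    ((cdot (f b) b - 2 * G (cabs b)) - (cdot (f a) a - 2 * G (cabs a))) =
  (G (cabs b) - G (cabs a) - (cdot (f a) b - cdot (f a) a)) -
  (G (cabs a) - G (cabs b) - (cdot (f b) a - cdot (f b) b)) by ring.
apply: le_trans (ler_normB _ _) _.
have -> : 2 * L * Q = L * Q + L * Q by ring.
exact: lerD.
Qed.

Lemma L2_dotE' u w : L2_dot u w = \int[mu]_x cdot (u x) (w x).
Proof. exact: L2_dotE. Qed.

(* The equation tested against [w], after one integration by parts. *)
Definition action u w :=
  L2_dot (weak_derivative u) (weak_derivative w) + L2_dot (fun x => f (u x)) w.

Definition pairing u := L2_dot (fun x => f (u x)) u - 2 * pot G u.

Lemma sup_of_H1 u (D : R) : H1 u -> H1_dot u u <= D ->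
  {ae mu, forall x, cabs (u x) <= Num.sqrt (2 * D)}.
Proof.
move=> Hu uD; apply: aeS (H1_bounded Hu) => x h.
have D0 : 0 <= H1_dot u u by rewrite H1_dotE addr_ge0 ?mass_ge0.
rewrite -[cabs _]ger0_norm ?cabs_ge0//; apply: normr_le_sqr; first exact: sqrtr_ge0.
rewrite sqr_sqrtr; first by apply: le_trans h _; rewrite ler_wpM2l.
by apply: mulr_ge0 => //; exact: le_trans uD.
Qed.

Lemma L2_f_H1 u : H1 u -> L2 (fun x => f (u x)).
Proof.
move=> Hu; apply: (L2_f (sqrtr_ge0 (2 * H1_dot u u)) (H1_L2 Hu)).
exact: sup_of_H1.
Qed.

Lemma mass_f_dist (B : R) : 0 <= B -> exists2 L : R, 0 <= L & forall u w,
  L2 u -> L2 w -> {ae mu, forall x, cabs (u x) <= B} ->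
  {ae mu, forall x, cabs (w x) <= B} ->
  mass (fun x => f (u x) - f (w x)) <= L ^+ 2 * mass (fun x => u x - w x).
Proof.
move=> B0; have [L L0 hL] := f_lipschitz B0; exists L => // u w hu hw uB wB.
have hfu := L2_f B0 hu uB; have hfw := L2_f B0 hw wB.
rewrite /mass -RintegralZl//; last by apply: itg_mass; exact: L2B.
apply: ae_le_Rintegral.
- by apply: itg_mass; exact: L2B.
- by apply: itgZ => //; apply: itg_mass; exact: L2B.
- by apply: aeS (aeI uB wB) => x [h1 h2]; exact: hL.
Qed.

Lemma pairing_dist (B : R) : 0 <= B -> exists2 L : R, 0 <= L & forall u w,
  L2 u -> L2 w -> {ae mu, forall x, cabs (u x) <= B} ->
  {ae mu, forall x, cabs (w x) <= B} ->
  `|L2_dot (fun x => f (w x)) u - L2_dot (fun x => f (u x)) w -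
    (pairing w - pairing u)| <= L * mass (fun x => u x - w x).
Proof.
move=> B0; have [L L0 hL] := trapezoid B0; exists L => // u w hu hw uB wB.
have hfu := L2_f B0 hu uB; have hfw := L2_f B0 hw wB.
have pu := itg_pot nl hu B0 uB; have pw := itg_pot nl hw B0 wB.
have i1 := itg_dot hfw hu; have i2 := itg_dot hfu hw.
have i3 := itg_dot hfw hw; have i4 := itg_dot hfu hu.
have i5 := itgZ 2 measurableT pu; have i6 := itgZ 2 measurableT pw.
rewrite /pairing !L2_dotE' /pot.
have -> : \int[mu]_x cdot (f (w x)) (u x) - \int[mu]_x cdot (f (u x)) (w x) -
   (\int[mu]_x cdot (f (w x)) (w x) - 2 * \int[mu]_x G (cabs (w x)) -
   (\int[mu]_x cdot (f (u x)) (u x) - 2 * \int[mu]_x G (cabs (u x)))) =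
   \int[mu]_x (cdot (f (w x)) (u x) - cdot (f (u x)) (w x) -
    ((cdot (f (w x)) (w x) - 2 * G (cabs (w x))) -
     (cdot (f (u x)) (u x) - 2 * G (cabs (u x))))).
  have j1 := itgB measurableT i1 i2; have j2 := itgB measurableT i3 i6.
  have j3 := itgB measurableT i4 i5; have j4 := itgB measurableT j2 j3.
  by rewrite (RintegralB measurableT j1 j4) (RintegralB measurableT i1 i2)
    (RintegralB measurableT j2 j3) (RintegralB measurableT i3 i6)
    (RintegralB measurableT i4 i5) (RintegralZl _ measurableT pu) (RintegralZl _ measurableT pw).
have j1 := itgB measurableT i1 i2; have j2 := itgB measurableT i3 i6.
have j3 := itgB measurableT i4 i5; have j4 := itgB measurableT j2 j3.
have j5 := itgB measurableT j1 j4.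
apply: le_trans (le_normr_Rintegral measurableT j5) _.
have md := itg_mass (L2B hu hw).
rewrite /mass -RintegralZl//; apply: ae_le_Rintegral.
- exact: itg_norm.
- exact: itgZ.
- by apply: aeS (aeI uB wB) => x [h1 h2]; exact: hL.
Qed.

End StaticEstimates.

Lemma MVT_pos {R : realType} (F dF : R -> R) (a b : R) : 0 < a -> a <= b ->
  (forall x : R, 0 < x -> is_derive x 1 F (dF x)) ->
  exists2 c : R, a <= c <= b & F b - F a = dF c * (b - a).
Proof.
move=> a0 ab H; have := @MVT_segment R F dF a b ab.
have h1 x : x \in `]a, b[ -> is_derive x 1 F (dF x).
  by rewrite in_itv/= => /andP[ax _]; apply: H; exact: lt_trans ax.
have h2 : {within `[a, b], continuous F}.
  apply: derivable_within_continuous => x; rewrite in_itv/= => /andP[ax _].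
  by case: (H x (lt_le_trans a0 ax)).
by move=> /(_ h1 h2)[c]; rewrite in_itv/= => cab E; exists c.
Qed.

(** The hypothesis gives [J] derivative 0 at every positive time. Time 0 is left out because the
    equation holds for t > 0 only; [flat_constant0] adds it by continuity. *)
Lemma flat_constant {R : realType} (J : R -> R) :
  (forall t e : R, 0 < t -> 0 < e -> exists2 r : R, 0 < r & forall a b : R, 0 < a ->
     t - r < a -> a <= b -> b < t + r -> `|J b - J a| <= e * (b - a)) ->
  forall a b, 0 < a -> 0 < b -> J a = J b.
Proof.
move=> H a b; wlog ab : a b / a <= b.
  by move=> W a0 b0; have [ab|/ltW ba] := leP a b; [exact: W|rewrite (W b a)].
move=> a0 b0; have dJ (x : R) : 0 < x -> is_derive x 1 J 0.
  move=> x0; apply/is_deriveP => e e0; have [r r0 hr] := H x e x0 e0.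
  exists (Num.min r x); first by rewrite lt_min r0.
  move=> h; rewrite lt_min => /andP[]; rewrite !ltr_norml => /andP[h1 h2] /andP[h3 h4].
  have [h0|/ltW h0] := leP 0 h.
    have -> : e * `|h| = e * (x + h - x) by rewrite ger0_norm//; ring.
    by rewrite mulr0 subr0; apply: hr; lra.
  have -> : e * `|h| = e * (x - (x + h)) by rewrite ler0_norm//; ring.
  by rewrite mulr0 subr0 distrC; apply: hr; lra.
have [c _ ] := MVT_pos a0 ab dJ; rewrite mul0r => /eqP.
by rewrite subr_eq0 => /eqP.
Qed.

Lemma flat_constant0 {R : realType} (J : R -> R) :
  (forall a b, 0 < a -> 0 < b -> J a = J b) ->
  (forall e : R, 0 < e -> exists2 r : R, 0 < r &
    forall s, 0 < s -> s < r -> `|J s - J 0| <= e) ->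
  forall t, 0 <= t -> J t = J 0.
Proof.
move=> HJ J0 t; rewrite le_eqVlt => /predU1P[<-//|t0].
apply/eqP; rewrite -subr_eq0 -normr_le0; apply/ler_addgt0Pr => e e0; rewrite add0r.
have [r r0 hr] := J0 e e0; rewrite (HJ t (r / 2)) ?divr_gt0//.
by apply: hr; lra.
Qed.

Lemma primitive_exists {R : realType} (p : R -> R) : continuous p ->
  exists P : R -> R, forall x : R, 0 < x -> is_derive x 1 P (p x).
Proof.
move=> cp; pose P (x : R) : R := \int[mu]_(t in `[0, x]) p t; exists P => x x0.
have xu : x < x + 1 by rewrite ltrDl.
have [d1 d2] : derivable P x 1 /\ derive1 P x = p x.
  exact: continuous_FTC1_closed xu (itg_continuous 0 (x + 1) cp) x0 (cp x).
by clearbody P; rewrite -d2 derive1E; exact: derivableP.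
Qed.

(** * The right-hand side of the equation as a functional on H^1 *)

Section ActionEstimates.
Context {R : realType}.
Variables (G g : R -> R) (f : R[i] -> R[i]).
Hypothesis nl : nonlinearity G g.
Hypothesis g_cont : continuous g.
Hypothesis fE : forall z, f z = Complex (g (cabs z) / cabs z) 0 * z.
Implicit Types (u v w : R -> R[i]) (z : R[i]).
Local Notation N u := (H1_dot u u).
Local Notation A := (action f).
Local Notation wd := weak_derivative.

Lemma H1_dot_ge0 u : 0 <= N u.
Proof. by rewrite H1_dotE addr_ge0 ?mass_ge0. Qed.

Lemma mass_le_H1 u : mass u <= N u.
Proof. by rewrite H1_dotE lerDl mass_ge0. Qed.

Lemma mass_wd_le_H1 u : mass (wd u) <= N u.
Proof. by rewrite H1_dotE lerDr mass_ge0. Qed.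

Lemma H1_dotB u w : H1 u -> H1 w -> N (fun x => u x - w x) =
  mass (fun x => u x - w x) + mass (fun x => wd u x - wd w x).
Proof.
move=> Hu Hw; have [Hd ed] := H1B Hu Hw.
rewrite H1_dotE; congr (_ + _); apply: mass_ae ed; first exact: H1_L2'.
by apply: L2B; exact: H1_L2'.
Qed.

Lemma H1_dotZ z u : H1 u -> N (fun x => z * u x) = cabs z ^+ 2 * N u.
Proof.
move=> Hu; have [Hd ed] := H1Z z Hu.
rewrite !H1_dotE mulrDr -!massZ; [|exact: H1_L2'|exact: H1_L2].
congr (_ + _); apply: mass_ae ed; first exact: H1_L2'.
by apply: L2Z; exact: H1_L2'.
Qed.

Lemma H1_dotD_le u w : H1 u -> H1 w ->
  N (fun x => u x + w x) <= 2 * N u + 2 * N w.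
Proof.
move=> Hu Hw; have [Hd ed] := H1D Hu Hw.
have lu := H1_L2 Hu; have lw := H1_L2 Hw; have lu' := H1_L2' Hu; have lw' := H1_L2' Hw.
rewrite !H1_dotE (mass_ae (H1_L2' Hd) (L2D lu' lw') ed).
have h1 := massD_le lu lw; have h2 := massD_le lu' lw'.
apply: le_trans (lerD h1 h2) _; move: (mass u) (mass w) (mass (wd u)) (mass (wd w)).
by move=> a b c d; apply: eq_ler; ring.
Qed.

Lemma H1_dotB_le u w : H1 u -> H1 w ->
  N (fun x => u x - w x) <= 2 * N u + 2 * N w.
Proof.
move=> Hu Hw.
have lu := H1_L2 Hu; have lw := H1_L2 Hw; have lu' := H1_L2' Hu; have lw' := H1_L2' Hw.
rewrite H1_dotB// !H1_dotE.
have h1 := massB_le lu lw; have h2 := massB_le lu' lw'.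
apply: le_trans (lerD h1 h2) _; move: (mass u) (mass w) (mass (wd u)) (mass (wd w)).
by move=> a b c d; apply: eq_ler; ring.
Qed.

Lemma H1_dot_mid u w v : H1 u -> H1 w -> H1 v -> N (fun x => u x - w x) <=
  2 * N (fun x => u x - v x) + 2 * N (fun x => w x - v x).
Proof.
move=> Hu Hw Hv; have [h1 _] := H1B Hu Hv; have [h2 _] := H1B Hw Hv.
have -> : (fun x => u x - w x) = fun x => (u x - v x) - (w x - v x).
  by apply/funext => x; rewrite opprB addrA subrK.
exact: H1_dotB_le h1 h2.
Qed.

Lemma H1_dot_le_shift u v : H1 u -> H1 v -> N u <= 2 * N (fun x => u x - v x) + 2 * N v.
Proof.
move=> Hu Hv; have [h1 _] := H1B Hu Hv.
have {1 2}-> : u = fun x => (u x - v x) + v x by apply/funext => x; rewrite subrK.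
exact: H1_dotD_le h1 Hv.
Qed.

Lemma cabs_i2 : cabs (Complex 0 1 : R[i]) ^+ 2 = 1.
Proof. by rewrite cabs_sqr/=; ring. Qed.

Lemma actionB u w w' : H1 u -> H1 w -> H1 w' ->
  A u (fun x => w x - w' x) = A u w - A u w'.
Proof.
move=> Hu Hw Hw'; have [Hd ed] := H1B Hw Hw'; have fu := L2_f_H1 nl g_cont fE Hu.
rewrite /action (L2_dot_ae (H1_L2' Hu) (H1_L2' Hu) (H1_L2' Hd) _ _ ed); last 2 first.
- by apply: L2B; exact: H1_L2'.
- exact: aeT.
rewrite !L2_dotBr//; try exact: H1_L2'; try exact: H1_L2.
by rewrite opprD addrACA.
Qed.

(** Infinitesimal phase invariance: pointwise, i u' is orthogonal to u', and f(u) is a real multiple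
    of u, hence orthogonal to i u. *)
Lemma action_rot (c : R) u : H1 u -> A u (fun x => Complex 0 c * u x) = 0.
Proof.
move=> Hu; have [Hd ed] := H1Z (Complex 0 c) Hu; have fu := L2_f_H1 nl g_cont fE Hu.
rewrite /action (L2_dot_ae (H1_L2' Hu) (H1_L2' Hu) (H1_L2' Hd) _ _ ed); last 2 first.
- by apply: L2Z; exact: H1_L2'.
- exact: aeT.
rewrite !L2_dotE (_ : (fun x => _) = cst 0).
  rewrite (_ : (fun x => _) = cst 0).
    by rewrite /Rintegral integral0 addr0.
  by apply/funext => x /=; rewrite ReM ImM (Re_f fE) (Im_f fE)/=; ring.
by apply/funext => x /=; rewrite ReM ImM /=; ring.
Qed.

Lemma mass_f_le (B : R) : 0 <= B -> exists2 L : R, 0 <= L & forall u,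
  L2 u -> {ae mu, forall x, cabs (u x) <= B} ->
  mass (fun x => f (u x)) <= L ^+ 2 * mass u.
Proof.
move=> B0; have [L L0 hL] := mass_f_dist nl g_cont fE B0; exists L => // u hu uB.
have l0 : L2 (fun _ : R => 0 : R[i]) by split; exact: L2r0.
have a0 : {ae mu, forall x : R, cabs (0 : R[i]) <= B}.
  apply: aeT => x; rewrite -[cabs _]ger0_norm ?cabs_ge0//.
  by apply: normr_le_sqr => //; rewrite cabs_sqr/= expr0n addr0 sqr_ge0.
have := hL u (fun=> 0) hu l0 uB a0; have f0 : f 0 = 0 by rewrite fE mulr0.
have -> : (fun x => f (u x) - f 0) = f \o u by apply/funext => x; rewrite f0 subr0.
by have -> : (fun x => u x - 0) = u by apply/funext => x; rewrite subr0.
Qed.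

(** The functional -u'' + f(u) is bounded in H^(-1) when [u] stays in an H^1 ball, since [f] is
    Lipschitz on the corresponding sup ball and vanishes at 0. *)
Lemma action_bound (D : R) : 0 <= D -> exists2 C : R, 0 <= C & forall u w (r : R),
  H1 u -> H1 w -> N u <= D -> 0 <= r -> N w <= r ^+ 2 -> `|A u w| <= C * r.
Proof.
move=> D0; have [L L0 hL] := mass_f_le (sqrtr_ge0 (2 * D)).
pose d := Num.sqrt D; have d0 : 0 <= d := sqrtr_ge0 D.
have dD : d ^+ 2 = D by rewrite sqr_sqrtr.
exists (d + L * d); first by rewrite addr_ge0// mulr_ge0.
move=> u w r Hu Hw uD r0 wr; have fu := L2_f_H1 nl g_cont fE Hu.
have uB := sup_of_H1 Hu uD; have mu1 := hL u (H1_L2 Hu) uB.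
rewrite /action; apply: le_trans (ler_normD _ _) _; rewrite [leRHS]mulrDl.
apply: lerD; apply: L2_dot_le => //; try exact: H1_L2'; try exact: H1_L2.
- by rewrite dD; apply: le_trans uD; exact: mass_wd_le_H1.
- by apply: le_trans wr; exact: mass_wd_le_H1.
- exact: mulr_ge0.
- apply: le_trans mu1 _; rewrite exprMn dD ler_wpM2l ?sqr_ge0//.
  by apply: le_trans uD; exact: mass_le_H1.
- by apply: le_trans wr; exact: mass_le_H1.
Qed.

Lemma action_lip (D : R) : 0 <= D -> exists2 C : R, 0 <= C & forall u v w (r : R),
  H1 u -> H1 v -> H1 w -> N u <= D -> N v <= D -> N w <= D -> 0 <= r ->
  N (fun x => u x - v x) <= r ^+ 2 -> `|A u w - A v w| <= C * r.
Proof.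
move=> D0; have [L L0 hL] := mass_f_dist nl g_cont fE (sqrtr_ge0 (2 * D)).
pose d := Num.sqrt D; have d0 : 0 <= d := sqrtr_ge0 D.
have dD : d ^+ 2 = D by rewrite sqr_sqrtr.
exists (d + L * d); first by rewrite addr_ge0// mulr_ge0.
move=> u v w r Hu Hv Hw uD vD wD r0 uv.
have fu := L2_f_H1 nl g_cont fE Hu; have fv := L2_f_H1 nl g_cont fE Hv.
have uB := sup_of_H1 Hu uD; have vB := sup_of_H1 Hv vD.
have mf := hL u v (H1_L2 Hu) (H1_L2 Hv) uB vB.
have lu := H1_L2' Hu; have lv := H1_L2' Hv; have lw := H1_L2' Hw.
rewrite H1_dotB// in uv; have m1 := mass_ge0 (fun x => u x - v x).
have m2 := mass_ge0 (fun x => wd u x - wd v x).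
have -> : A u w - A v w = L2_dot (fun x => wd u x - wd v x) (wd w) +
    L2_dot (fun x => f (u x) - f (v x)) w.
  rewrite (L2_dotBl lu lv lw) (L2_dotBl fu fv (H1_L2 Hw)) /action.
  by rewrite opprD addrACA.
apply: le_trans (ler_normD _ _) _; rewrite [leRHS]mulrDl.
apply: lerD.
  rewrite [d * r]mulrC; apply: L2_dot_le => //; first exact: L2B.
    by apply: le_trans uv; rewrite lerDr.
  by rewrite dD; apply: le_trans wD; exact: mass_wd_le_H1.
rewrite -mulrA [d * r]mulrC mulrA; apply: L2_dot_le => //.
- exact: L2B.
- exact: H1_L2.
- exact: mulr_ge0.
- apply: le_trans mf _; rewrite exprMn ler_wpM2l ?sqr_ge0//.
  by apply: le_trans uv; rewrite lerDl.
- by rewrite dD; apply: le_trans wD; exact: mass_le_H1.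
Qed.

End ActionEstimates.

Lemma le_quarters {R : realType} (x y e : R) :
  x <= e / 4 -> y <= e / 4 -> 2 * x + 2 * y <= e.
Proof. lra. Qed.

Lemma mass_continuous {R : realType} (u : R -> R[i]) (e : R) : L2 u -> 0 < e ->
  exists2 d : R, 0 < d & forall w, L2 w -> mass (fun x => w x - u x) <= d ->
    `|mass w - mass u| <= e.
Proof.
move=> hu e0; pose M := Num.sqrt (mass u).
have M0 : 0 <= M := sqrtr_ge0 _; have MM : M ^+ 2 = mass u by rewrite sqr_sqrtr ?mass_ge0.
have M1 : 0 < 1 + 2 * M by lra.
pose q := Num.min 1 (e / (1 + 2 * M)).
have q0 : 0 < q by rewrite lt_min ltr01 divr_gt0.
have q1 : q <= 1 by rewrite ge_min lexx.
have qe : q * (1 + 2 * M) <= e by rewrite -ler_pdivlMr// ge_min lexx orbT.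
exists (q ^+ 2); first by rewrite exprn_gt0.
move=> w hw wd; have hd := L2B hw hu.
have -> : mass w - mass u = mass (fun x => w x - u x) + 2 * L2_dot (fun x => w x - u x) u.
  by rewrite massB_dot// L2_dotBl// -massE; move: (mass w) (mass u) (L2_dot w u) => *; ring.
have uM : mass u <= M ^+ 2 by rewrite MM.
have := L2_dot_le hd hu (ltW q0) M0 wd uM; have := mass_ge0 (fun x => w x - u x).
move: wd; move: (mass _) (L2_dot _ _) => c d h1 h2.
rewrite ler_norml => /andP[h3 h4]; have : q ^+ 2 <= q by rewrite expr2 ler_piMr// ltW.
by move=> h5; rewrite ler_norml; apply/andP; split; lra.
Qed.

Lemma action_arith {R : realType} (uu uw wu ww pu pw x y z : R) :
  `|uw - uu| <= x -> `|ww - uw| <= y -> `|wu - uu| <= y ->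
  `|wu - uw - (pw - pu)| <= z ->
  `|pw - pu| <= x + y + z + (x + y) /\ `|ww - pw - (uu - pu)| <= x + y + z + (x + y).
Proof.
move=> h1 h2 h3 h4; have x0 := le_trans (normr_ge0 _) h1.
have y0 := le_trans (normr_ge0 _) h2; move: h1 h2 h3 h4; rewrite !ler_norml.
move=> /andP[a1 a2] /andP[b1 b2] /andP[d1 d2] /andP[e1 e2].
by split; apply/andP; split; lra.
Qed.

Lemma correlation_arith {R : realType} (ab0 ba0 b0a0 ab A1 A2 k x : R) :
  `|ab0 - - b0a0 - k * A1| <= x -> `|ba0 - b0a0 - k * A2| <= x ->
  `|ab - ab0 - (- ba0 - - b0a0)| <= x ->
  `|ab - - b0a0 - k * (A1 - A2)| <= x + x + x.
Proof.
rewrite mulrBr; move: (k * A1) (k * A2) => a1 a2; rewrite !ler_norml.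
move=> /andP[? ?] /andP[? ?] /andP[? ?]; apply/andP; split; lra.
Qed.

(** * Conservation laws along a solution *)

Section Conservation.
Context {R : realType}.
Variables (G g : R -> R) (f : R[i] -> R[i]) (u0 : R -> R[i]) (phi : R -> R -> R[i]).
Hypothesis nl : nonlinearity G g.
Hypothesis g_cont : continuous g.
Hypothesis fE : forall z, f z = Complex (g (cabs z) / cabs z) 0 * z.
Hypothesis sol : is_solution f u0 phi.
Implicit Types (u v w : R -> R[i]) (z : R[i]) (t s a b e : R).
Local Notation N u := (H1_dot u u).
Local Notation A := (action f).
Local Notation wd := weak_derivative.
Local Notation i_ := (Complex 0 1).

Let phiH t : 0 <= t -> H1 (phi t). Proof. by case: sol => H _ _ _; exact: H. Qed.

Lemma flow_continuous t e : 0 <= t -> 0 < e -> exists2 r : R, 0 < r &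
  forall s, 0 <= s -> `|s - t| < r -> N (fun x => phi s x - phi t x) <= e.
Proof.
case: sol => _ H _ _ t0 e0; have := H t t0 => /cvgrPdist_le.
move=> /(_ (Num.sqrt e)); rewrite sqrtr_gt0 => /(_ e0).
rewrite near_withinE => /nbhs_ballP[r /= r0 hr]; exists r => // s s0 st.
have := hr s; rewrite /ball/= distrC => /(_ st s0).
by rewrite sub0r normrN /H1_dist ger0_norm ?sqrtr_ge0// ler_sqrt ?(ltW e0).
Qed.

(** The time [c] depends on [w], as the mean value theorem applies to the scalar function obtained
    by testing with one fixed [w]. *)
Lemma flow_MVT a b w : 0 < a -> a <= b -> H1 w -> exists2 c : R, a <= c <= b &
  L2_dot (fun x => i_ * phi b x) w - L2_dot (fun x => i_ * phi a x) w =
  A (phi c) w * (b - a).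
Proof.
move=> a0 ab Hw; case: sol => _ _ _ H.
apply: (@MVT_pos R (fun s => L2_dot (fun x => i_ * phi s x) w) (fun c => A (phi c) w)) => //.
by move=> x x0; exact: H.
Qed.

Lemma flow_incr a b w : 0 < a -> a <= b -> H1 w -> exists2 c : R, a <= c <= b &
  L2_dot (fun x => phi b x - phi a x) w = A (phi c) (fun x => i_ * w x) * (b - a).
Proof.
move=> a0 ab Hw; have [Hiw _] := H1Z i_ Hw.
have [c cab E] := flow_MVT a0 ab Hiw; exists c => //; rewrite -E !L2_dot_mul_i.
have b0 := lt_le_trans a0 ab.
have lb := H1_L2 (phiH (ltW b0)); have la := H1_L2 (phiH (ltW a0)).
by rewrite L2_dotBl//; exact: H1_L2.
Qed.

Lemma flow_near t e : 0 < t -> 0 < e -> exists2 r : R, 0 < r & forall a b,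
  0 < a -> 0 < b -> `|a - t| < r -> `|b - t| < r ->
  N (fun x => phi a x - phi b x) <= e.
Proof.
move=> t0 e0; have e4 : 0 < e / 4 by rewrite divr_gt0.
have [r r0 hr] := flow_continuous (ltW t0) e4; exists r => // a b a0 b0 ar br.
have h1 := hr a (ltW a0) ar; have h2 := hr b (ltW b0) br.
apply: le_trans (H1_dot_mid (phiH (ltW a0)) (phiH (ltW b0)) (phiH (ltW t0))) _.
exact: le_quarters h1 h2.
Qed.

Lemma flow_locally_bounded t : 0 < t -> exists2 D : R, 0 <= D &
  exists2 r : R, 0 < r & forall a, 0 < a -> `|a - t| < r -> N (phi a) <= D.
Proof.
move=> t0; have [r r0 hr] := flow_near t0 ltr01.
exists (2 * 1 + 2 * N (phi t)); first by rewrite addr_ge0// mulr_ge0// H1_dot_ge0.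
exists r => // a a0 ar.
apply: le_trans (H1_dot_le_shift (phiH (ltW a0)) (phiH (ltW t0))) _.
rewrite lerD2r ler_wpM2l//; apply: hr => //; by rewrite subrr normr0.
Qed.

(** Test the increment against itself by [flow_incr]: the functional at the intermediate time is
    bounded in H^(-1), and the test function is small in H^1 by continuity of the flow. The constant
    [e] can therefore be taken arbitrarily small. *)
Lemma flow_holder t e : 0 < t -> 0 < e -> exists2 r : R, 0 < r & forall a b,
  0 < a -> t - r < a -> a <= b -> b < t + r ->
  mass (fun x => phi b x - phi a x) <= e * (b - a).
Proof.
move=> t0 e0; have [D D0 [r1 r10 hD]] := flow_locally_bounded t0.
have [C C0 hC] := action_bound nl g_cont fE D0.
pose q := e / (C + 1); have C1 : 0 < C + 1 by rewrite ltr_wpDl.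
have q0 : 0 < q by rewrite divr_gt0.
have q2 : 0 < q ^+ 2 by rewrite exprn_gt0.
have [r2 r20 hN] := flow_near t0 q2.
exists (Num.min r1 r2); first by rewrite lt_min r10.
move=> a b a0 ta ab bt.
have near x : a <= x -> x <= b -> 0 < x /\ (`|x - t| < r1 /\ `|x - t| < r2).
  move=> ax xb; split; first exact: lt_le_trans ax.
  by apply/andP; rewrite -lt_min ltr_norml; apply/andP; split; lra.
have [_ [_ ar]] := near a (lexx a) ab; have [b0 [_ br]] := near b ab (lexx b).
have [Hd _] := H1B (phiH (ltW b0)) (phiH (ltW a0)).
have [c /andP[ac cb] E] := flow_incr a0 ab Hd.
have [c0 [cr _]] := near c ac cb; have [Hid _] := H1Z i_ Hd.
rewrite massE E; apply: ler_wpM2r; first by rewrite subr_ge0.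
apply: le_trans (ler_norm _) _.
apply: (@le_trans _ _ (C * q)).
  apply: hC => //; first exact: phiH (ltW c0).
  - exact: hD.
  - exact: ltW.
  - by rewrite H1_dotZ// cabs_i2 mul1r; exact: hN.
rewrite /q mulrCA ler_piMr ?(ltW e0)// ler_pdivrMr// mul1r lerDl//.
Qed.

(** The increment of the mass is the increment of phi tested against phi(b) + phi(a), that is, b - a
    times the functional at some phi(c) applied to i (phi(b) + phi(a)). By [action_rot] one may
    subtract 2 i phi(c), and what remains is small in H^1. *)
Lemma flow_mass t : 0 <= t -> mass (phi t) = mass (phi 0).
Proof.
apply: (@flat_constant0 R (fun s => mass (phi s))).
  apply: flat_constant => {}t e t0 e0.
  have [D D0 [r1 r10 hD]] := flow_locally_bounded t0.
  have [C C0 hC] := action_bound nl g_cont fE D0.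
  pose q := e / (C + 1); have C1 : 0 < C + 1 by rewrite ltr_wpDl.
  have q0 : 0 < q by rewrite divr_gt0.
  have q4 : 0 < q ^+ 2 / 4 by rewrite divr_gt0// exprn_gt0.
  have [r2 r20 hN] := flow_near t0 q4.
  exists (Num.min r1 r2); first by rewrite lt_min r10.
  move=> a b a0 ta ab bt.
  have near x : a <= x -> x <= b -> 0 < x /\ (`|x - t| < r1 /\ `|x - t| < r2).
    move=> ax xb; split; first exact: lt_le_trans ax.
    by apply/andP; rewrite -lt_min ltr_norml; apply/andP; split; lra.
  have [_ [_ ar]] := near a (lexx a) ab; have [b0 [_ br]] := near b ab (lexx b).
  have Ha := phiH (ltW a0); have Hb := phiH (ltW b0).
  have la := H1_L2 Ha; have lb := H1_L2 Hb.
  have [Hd _] := H1D Hb Ha; have [Hid _] := H1Z i_ Hd.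
  have -> : mass (phi b) - mass (phi a) =
      L2_dot (fun x => phi b x - phi a x) (fun x => phi b x + phi a x).
    rewrite L2_dotBl//; last exact: L2D.
    rewrite !L2_dotDr// !massE (L2_dotC (phi a) (phi b)) opprD addrA.
    by rewrite addrK.
  have [c /andP[ac cb] ->] := flow_incr a0 ab Hd.
  have [c0 [cr cr2]] := near c ac cb; have Hc := phiH (ltW c0).
  rewrite normrM [`|b - a|]ger0_norm ?subr_ge0//; apply: ler_wpM2r.
    by rewrite subr_ge0.
  have [H2 _] := H1Z (Complex 0 2) Hc.
  have E := actionB nl g_cont fE Hc Hid H2; rewrite (action_rot nl g_cont fE 2 Hc) subr0 in E.
  rewrite -E.
  have [h1 _] := H1B Hb Hc; have [h2 _] := H1B Ha Hc; have [h3 _] := H1D h1 h2.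
  have -> : (fun x => i_ * (phi b x + phi a x) - Complex 0 2 * phi c x) =
      fun x => i_ * ((phi b x - phi c x) + (phi a x - phi c x)).
    apply/funext => x; apply: complex_ext; rewrite !(ReB, ImB, ReD, ImD, ReM, ImM)/=; ring.
  apply: (@le_trans _ _ (C * q)).
    apply: hC => //; first by have [] := H1Z i_ h3.
    - exact: hD.
    - exact: ltW.
    - rewrite H1_dotZ// cabs_i2 mul1r; apply: le_trans (H1_dotD_le h1 h2) _.
      have n1 : N (fun x => phi b x - phi c x) <= q ^+ 2 / 4 by exact: hN.
      have n2 : N (fun x => phi a x - phi c x) <= q ^+ 2 / 4 by exact: hN.
      exact: le_quarters n1 n2.
  rewrite /q mulrCA ler_piMr ?(ltW e0)// ler_pdivrMr// mul1r lerDl//.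
move=> e e0; have [d d0 hd] := mass_continuous (H1_L2 (phiH (lexx 0))) e0.
have [r r0 hr] := flow_continuous (lexx 0) d0; exists r => // s s0 sr.
apply: hd; first exact: H1_L2 (phiH (ltW s0)).
apply: le_trans (mass_le_H1 _) _; apply: hr; first exact: ltW.
by rewrite subr0 ger0_norm// ltW.
Qed.

(** The kinetic parts of the two actions cancel by symmetry, which leaves the integrated form of
    [trapezoid]. *)
Lemma action_swap_pairing (D : R) : 0 <= D -> exists2 L : R, 0 <= L & forall u w,
  H1 u -> H1 w -> N u <= D -> N w <= D ->
  `|A w u - A u w - (pairing G f w - pairing G f u)| <=
    L * mass (fun x => w x - u x).
Proof.
move=> D0; have [L L0 hL] := pairing_dist nl g_cont fE (sqrtr_ge0 (2 * D)).
exists L => // u w Hu Hw uD wD.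
have := hL u w (H1_L2 Hu) (H1_L2 Hw) (sup_of_H1 Hu uD) (sup_of_H1 Hw wD).
rewrite massBC; suff -> : A w u - A u w =
  L2_dot (fun x => f (w x)) u - L2_dot (fun x => f (u x)) w by [].
by rewrite /action [L2_dot (wd w) _]L2_dotC opprD addrACA subrr add0r.
Qed.

(* Twice the energy. *)
Definition hamiltonian u := A u u - pairing G f u.

Lemma hamiltonianE u : hamiltonian u = mass (wd u) + 2 * pot G u.
Proof.
rewrite /hamiltonian /action /pairing massE; move: (L2_dot _ _) (L2_dot _ _) (pot _ _).
by move=> a b c; ring.
Qed.

(** The bound on [pairing] is read off [action_swap_pairing]: the two swapped actions are each close
    to [action f u u]. *)
Lemma pairing_action_lip (D : R) : 0 <= D -> exists2 C : R, 0 <= C & forall u w (r : R),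
  H1 u -> H1 w -> N u <= D -> N w <= D -> 0 <= r <= 1 ->
  N (fun x => w x - u x) <= r ^+ 2 ->
  `|pairing G f w - pairing G f u| <= C * r /\
  `|hamiltonian w - hamiltonian u| <= C * r.
Proof.
move=> D0; have [C1 C10 h1] := action_bound nl g_cont fE D0.
have [C2 C20 h2] := action_lip nl g_cont fE D0.
have [L L0 h3] := action_swap_pairing D0.
exists (C1 + C2 + L + (C1 + C2)); first by rewrite !addr_ge0.
move=> u w r Hu Hw uD wD /andP[r0 r1] uw; have [Hd _] := H1B Hw Hu.
have k1 := h1 u _ r Hu Hd uD r0 uw; rewrite (actionB nl g_cont fE)// in k1.
have k2 := h2 w u w r Hw Hu Hw wD uD wD r0 uw.
have k2' := h2 w u u r Hw Hu Hu wD uD uD r0 uw.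
have k3 := h3 u w Hu Hw uD wD; have m1 := mass_le_H1 (fun x => w x - u x).
have k4 : L * mass (fun x => w x - u x) <= L * r.
  rewrite ler_wpM2l//; apply: le_trans m1 _; apply: le_trans uw _.
  by rewrite expr2 ler_piMr.
rewrite /hamiltonian !mulrDl; apply: action_arith k1 k2 k2' _.
exact: le_trans k3 k4.
Qed.

Lemma flow_pairing_continuous t e : 0 <= t -> 0 < e -> exists2 r : R, 0 < r &
  forall s, 0 <= s -> `|s - t| < r ->
  `|pairing G f (phi s) - pairing G f (phi t)| <= e /\
  `|hamiltonian (phi s) - hamiltonian (phi t)| <= e.
Proof.
move=> t0 e0; pose D := 2 + 2 * N (phi t).
have D0 : 0 <= D by rewrite addr_ge0// mulr_ge0// H1_dot_ge0.
have [C C0 hC] := pairing_action_lip D0.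
have C1 : 0 < C + 1 by rewrite ltr_wpDl.
pose q := Num.min 1 (e / (C + 1)).
have q0 : 0 < q by rewrite lt_min ltr01 divr_gt0.
have q1 : q <= 1 by rewrite ge_min lexx.
have qe : C * q <= e.
  apply: (@le_trans _ _ (q * (C + 1))); last by rewrite -ler_pdivlMr// ge_min lexx orbT.
  by rewrite mulrC ler_wpM2l ?(ltW q0)// lerDl.
have q2 : 0 < q ^+ 2 by rewrite exprn_gt0.
have [r r0 hr] := flow_continuous t0 q2; exists r => // s s0 st.
have n1 := hr s s0 st; have Hs := phiH s0; have Ht := phiH t0.
have sD : N (phi s) <= D.
  apply: le_trans (H1_dot_le_shift Hs Ht) _; rewrite lerD2r -[leRHS]mulr1 ler_wpM2l//.
  by apply: le_trans n1 _; rewrite expr_le1// ltW.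
have tD : N (phi t) <= D.
  by apply: (@le_trans _ _ (2 * N (phi t))); [rewrite ler_peMl ?H1_dot_ge0// ler1n|rewrite lerDr].
have q01 : 0 <= q <= 1 by rewrite (ltW q0).
by have [k1 k2] := hC _ _ q Ht Hs tD sD q01 n1; split; exact: le_trans qe.
Qed.

Lemma flow_holder_at t e : 0 < t -> 0 < e -> exists2 r : R, 0 < r & forall k : R,
  `|k| < r -> mass (fun x => phi (t + k) x - phi t x) <= e * `|k|.
Proof.
move=> t0 e0; have [r r0 hr] := flow_holder t0 e0.
exists (Num.min r t); first by rewrite lt_min r0.
move=> k; rewrite lt_min !ltr_norml => /andP[/andP[k1 k2] /andP[k3 k4]].
have [k0|/ltW k0] := leP 0 k.
  have -> : e * `|k| = e * (t + k - t) by rewrite ger0_norm//; ring.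
  by apply: hr; lra.
have -> : e * `|k| = e * (t - (t + k)) by rewrite ler0_norm//; ring.
by rewrite massBC; apply: hr; lra.
Qed.

Lemma flow_correlation_derive t (h : R) : 0 < t -> 0 <= h ->
  is_derive t 1 (fun s => L2_dot (fun x => i_ * phi (s + h) x) (phi s))
    (A (phi (t + h)) (phi t) - A (phi t) (phi (t + h))).
Proof.
move=> t0 h0; have th0 : 0 < t + h by rewrite ltr_wpDr.
case: (sol) => _ _ _ dphi; have Ht := phiH (ltW t0); have Hth := phiH (ltW th0).
apply/is_deriveP => e e0; have e3 : 0 < e / 3 by rewrite divr_gt0.
have /is_deriveP/(_ _ e3)[r1 r10 k1] := dphi _ _ th0 Ht.
have /is_deriveP/(_ _ e3)[r2 r20 k2] := dphi _ _ t0 Hth.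
have [r3 r30 k3] := flow_holder_at th0 e3; have [r4 r40 k4] := flow_holder_at t0 e3.
exists (Num.min (Num.min r1 r2) (Num.min (Num.min r3 r4) t)).
  by rewrite !lt_min r10 r20 r30 r40.
move=> k; rewrite !lt_min => /andP[/andP[/k1{}k1 /k2{}k2] /andP[/andP[/k3{}k3 /k4{}k4] kt]].
have tk : 0 <= t + k by move: kt; rewrite ltr_norml => /andP[? _]; lra.
have thk : 0 <= t + h + k by lra.
have eqa : t + k + h = t + h + k by ring.
rewrite eqa; have Ha := phiH thk; have Hb := phiH tk.
have la := H1_L2 Ha; have lb := H1_L2 Hb; have la0 := H1_L2 Hth; have lb0 := H1_L2 Ht.
set a := phi (t + h + k) in k1 k3 la *; set a0 := phi (t + h) in k1 k2 k3 la0 *.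
set b := phi (t + k) in k2 k4 lb *; set b0 := phi t in k1 k2 k4 lb0 *.
have cross : `|L2_dot (fun x => i_ * (a x - a0 x)) (fun x => b x - b0 x)| <= e / 3 * `|k|.
  have ek : 0 <= e / 3 * `|k| by rewrite mulr_ge0// ltW.
  rewrite -[leRHS](sqr_sqrtr ek) expr2; apply: L2_dot_le; rewrite ?sqrtr_ge0 ?sqr_sqrtr//.
  - by apply: L2Z; exact: L2B.
  - exact: L2B.
  - by rewrite massZ ?cabs_i2 ?mul1r//; exact: L2B.
have E : L2_dot (fun x => i_ * (a x - a0 x)) (fun x => b x - b0 x) =
    L2_dot (fun x => i_ * a x) b - L2_dot (fun x => i_ * a x) b0
    - (L2_dot (fun x => i_ * a0 x) b - L2_dot (fun x => i_ * a0 x) b0).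
  have za := L2Z i_ la; have za0 := L2Z i_ la0.
  have -> : (fun x => i_ * (a x - a0 x)) = fun x => i_ * a x - i_ * a0 x.
    by apply/funext => x; rewrite mulrBr.
  by rewrite L2_dotBl ?L2_dotBr//; exact: L2B.
rewrite E in cross; have sa := L2_dot_i_antisym la0 lb; have sb := L2_dot_i_antisym la0 lb0.
rewrite sa sb in cross k1 *.
have -> : e * `|k| = e / 3 * `|k| + e / 3 * `|k| + e / 3 * `|k| by field.
exact: correlation_arith k1 k2 cross.
Qed.

Lemma is_derive_shift (F : R -> R) (x h l : R) : is_derive (x + h) 1 F l ->
  is_derive x 1 (fun s => F (s + h)) l.
Proof.
move=> /is_deriveP H; apply/is_deriveP => e e0; have [d d0 hd] := H e e0.
by exists d => // k kd; rewrite (addrAC x); exact: hd.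
Qed.

Lemma flow_hamiltonian t : 0 <= t -> hamiltonian (phi t) = hamiltonian (phi 0).
Proof.
(* Even extension to negative times, where [phi] is unconstrained, gives a function continuous on
   the whole line. *)
pose p s := pairing G f (phi `|s|).
have cp : continuous p.
  move=> s; apply/cvgrPdist_le => e e0.
  have [r r0 hr] := flow_pairing_continuous (normr_ge0 s) e0.
  apply: filterS (near_dist s r0) => y ys; rewrite distrC.
  rewrite distrC in ys.
  by have [] := hr `|y| (normr_ge0 y) (le_lt_trans (ler_dist_dist _ _) ys).
have [P dP] := primitive_exists cp.
have pE s : 0 < s -> p s = pairing G f (phi s) by move=> s0; rewrite /p gtr0_norm.
pose W h s := L2_dot (fun x => i_ * phi (s + h) x) (phi s).
(* [P] is a primitive of [p], so subtracting its increment removes the main part of the derivative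
   of [W h]. The increments of [Z h] in [s] are thus o(h), while [Z h s / h] tends to the
   hamiltonian. *)
pose Z h s := W h s - (P (s + h) - P s).
have dZ h s : 0 < h -> 0 < s -> is_derive s 1 (Z h)
    (A (phi (s + h)) (phi s) - A (phi s) (phi (s + h)) - (p (s + h) - p s)).
  move=> h0 s0; have d1 := flow_correlation_derive s0 (ltW h0).
  have d2 := is_derive_shift (dP _ (addr_gt0 s0 h0)).
  have d3 := dP _ s0.
  exact: (is_deriveB (f := W h) (g := fun s => P (s + h) - P s)).
have limZ s e : 0 < s -> 0 < e -> exists2 d : R, 0 < d & forall h, 0 < h -> h < d ->
    `|Z h s - h * hamiltonian (phi s)| <= e * h.
  move=> s0 e0; have e2 : 0 < e / 2 by rewrite divr_gt0.
  case: (sol) => _ _ _ dphi; have Hs := phiH (ltW s0).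
  have /is_deriveP/(_ _ e2)[d1 d10 h1] := dphi _ _ s0 Hs.
  have /is_deriveP/(_ _ e2)[d2 d20 h2] := dP _ s0.
  exists (Num.min d1 d2); first by rewrite lt_min d10.
  move=> h h0; rewrite lt_min => /andP[hd1 hd2].
  have {}h1 : `|W h s - h * A (phi s) (phi s)| <= e / 2 * h.
    by have := h1 h; rewrite gtr0_norm// L2_dot_i_self subr0; exact.
  have := h2 h; rewrite gtr0_norm// => /(_ hd2); rewrite pE// => {}h2.
  rewrite /Z /hamiltonian; apply: (@le_trans _ _ (e / 2 * h + e / 2 * h)).
    apply: le_trans (lerD h1 h2); apply: le_trans (ler_normB _ _).
    apply: eq_ler; congr (`|_|); rewrite mulrBr.
    by move: (W _ _) (A _ _) (pairing _ _ _) => *; ring.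
  by apply: eq_ler; field.
(* The derivative of [Z h] at [c] is at most [L] times |phi(c + h) - phi(c)|^2, hence at most e h by
   [flow_holder]. Halving the radius keeps c + h inside the neighbourhood. *)
have locZ t0 e : 0 < t0 -> 0 < e -> exists2 r : R, 0 < r & forall a b h, 0 < a ->
    t0 - r < a -> a <= b -> b < t0 + r -> 0 < h -> h < r ->
    `|Z h b - Z h a| <= e * h * (b - a).
  move=> t00 e0.
  have [D D0 [r1 r10 hD]] := flow_locally_bounded t00.
  have [L L0 hL] := action_swap_pairing D0.
  have L1 : 0 < L + 1 by rewrite ltr_wpDl.
  have q0 : 0 < e / (L + 1) by rewrite divr_gt0.
  have [r2 r20 hr] := flow_holder t00 q0.
  exists (Num.min r1 r2 / 2); first by rewrite divr_gt0// lt_min r10.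
  move=> a b h a0; set r := Num.min r1 r2 => ta ab bt h0 hr0.
  have rr1 : r <= r1 by rewrite ge_min lexx.
  have rr2 : r <= r2 by rewrite ge_min lexx orbT.
  have [c /andP[ac cb] ->] := MVT_pos a0 ab (fun x x0 => dZ h x h0 x0).
  rewrite normrM [`|b - a|]ger0_norm ?subr_ge0//; apply: ler_wpM2r.
    by rewrite subr_ge0.
  have c0 := lt_le_trans a0 ac; have ch0 : 0 < c + h by exact: addr_gt0.
  have hE : c + h - c = h by ring.
  have hm : mass (fun x => phi (c + h) x - phi c x) <= e / (L + 1) * h.
    have h1 : t0 - r2 < c by lra.
    have h2 : c <= c + h by lra.
    have h3 : c + h < t0 + r2 by lra.
    by rewrite -[h in leRHS]hE; exact: (hr c (c + h) c0 h1 h2 h3).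
  have nc : N (phi c) <= D by apply: hD => //; rewrite ltr_norml; apply/andP; split; lra.
  have nch : N (phi (c + h)) <= D.
    by apply: hD => //; rewrite ltr_norml; apply/andP; split; lra.
  rewrite !pE//; apply: le_trans (hL _ _ (phiH (ltW c0)) (phiH (ltW ch0)) nc nch) _.
  have hm2 := ler_wpM2l L0 hm.
  apply: le_trans hm2 _.
  have Le : L * (e / (L + 1)) <= e.
    by rewrite mulrCA ler_piMr ?(ltW e0)// ler_pdivrMr// mul1r lerDl.
  by rewrite mulrA; apply: ler_wpM2r Le; exact: ltW.
apply: (@flat_constant0 R (fun s => hamiltonian (phi s))).
  apply: flat_constant => s e s0 e0; have [r r0 hr] := locZ s e s0 e0.
  exists r => // a b a0 ta ab bt; have b0 := lt_le_trans a0 ab.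
  apply/ler_addgt0Pr => d d0; have d2 : 0 < d / 2 by rewrite divr_gt0.
  have [h1 h10 k1] := limZ a _ a0 d2; have [h2 h20 k2] := limZ b _ b0 d2.
  (* Any admissible [h] serves: dividing the bound on the increment of [Z h] by [h] bounds the
     increment of the hamiltonian up to the arbitrary error [d]. *)
  pose h := Num.min r (Num.min h1 h2) / 2.
  have m0 : 0 < Num.min r (Num.min h1 h2) by rewrite !lt_min r0 h10.
  have h0 : 0 < h by rewrite divr_gt0.
  have : h < Num.min r (Num.min h1 h2) by rewrite /h ltr_pdivrMr// ltr_pMr// ltr1n.
  rewrite !lt_min => /and3P[hr0 hh1 hh2].
  have {}k1 := k1 h h0 hh1; have {}k2 := k2 h h0 hh2.
  have k3 := hr a b h a0 ta ab bt h0 hr0.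
  rewrite -(ler_pM2l h0) -[h in leLHS]gtr0_norm// -normrM.
  have -> : h * (e * (b - a) + d) = e * h * (b - a) + (d / 2 * h + d / 2 * h) by field.
  apply: le_trans (lerD k3 (lerD k2 k1)).
  rewrite [`|Z h a - _|]distrC; apply: le_trans (lerD (lexx _) (ler_normD _ _)).
  apply: le_trans (ler_normB _ _); apply: eq_ler; congr (`|_|).
  by rewrite mulrBr; move: (hamiltonian _) (hamiltonian _) (Z _ _) (Z _ _) => *; ring.
move=> e e0; have [r r0 hr] := flow_pairing_continuous (lexx 0) e0.
exists r => // s s0 sr; have [] := hr s (ltW s0) _ => //.
by rewrite subr0 ger0_norm// ltW.
Qed.

Lemma flow_energy t : 0 <= t -> energy G (phi t) = energy G (phi 0).
Proof.
move=> t0; have E u : energy G u = 2^-1 * hamiltonian u.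
  rewrite hamiltonianE mulrDr mulKf ?pnatr_eq0//.
by rewrite !E flow_hamiltonian.
Qed.

End Conservation.

(** * Ground states *)

Section NegativeEnergy.
Context {R : realType}.
Variables G g : R -> R.
Hypothesis nl : nonlinearity G g.
Implicit Types (u v w : R -> R[i]).

Lemma cabs_real (a b : R) : 0 <= a -> 0 <= b ->
  cabs (Complex a 0 * Complex b 0) = a * b.
Proof.
move=> a0 b0; apply/eqP; rewrite -(@eqrXn2 _ 2)// ?cabs_ge0 ?mulr_ge0//.
by rewrite cabs_sqr ReM ImM/=; apply/eqP; ring.
Qed.

Lemma negative_potential : exists u v, sobolev u v /\ pot G u < 0.
Proof.
have [s s0 Gs] := nl_neg nl; have [K K0 hK] := G_quad nl s0.
pose C := K * s ^+ 2; have C0 : 0 <= C by rewrite mulr_ge0 ?sqr_ge0.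
(* With this length the flat part, at least [1, L], contributes at most -2 C + G s, while the two
   layers of length 1 cost at most [C] each; the total is at most G s < 0. *)
pose L := 2 * C / (- G s) + 2.
have Gs0 : 0 < - G s by rewrite oppr_gt0.
have L2 : 2 <= L by rewrite lerDr divr_ge0 ?mulr_ge0// ltW.
have L0 : 0 <= L by lra.
have [v nv] := plateau_sobolev ltr01 L0.
have nu := sobolevZ (Complex s 0) nv.
set u := (fun x => Complex s 0 * _) in nu; exists u; eexists; split; first exact: nu.
have p01 x : 0 <= plateau 1 0 L x <= 1.
  by apply: plateau_ge0_le1 => //; rewrite invr1; lra.
have uE x : cabs (u x) = s * plateau 1 0 L x.
  by apply: cabs_real => //; case/andP: (p01 x).
have uC x : G (cabs (u x)) <= C.
  have /andP[p0 p1] := p01 x; apply: le_trans (ler_norm _) _.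
  apply: (@le_trans _ _ (K * cabs (u x) ^+ 2)).
    by apply: hK; rewrite cabs_ge0 uE ler_piMr.
  rewrite /C ler_wpM2l// lerXn2r ?nnegrE ?cabs_ge0//.
  by rewrite uE ler_piMr.
have iu := itg_pot_sobolev nl nu.
have usup x : x < 0 \/ L + 1 < x -> G (cabs (u x)) = 0.
  move=> hx; rewrite uE plateau_supp ?mulr0 ?(nl_G0 nl)// invr1.
  by case: hx => /ltW; auto.
rewrite /pot (Rintegral_supp_itv usup).
have ir a b : itg `[a, b] (fun x => G (cabs (u x))) by apply: integrableS iu => //; exact: msb_itv.
rewrite (@Rintegral_itv_split _ _ 0 1)//; last by lra.
rewrite (@Rintegral_itv_split _ _ 1 L)//; [|lra|lra].
have e1 : \int[mu]_(x in `[0, 1]) G (cabs (u x)) <= C * (1 - 0).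
  rewrite -Rintegral_cst_itv//; apply: le_Rintegral => //.
  exact: itg_cst_itv.
have e2 : \int[mu]_(x in `[1, L]) G (cabs (u x)) <= G s * (L - 1).
  rewrite -Rintegral_cst_itv; last by lra.
  apply: le_Rintegral => //; first exact: itg_cst_itv.
  move=> x xI; have /andP[x1 xL] : 1 <= x <= L by move: xI; rewrite /= in_itv.
  by rewrite uE plateau_eq1 ?mulr1// invr1 add0r.
have e3 : \int[mu]_(x in `[L, L + 1]) G (cabs (u x)) <= C * (L + 1 - L).
  rewrite -Rintegral_cst_itv; last by lra.
  by apply: le_Rintegral => //; exact: itg_cst_itv.
have E : G s * (L - 1) = - (2 * C) + G s by rewrite /L; field; rewrite lt_eqF.
rewrite E in e2; apply: le_lt_trans (lerD e1 (lerD e2 e3)) _.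
have -> : C * (1 - 0) + (- (2 * C) + G s + C * (L + 1 - L)) = G s by ring.
exact: Gs.
Qed.

Lemma negative_energy : exists u v, [/\ sobolev u v, 0 < mass u & en G u v < 0].
Proof.
have [u [v [uv pu]]] := negative_potential.
have [hu hv] := sobolev_L2 uv; have v0 := mass_ge0 v.
(* After stretching, the energy is (c^2 mass v / 2 + pot u) / c. Here c^2 <= c and c (mass v + 1) <=
   - pot u, where the summand 1 makes the result strictly negative. *)
pose c := Num.min 1 (- pot G u / (mass v + 1)).
have v1 : 0 < mass v + 1 by rewrite ltr_wpDl.
have c0 : 0 < c by rewrite lt_min ltr01 divr_gt0 ?oppr_gt0.
have c1 : c <= 1 by rewrite ge_min lexx.
have cv : c * (mass v + 1) <= - pot G u by rewrite -ler_pdivlMr// ge_min lexx orbT.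
exists (fun x => u (c * x + 0)), (fun x => Complex c 0 * v (c * x + 0)); split.
- exact: sobolev_rescale.
- rewrite mass_rescale// divr_gt0// lt_def mass_ge0 andbT; apply/eqP => u0.
  by have [L] := pot_ge_quad nl uv; rewrite u0 mulr0 leNgt pu.
- rewrite /en mass_rescale_deriv// (pot_rescale nl _ c0 uv).
  have -> : 2^-1 * (c * mass v) + pot G u / c = (2^-1 * (c * (c * mass v)) + pot G u) / c.
    by field; rewrite gt_eqF.
  rewrite pmulr_llt0 ?invr_gt0//.
  have cv0 : 0 <= c * mass v by rewrite mulr_ge0// ltW.
  have : c * (c * mass v) <= c * mass v by rewrite ler_piMl.
  rewrite mulrDr mulr1 in cv; move: cv cv0 c0; set q := c * mass v; lra.
Qed.

(** The threshold is the mass of one function of negative energy: stretching by c = mass u / l < 1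
    reaches mass [l], divides the potential energy by [c] and lowers the kinetic energy. *)
Lemma negative_energy_mass : exists2 l0 : R, 0 <= l0 & forall l, l0 < l ->
  exists u v, [/\ sobolev u v, mass u = l & en G u v < 0].
Proof.
have [u [v [uv u0 euv]]] := negative_energy; have [hu hv] := sobolev_L2 uv.
exists (mass u); first exact: ltW.
move=> l ul; have l0 := lt_trans u0 ul; pose c := mass u / l.
have c0 : 0 < c by rewrite divr_gt0.
have c1 : c <= 1 by rewrite ler_pdivrMr// mul1r ltW.
exists (fun x => u (c * x + 0)), (fun x => Complex c 0 * v (c * x + 0)); split.
- exact: sobolev_rescale.
- by rewrite mass_rescale// /c invf_div mulrC divfK// gt_eqF.
- rewrite /en mass_rescale_deriv// (pot_rescale nl _ c0 uv).
  have -> : 2^-1 * (c * mass v) + pot G u / c = (2^-1 * (c * (c * mass v)) + pot G u) / c.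
    by field; rewrite gt_eqF.
  rewrite pmulr_llt0 ?invr_gt0//; apply: le_lt_trans euv; rewrite lerD2r ler_wpM2l//.
  have cv : c * mass v <= mass v by rewrite ler_piMl ?mass_ge0.
  by apply: le_trans cv; rewrite ler_piMl// mulr_ge0 ?mass_ge0// ltW.
Qed.

End NegativeEnergy.

Lemma mass_triangle {R : realType} (u v w : R -> R[i]) (e : R) : L2 u -> L2 v -> L2 w ->
  mass (fun x => u x - v x) <= e / 4 -> mass (fun x => v x - w x) <= e / 4 ->
  mass (fun x => u x - w x) <= e.
Proof.
move=> hu hv hw h1 h2.
have -> : (fun x => u x - w x) = fun x => (u x - v x) + (v x - w x).
  by apply/funext => x; rewrite addrA subrK.
apply: le_trans (massD_le (L2B hu hv) (L2B hv hw)) _; exact: le_quarters h1 h2.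
Qed.

Lemma le_shift_half {R : realType} (a b l r d : R) :
  a <= l + r -> r <= d / 2 -> - (d / 2) <= a - b -> b <= l + d.
Proof. lra. Qed.

Section GroundStates.
Context {R : realType}.
Variables (G g : R -> R).
Hypothesis nl : nonlinearity G g.
Implicit Types (u v w z : R -> R[i]).
Local Notation N u := (H1_dot u u).
Local Notation wd := weak_derivative.

Lemma energyE u : energy G u = en G u (wd u). Proof. by []. Qed.

Lemma pot_ae u w : L2 u -> L2 w -> {ae mu, forall x, u x = w x} ->
  pot G u = pot G w.
Proof.
move=> hu hw uw; apply: ae_eq_Rintegral; [exact: (mfn_pot nl)|exact: (mfn_pot nl)|].
by apply: aeS uw => x ->.
Qed.

Lemma sobolev_energy u v : sobolev u v -> energy G u = en G u v.
Proof.
move=> uv; have [hu hv] := sobolev_L2 uv; have Hu := sobolev_H1 uv.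
by rewrite energyE /en (mass_ae (H1_L2' Hu) hv (sobolev_weak_derivative uv)).
Qed.

Lemma energy_representative u : H1 u -> exists w,
  [/\ sobolev w (wd u), {ae mu, forall x, w x = u x}, mass w = mass u &
      en G w (wd u) = energy G u].
Proof.
move=> Hu; have [w nw wu] := H1_sobolev Hu; have [hw _] := sobolev_L2 nw.
have hu := H1_L2 Hu; exists w; split => //; first exact: mass_ae.
by rewrite energyE /en (pot_ae hw hu wu).
Qed.

(** A solution attains its initial datum almost everywhere only, so mass and energy have to be
    carried from [phi 0] to the datum. *)
Lemma energy_ae u w : H1 u -> L2 w -> {ae mu, forall x, w x = u x} ->
  mass w = mass u /\ energy G w = energy G u.
Proof.
move=> Hu hw wu; have [r [nr ru mr <-]] := energy_representative Hu.
have rw : {ae mu, forall x, r x = w x} by apply: aeS (aeI ru wu) => x [-> ->].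
have [hr hd] := sobolev_L2 nr; have [Hw ew] := H1_ae nr hw rw.
rewrite energyE /en (mass_ae (H1_L2' Hw) hd ew) -(pot_ae hr hw rw).
by split => //; apply: mass_ae (H1_L2 Hu) wu.
Qed.

Variable lambda : R.
Hypothesis lambda0 : 0 < lambda.
Hypothesis neg : exists u v, [/\ sobolev u v, mass u = lambda & en G u v < 0].

Let levels : set R :=
  [set e | exists u v, [/\ sobolev u v, mass u = lambda & e = en G u v]].

Definition ground_level : R := inf levels.

Let levels_inf : has_inf levels.
Proof.
have [u [v [uv ul _]]] := neg; split; first by exists (en G u v), u, v.
have [C C0 hC] := en_coercive nl lambda0; exists (- C) => _ [u' [v' [n' l' ->]]].
have := hC u' v' n'; rewrite l' => /(_ (lexx _)); have := mass_ge0 v'.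
by move: (mass _) (en _ _ _) => a b; lra.
Qed.

Lemma ground_level_le u v : sobolev u v -> mass u = lambda -> ground_level <= en G u v.
Proof. by move=> uv ul; apply: ge_inf; [case: levels_inf|exists u, v]. Qed.

Lemma ground_level_lt0 : ground_level < 0.
Proof.
by have [u [v [uv ul]]] := neg; apply: le_lt_trans; exact: ground_level_le.
Qed.

Let close := minimizing_close nl lambda0 ground_level_le ground_level_lt0.

Lemma minimizer_exists : exists w wv,
  [/\ sobolev w wv, mass w = lambda & en G w wv = ground_level].
Proof.
have [d d0 hd] := close ltr01.
have [_ [u [v [uv ul ->]]] h] := inf_adherent d0 levels_inf.
by have [w [wv [h1 h2 h3 _ _]]] := hd u v uv ul (ltW h); exists w, wv.
Qed.

(** The infimum in [\bar R] of the definition equals the real infimum over Sobolev pairs: a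
    minimizing pair gives one inequality, the continuous representative of each competitor the
    other. *)
Lemma ground_states_E : ground_states G lambda =
  [set u | [/\ H1 u, mass u = lambda & energy G u = ground_level]].
Proof.
have infE : ereal_inf [set (energy G v)%:E | v in mass_sphere lambda] = ground_level%:E.
  apply/eqP; rewrite eq_le; apply/andP; split.
    have [w [wv [nw wl we]]] := minimizer_exists.
    apply: ereal_inf_lbound; exists w; last by rewrite (sobolev_energy nw) we.
    by split => //; exact: sobolev_H1 nw.
  apply: le_ereal_inf_tmp => _ [u [Hu ul] <-]; rewrite lee_fin.
  have [w [nw _ wl <-]] := energy_representative Hu.
  by apply: ground_level_le => //; rewrite wl.
apply/seteqP; split => u /=.
  by rewrite /ground_states/= infE => -[[Hu ul] [uE]]; split.
by rewrite /ground_states/= infE => -[Hu ul ->]; split.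
Qed.

(** Multiplication by s = sqrt(lambda / mass u) brings [u] onto the sphere of mass lambda. When the
    masses are close this moves the pair little, so the energy stays almost minimal and
    [minimizing_close] applies. *)
Lemma near_ground (e : R) : 0 < e -> exists2 d : R, 0 < d & forall u v, sobolev u v ->
  `|mass u - lambda| <= d -> en G u v <= ground_level + d ->
  exists w wv, [/\ sobolev w wv, mass w = lambda, en G w wv = ground_level,
    mass (fun x => u x - w x) <= e & mass (fun x => v x - wv x) <= e].
Proof.
move=> e0; have e4 : 0 < e / 4 by rewrite divr_gt0.
have [d1 d10 hd1] := close e4.
have l2 : 0 < 2 * lambda by rewrite mulr_gt0.
have [C C0 hC] := en_coercive nl l2.
pose K := 4 * (C + 1); have K0 : 0 <= K by rewrite mulr_ge0// addr_ge0.
pose D := 2 * lambda + 2 * K; have D0 : 0 <= D by apply: addr_ge0; [exact: ltW|exact: mulr_ge0].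
have d12 : 0 < d1 / 2 by rewrite divr_gt0.
have [d2 d20 hd2] := en_close nl D0 d12.
(* The normalization moves [u] by at most [r] and its derivative by at most r (2 K / lambda), in
   squared L^2 norm; [r * M] dominates both. *)
pose M := 1 + 2 * K / lambda.
have M1 : 0 <= 2 * K / lambda by apply: divr_ge0; [exact: mulr_ge0|exact: ltW].
have M0 : 0 < M by rewrite ltr_pwDl.
(* In order: half of the energy tolerance, the rest being left for the normalization; mass at least
   lambda / 2 and at most 2 lambda; energy at most 1, whence the bound [K]; and a small
   displacement. *)
pose r := Num.min (Num.min (d1 / 2) (lambda / 2)) (Num.min 1 (Num.min d2 (e / 4) / M)).
have m20 : 0 < Num.min d2 (e / 4) by rewrite lt_min d20.
have r0 : 0 < r by rewrite !(lt_min 0) d12 divr_gt0// ltr01 divr_gt0.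
have r1 : r <= d1 / 2 by rewrite !ge_min lexx.
have r2 : r <= lambda / 2 by rewrite !ge_min lexx !orbT.
have r3 : r <= 1 by rewrite !ge_min lexx !orbT.
have r4 : r * M <= Num.min d2 (e / 4).
  by rewrite -ler_pdivlMr// !ge_min lexx !orbT.
clearbody r; exists r => // u v uv ul uen; have [hu hv] := sobolev_L2 uv.
move: ul; rewrite ler_norml => /andP[ul1 ul2].
have u0 : lambda / 2 <= mass u by lra.
have um : 0 < mass u by lra.
have u2 : mass u <= 2 * lambda by have := lambda0; lra.
have vK : mass v <= K.
  have := hC u v uv u2; have := ground_level_lt0; rewrite /K; lra.
pose s := Num.sqrt (lambda / mass u).
have s2 : s ^+ 2 = lambda / mass u by rewrite sqr_sqrtr// divr_ge0// ltW.
have s0 : 0 <= s := sqrtr_ge0 _.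
have ny := sobolevZ (Complex s 0) uv.
have cs : cabs (Complex s 0) ^+ 2 = s ^+ 2 by rewrite cabs_sqr/= expr0n addr0.
set y := (fun x => Complex s 0 * u x) in ny; set yv := (fun x => _) in ny.
have my : mass y = lambda by rewrite massZ// cs s2 divfK// gt_eqF.
have s22 : s ^+ 2 <= 2 by rewrite s2 ler_pdivrMr// -ler_pdivrMl// mulrC.
have myv : mass yv <= 2 * K.
  by rewrite massZ// cs; apply: ler_pM => //; [exact: sqr_ge0|exact: mass_ge0].
(* As s >= 0, (s - 1)^2 <= |s - 1| (s + 1) = |s^2 - 1|, and |s^2 - 1| mass u is the difference
   between the masses. *)
have s1 : (s - 1) ^+ 2 * mass u <= r.
  have : (s - 1) ^+ 2 <= `|s ^+ 2 - 1|.
    have -> : s ^+ 2 - 1 = (s - 1) * (s + 1) by ring.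
    rewrite normrM -real_normK ?num_real// expr2 ler_wpM2l//.
    rewrite [`|s + 1|]ger0_norm ?addr_ge0//; apply: le_trans (ler_normB _ _) _.
    by rewrite normr1 ger0_norm.
  move=> h; apply: (@le_trans _ _ (`|s ^+ 2 - 1| * mass u)).
    by rewrite ler_wpM2r// ltW.
  rewrite -[X in _ * X]gtr0_norm// -normrM s2 mulrBl mul1r divfK ?gt_eqF//.
  by rewrite distrC ler_norml ul1.
have dist (p : R -> R[i]) : L2 p ->
    mass (fun x => p x - Complex s 0 * p x) = (s - 1) ^+ 2 * mass p.
  move=> hp; have -> : (fun x => p x - Complex s 0 * p x) =
      fun x => Complex (1 - s) 0 * p x.
    by apply/funext => x; apply: complex_ext; rewrite ?(ReB, ImB) ?(ReM, ImM)/=; ring.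
  by rewrite massZ// cabs_sqr/= expr0n addr0 -sqrrN opprB.
have dy : mass (fun x => u x - y x) <= Num.min d2 (e / 4).
  rewrite dist//; apply: le_trans s1 (le_trans _ r4).
  by rewrite ler_peMr ?(ltW r0)// lerDl.
have dyv : mass (fun x => v x - yv x) <= Num.min d2 (e / 4).
  rewrite dist//; apply: le_trans r4.
  apply: (@le_trans _ _ ((r / (lambda / 2)) * K)).
    apply: ler_pM => //; [exact: sqr_ge0|exact: mass_ge0|].
    rewrite ler_pdivlMr ?divr_gt0//; apply: le_trans s1.
    by rewrite ler_wpM2l ?sqr_ge0.
  rewrite /M mulrDr mulr1; apply: (@le_trans _ _ (r * (2 * K / lambda))).
    by apply: eq_ler; field; rewrite gt_eqF.
  by rewrite lerDr ltW.
move: dy dyv; rewrite !le_min => /andP[y1 y2] /andP[v1 v2].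
have uD : mass u + mass v <= D 
  by apply: lerD => //; apply: le_trans vK _; rewrite ler_peMl// ler1n.
have yD : mass y + mass yv <= D.
  by rewrite my; apply: lerD myv; rewrite ler_peMl ?(ltW lambda0)// ler1n.
have [_] := hd2 u v y yv uv ny uD yD y1 v1; rewrite ler_norml => /andP[e1 e2].
have ye := le_shift_half uen r1 e1.
have [w [wv [nw mw ew w1 w2]]] := hd1 y yv ny my ye.
exists w, wv; split => //.
- have [hy _] := sobolev_L2 ny; have [hw _] := sobolev_L2 nw.
  exact: mass_triangle hu hy hw y2 w1.
- have [_ hy] := sobolev_L2 ny; have [_ hw] := sobolev_L2 nw.
  exact: mass_triangle hv hy hw v2 w2.
Qed.

End GroundStates.

(** * Orbital stability *)

Section Stability.
Context {R : realType}.
Variables (G g : R -> R) (f : R[i] -> R[i]) (lambda : R).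
Hypothesis nl : nonlinearity G g.
Hypothesis g_cont : continuous g.
Hypothesis fE : forall z, f z = Complex (g (cabs z) / cabs z) 0 * z.
Hypothesis f_wp : globally_well_posed f.
Hypothesis lambda0 : 0 < lambda.
Hypothesis neg : exists u v, [/\ sobolev u v, mass u = lambda & en G u v < 0].
Implicit Types (u v w z q : R -> R[i]).
Local Notation N u := (H1_dot u u).
Local Notation wd := weak_derivative.
Local Notation level := (ground_level G lambda).
Local Notation S := (ground_states G lambda).

Lemma near_ground_states (e : R) : 0 < e -> exists2 d : R, 0 < d & forall z, H1 z ->
  `|mass z - lambda| <= d -> energy G z <= level + d ->
  exists2 w, S w & N (fun x => z x - w x) <= e.
Proof.
move=> e0; have e2 : 0 < e / 2 by rewrite divr_gt0.
have [d d0 hd] := near_ground nl lambda0 neg e2; exists d => // z Hz.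
have [r [nr rz mr er]] := energy_representative nl Hz; rewrite -mr -er => h1 h2.
have [w [wv [nw mw ew w1 w2]]] := hd r _ nr h1 h2.
have Hw := sobolev_H1 nw; exists w.
  by rewrite (ground_states_E nl lambda0 neg); split => //; rewrite (sobolev_energy G nw).
have lz := H1_L2 Hz; have lz' := H1_L2' Hz; have lw := H1_L2 Hw; have lw' := H1_L2' Hw.
have [lr _] := sobolev_L2 nr; have [_ lwv] := sobolev_L2 nw.
rewrite H1_dotB// (_ : e = e / 2 + e / 2); last by field.
apply: lerD.
  rewrite (mass_ae (L2B lz lw) (L2B lr lw))//.
  by apply: aeS rz => x ->.
rewrite (mass_ae (L2B lz' lw') (L2B lz' lwv))//.
by apply: aeS (sobolev_weak_derivative nw) => x ->.
Qed.

Lemma ground_states_bounded : exists2 D : R, 0 <= D & forall q, S q -> N q <= D.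
Proof.
have [C C0 hC] := en_coercive nl lambda0.
exists (lambda + 4 * C); first by apply: addr_ge0; [exact: ltW|exact: mulr_ge0].
move=> q; rewrite (ground_states_E nl lambda0 neg) => -[Hq mq eq].
have [r [nr rq mr er]] := energy_representative nl Hq.
have := hC _ _ nr; rewrite mr er mq eq H1_dotE mq lerD2l => /(_ (lexx _)).
have := ground_level_lt0 nl lambda0 neg; move: (mass _) level => a b; lra.
Qed.

Lemma near_ground_mass_energy (e : R) : 0 < e -> exists2 d : R, 0 < d & forall u q,
  H1 u -> S q -> N (fun x => u x - q x) <= d ->
  `|mass u - lambda| <= e /\ `|energy G u - level| <= e.
Proof.
move=> e0; have [D D0 hD] := ground_states_bounded.
pose D1 := 2 + 2 * D; have D10 : 0 <= D1 by rewrite addr_ge0// mulr_ge0.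
have [d d0 hd] := en_close nl D10 e0.
exists (Num.min 1 d); first by rewrite lt_min ltr01.
move=> u q Hu Sq; rewrite le_min => /andP[n1 nd].
have qD := hD q Sq; move: Sq; rewrite (ground_states_E nl lambda0 neg) => -[Hq mq eq].
have [ru [nu ruu mu1 eu]] := energy_representative nl Hu.
have [rq [nq rqq mq1 eq1]] := energy_representative nl Hq.
have uD : N u <= D1.
  apply: le_trans (H1_dot_le_shift Hu Hq) _.
  by apply: lerD; [rewrite -[leRHS]mulr1 ler_wpM2l|rewrite ler_wpM2l].
have qD1 : N q <= D1.
  by apply: le_trans qD _; apply: (@le_trans _ _ (2 * D)); rewrite ?lerDr// ler_peMl// ler1n.
have lu := H1_L2 Hu; have lq := H1_L2 Hq.
have [lru _] := sobolev_L2 nu; have [lrq _] := sobolev_L2 nq.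
rewrite -eu -eq -eq1 -mq -mq1 -mu1; apply: (hd _ _ _ _ nu nq).
- rewrite mu1 -H1_dotE; exact: uD.
- rewrite mq1 -H1_dotE; exact: qD1.
- rewrite (mass_ae (L2B lru lrq) (L2B lu lq)); last by apply: aeS (aeI ruu rqq) => x [-> ->].
  by apply: le_trans nd; rewrite H1_dotB// lerDl mass_ge0.
- by apply: le_trans nd; rewrite H1_dotB// lerDr mass_ge0.
Qed.

Lemma flow_solution u : H1 u -> exists2 phi, is_solution f u phi &
  forall t, flow f t u = phi t.
Proof.
move=> Hu; pose phi := xget (fun _ _ => 0) [set phi | is_solution f u phi].
exists phi => //; have [psi hpsi _] := f_wp Hu.
by apply: (@xgetPex _ (fun _ _ => 0) [set phi | is_solution f u phi]); exists psi.
Qed.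

(** Closeness to the set makes mass and energy almost those of ground states. Both are conserved,
    and at any later time [near_ground_states] converts them back into closeness. *)
Lemma ground_states_stable : stable f S.
Proof.
move=> eps eps0; have e0 : 0 < eps ^+ 2 / 2 by rewrite divr_gt0// exprn_gt0.
have [d d0 hd] := near_ground_states e0.
have [r r0 hr] := near_ground_mass_energy d0.
(* A distance below 1 dominates its own square, so the squared distance is at most [r]. *)
exists (Num.min 1 r); first by rewrite lt_min ltr01.
move=> u Hu /ereal_inf_lt[_ [q Sq <-]]; rewrite lte_fin lt_min => /andP[q1 qr] t t0.
have un : N (fun x => u x - q x) <= r.
  rewrite -[leLHS](sqr_sqrtr (H1_dot_ge0 _)) expr2; apply: le_trans (ltW qr).
  by rewrite ler_piMr ?sqrtr_ge0// ltW.
have [mu1 eu] := hr u q Hu Sq un.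
have [phi sol ->] := flow_solution Hu.
have [phiH _ phi0 _] := sol.
have [m0 en0] := energy_ae nl Hu (H1_L2 (phiH 0 (lexx 0))) phi0.
have mt := flow_mass nl g_cont fE sol t0; have et := flow_energy nl g_cont fE sol t0.
rewrite m0 in mt; rewrite en0 in et.
have [w Sw wN] : exists2 w, S w & N (fun x => phi t x - w x) <= eps ^+ 2 / 2.
  apply: hd; [exact: phiH|by rewrite mt|rewrite et].
  by move: eu; rewrite ler_norml => /andP[_]; rewrite lerBlDl.
apply: (@le_lt_trans _ _ (H1_dist (phi t) w)%:E).
  by apply: ereal_inf_lbound; exists w.
rewrite lte_fin /H1_dist -[ltRHS]ger0_norm ?(ltW eps0)// -sqrtr_sqr ltr_sqrt ?exprn_gt0//.
by apply: le_lt_trans wN _; rewrite ltr_pdivrMr// ltr_pMr ?exprn_gt0// ltr1n.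
Qed.

End Stability.

(** * Radial nonlinearities *)

Section Radial.
Context {R : realType}.
Variables (f : R[i] -> R[i]) (G : R -> R).
Hypothesis f_C1 : C1_real f.
Hypothesis f_conj : forall s : R[i], f (conjc s) = conjc (f s).
Hypothesis f_rot : forall s z : R[i], cabs z = 1 -> f (z * s) = z * f s.
Hypothesis G_prim : is_primitive0 G (restr_real f).
Let g := restr_real f.

Lemma cabs_unit (a b : R) : a ^+ 2 + b ^+ 2 = 1 -> cabs (Complex a b) = 1.
Proof. by move=> /= ->; rewrite sqrtr1. Qed.

Lemma f_odd (z : R[i]) : f (- z) = - f z.
Proof.
have : cabs (- 1 : R[i]) = 1 by apply: cabs_unit; ring.
by move=> /(f_rot z); rewrite !mulN1r.
Qed.

Lemma f_zero : f 0 = 0.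
Proof.
have := f_odd 0; rewrite oppr0 => f0; apply: complex_ext.
  by have := congr1 (@Re R) f0; case: (f 0) => a b /= h; lra.
by have := congr1 (@Im R) f0; case: (f 0) => a b /= h; lra.
Qed.

Lemma f_real (s : R) : f (Complex s 0) = Complex (g s) 0.
Proof.
have := f_conj (Complex s 0); rewrite /= oppr0 /g /restr_real.
by case: (f _) => a b [] h /=; congr Complex; lra.
Qed.

(** Writing [z] as a unit complex number times |z| takes the rotation out of [f], and on the real
    line [f] is real by conjugation symmetry. At 0 both sides vanish. *)
Lemma f_radial (z : R[i]) : f z = Complex (g (cabs z) / cabs z) 0 * z.
Proof.
have [->|z0] := eqVneq z 0; first by rewrite f_zero mulr0.
have sz := cabs_sqr z.
have r0 : cabs z != 0.
  apply: contra z0 => /eqP r0; rewrite r0 expr0n/= in sz.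
  have a0 := sqr_ge0 (Re z); have b0 := sqr_ge0 (Im z).
  have /eqP : Re z ^+ 2 = 0 by lra.
  have /eqP : Im z ^+ 2 = 0 by lra.
  rewrite !sqrf_eq0 => /eqP h1 /eqP h2; apply/eqP; exact: complex_ext.
pose om := Complex (Re z / cabs z) (Im z / cabs z).
have omu : cabs om = 1.
  apply: cabs_unit; rewrite !expr_div_n -mulrDl -sz divff//.
  by rewrite sqrf_eq0.
have zE : z = om * Complex (cabs z) 0.
  by apply: complex_ext; rewrite ?ReM ?ImM /=; field.
rewrite [in LHS]zE f_rot// f_real.
by apply: complex_ext; rewrite ?ReM ?ImM /=; field.
Qed.

Lemma g_odd (s : R) : g (- s) = - g s.
Proof.
have := f_odd (Complex s 0); have -> : - Complex s 0 = Complex (- s) 0.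
  by apply: complex_ext; rewrite /= ?oppr0.
by rewrite !f_real => /(congr1 (@Re R)).
Qed.

Lemma g_zero : g 0 = 0.
Proof. by have := g_odd 0; rewrite oppr0 => h; lra. Qed.

Let dG (s : R) : is_derive s 1 G (g s). Proof. by case: G_prim. Qed.

Lemma G_even (s : R) : G (- s) = G s.
Proof.
wlog s0 : s / 0 <= s.
  move=> H; have [/H//|/ltW s0] := leP 0 s.
  by have := H (- s); rewrite opprK oppr_ge0 => /(_ s0) ->.
have dH (x : R) : is_derive x 1 (fun y => G y - G (- y)) 0.
  have d2 : is_derive x 1 (fun y => G (- y)) (- g (- x)).
    apply/is_deriveP => e e0; have /is_deriveP/(_ e e0)[d d0 hd] := dG (- x).
    exists d => // h hd'; have := hd (- h); rewrite normrN => /(_ hd').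
    by rewrite opprD mulrN mulNr.
  have := is_deriveB (dG x) d2; rewrite g_odd opprK subrr; exact.
have [c _ ] := MVT_all s0 dH; rewrite mul0r oppr0 !subrr subr0 => /eqP.
by rewrite subr_eq0 => /eqP ->.
Qed.

Lemma fst_cvg (T : Type) (F : set_system T) (h : T -> R * R) (p : R * R) :
  Filter F -> h x @[x --> F] --> p -> (h x).1 @[x --> F] --> p.1.
Proof. by move=> FF hp; apply: (cvg_comp _ _ hp); exact: cvg_fst. Qed.

Lemma g_C1 : exists2 dg : R -> R, continuous dg & forall s : R, is_derive s 1 g (dg s).
Proof.
have [fd fc] := f_C1; exists (fun s => ('d (as_real_map f) (s, 0) (1, 0)).1).
  move=> s; have c1 : (fun s : R => (s, 0 : R)) @ s --> (s, 0 : R).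
    exact: (cvg_pair (F := nbhs s) (G := nbhs s) (H := nbhs (0 : R)) cvg_id (cvg_cst _)).
  have c2 := cvg_comp _ _ c1 (fc (1, 0) (s, 0)).
  exact: (fst_cvg _ c2).
move=> s; have := @diff_derivable R _ _ (as_real_map f) (s, 0) (1, 0) (fd (s, 0)); rewrite /derivable.
move=> /cvg_ex[l hl]; have lE : 'd (as_real_map f) (s, 0) (1, 0) = l.
  by rewrite -deriveE//; apply/cvg_lim.
rewrite lE; have := fst_cvg _ hl.
have -> : (fun h : R => (h^-1 *: ((as_real_map f \o shift (s, 0)) (h *: (1, 0)) -
    as_real_map f (s, 0))).1) = fun h => h^-1 *: ((g \o shift s) (h *: 1) - g s).
  apply/funext => h /=; rewrite /g /restr_real /as_real_map /=.
  by rewrite scaler0 add0r.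
move=> gl; have dg : derivable g s 1 by apply/cvg_ex; exists l.1; exact: gl.
have -> : l.1 = 'D_1 g s by apply/esym/cvg_lim => //; exact: gl.
exact: derivableP.
Qed.

Lemma g_continuous : continuous g.
Proof.
have [dg _ h] := g_C1; move=> s.
by apply/differentiable_continuous/derivable1_diffP; case: (h s).
Qed.

Lemma g_lipschitz (B : R) : 0 <= B -> exists2 L : R, 0 <= L & forall x y,
  0 <= x <= B -> 0 <= y <= B -> `|g x - g y| <= L * `|x - y|.
Proof.
move=> B0; have [dg cdg hdg] := g_C1.
have [L L0 hL] := @continuous_bounded_itv R dg 0 B cdg; exists L; first exact: ltW.
move=> x y; wlog yx : x y / y <= x.
  move=> H xB yB; have [/H|/ltW/H] := leP y x; first exact.
  by rewrite distrC [`|y - x|]distrC; apply.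
move=> /andP[x0 xB] /andP[y0 yB]; have [c /andP[yc cx] ->] := MVT_all yx hdg.
by rewrite normrM ler_wpM2r// hL//; [exact: le_trans yc|exact: le_trans xB].
Qed.

Hypothesis G1 : exists s0 : R, G s0 < 0.
Hypothesis G2 : exists C p q pstar sstar : R,
    [/\ 0 < C, 2 < pstar < 6, 2 < p <= q,
        forall s : R, `|derive1 G s| <= C * (`|s| `^ (p - 1) + `|s| `^ (q - 1)) &
        forall s : R, sstar <= s -> - C * `|s| `^ (pstar - 1) <= derive1 G s].

Lemma derive1_G (s : R) : derive1 G s = g s.
Proof. by rewrite derive1E; case: (dG s). Qed.

Lemma G_zero : G 0 = 0. Proof. by case: G_prim. Qed.

Lemma G_small (e : R) : 0 < e -> exists2 d : R, 0 < d &
  forall s, 0 <= s <= d -> `|G s| <= e * s ^+ 2.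
Proof.
have [C [p [q [_ [_ [C0 _ /andP[p2 pq] hg _]]]]]] := G2; move=> e0.
have e1 : 0 < e / (2 * C) by rewrite divr_gt0// mulr_gt0.
have p0 : 0 < p - 2 by rewrite subr_gt0.
(* Up to [d], the power c^(q-1) is at most c^(p-1) because c <= 1, and c^(p-2) is at most e / (2 C);
   together they give |g c| <= e c. *)
pose d := Num.min 1 ((e / (2 * C)) `^ (p - 2)^-1).
have d0 : 0 < d by rewrite lt_min ltr01 powR_gt0.
exists d => // s /andP[s0 sd]; have s1 : s <= 1 by apply: le_trans sd _; rewrite ge_min lexx.
have [c /andP[c0 cs]] := MVT_all s0 dG; rewrite G_zero !subr0 => ->.
have sq : 0 <= e * c by rewrite mulr_ge0// ltW.
rewrite normrM [`|s|]ger0_norm// expr2 mulrA ler_wpM2r//.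
apply: (@le_trans _ _ (e * c)); last by rewrite ler_pM2l.
move: c0; rewrite le_eqVlt => /predU1P[<-|c0]; first by rewrite g_zero normr0 mulr0.
have cd : c <= d by exact: le_trans cs sd.
have c1 : c <= 1 by exact: le_trans cs s1.
have := hg c; rewrite derive1_G [`|c|]gtr0_norm// => h; apply: le_trans h _.
have cq : c `^ (q - 1) <= c `^ (p - 1) by apply: ger_powR; rewrite ?c0// lerD2r.
have cp : c `^ (p - 1) = c * c `^ (p - 2).
  have -> : p - 1 = 1 + (p - 2) by ring.
  by rewrite (@powRD _ c 1) ?powRr1 ?(ltW c0)//; apply/implyP => _; rewrite gt_eqF.
have ce : c `^ (p - 2) <= e / (2 * C).
  have -> : e / (2 * C) = ((e / (2 * C)) `^ (p - 2)^-1) `^ (p - 2).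
    by rewrite -powRrM mulVf ?gt_eqF// powRr1// ltW.
  apply: ge0_ler_powR; rewrite ?nnegrE ?powR_ge0 ?(ltW p0) ?(ltW c0)//.
  by apply: le_trans cd _; rewrite ge_min lexx orbT.
apply: (@le_trans _ _ (C * (2 * c `^ (p - 1)))).
  by rewrite ler_pM2l// mulr_natl mulr2n lerD2l.
rewrite cp; apply: (@le_trans _ _ (C * (2 * (c * (e / (2 * C)))))).
  by rewrite !ler_pM2l.
by apply: eq_ler; field; rewrite gt_eqF.
Qed.

Lemma G_quadratic (B : R) : 0 <= B -> exists2 L : R, 0 <= L &
  forall s, 0 <= s <= B -> `|G s| <= L * s ^+ 2.
Proof.
move=> B0; have [L L0 hL] := g_lipschitz B0; exists L => // s /andP[s0 sB].
have [c /andP[c0 cs]] := MVT_all s0 dG; rewrite G_zero !subr0 => ->.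
rewrite normrM [`|s|]ger0_norm// expr2 mulrA ler_wpM2r//.
have := hL c 0; rewrite c0 lexx B0 (le_trans cs sB) g_zero !subr0 => /(_ isT isT) h.
by apply: le_trans h _; rewrite ger0_norm// ler_wpM2l.
Qed.

(** Up to [S] the quadratic bound suffices. Beyond it the one-sided bound on the derivative
    integrates to G s - G S >= -C s^p, where p now stands for p_*, and since p < 6 this power is
    split between s^2 and a small multiple of s^6. *)
Lemma G_low (e : R) : 0 < e -> exists2 K : R, 0 <= K &
  forall s, 0 <= s -> - K * s ^+ 2 - e * s ^+ 6 <= G s.
Proof.
have [C [_ [_ [p [S0 [C0 /andP[p2 p6] _ _ hg]]]]]] := G2; move=> e0.
pose S := Num.max S0 1.
have S1 : 1 <= S by rewrite le_max lexx orbT.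
have SS : S0 <= S by rewrite le_max lexx.
have Sp : 0 <= S by exact: le_trans S1.
have [L L0 hL] := G_quadratic Sp.
have p60 : 0 < 6 - p by rewrite subr_gt0.
(* The splitting point: for s >= T one has s^(6-p) >= C / e, so C s^p <= e s^6; for 1 <= s <= T, C
   s^p is at most C T^p s^2. *)
pose T := Num.max 1 ((C / e) `^ (6 - p)^-1).
have T1 : 1 <= T by rewrite le_max lexx.
have T0 : 0 < T by exact: lt_le_trans T1.
have TC : 0 <= C * T `^ p by rewrite mulr_ge0 ?powR_ge0// ltW.
have pp : 0 < p by lra.
exists (L + C * T `^ p); first exact: addr_ge0.
move=> s s0; have s20 := sqr_ge0 s; have s60 : 0 <= e * s ^+ 6.
  by rewrite mulr_ge0 ?exprn_ge0// ltW.
have [sS|Ss] := leP s S.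
  have := hL s; rewrite s0 sS => /(_ isT); rewrite ler_norml => /andP[h _].
  have : 0 <= C * T `^ p * s ^+ 2 by exact: mulr_ge0.
  rewrite mulNr mulrDl; lra.
have {}s0 : 0 < s by exact: le_lt_trans Ss.
have s1 : 1 <= s by apply: le_trans S1 (ltW Ss).
have [c /andP[Sc cs] E] := MVT_all (ltW Ss) dG.
have c0 : 0 < c by apply: lt_le_trans Sc; exact: lt_le_trans S1.
have hc := hg c (le_trans SS Sc); rewrite derive1_G gtr0_norm// in hc.
have cp : c `^ (p - 1) <= s `^ (p - 1).
  by apply: ge0_ler_powR; rewrite ?nnegrE ?(ltW c0) ?(ltW s0)//; lra.
have low : - (C * s `^ p) <= G s - G S.
  rewrite E -(mulr_powRB1 (ltW s0) pp); apply: (@le_trans _ _ (- C * c `^ (p - 1) * (s - S))).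
    rewrite !mulNr lerN2 [s * _]mulrC mulrA.
    by apply: ler_pM; rewrite ?mulr_ge0 ?powR_ge0 ?subr_ge0 ?(ltW C0) ?(ltW Ss) ?ler_pM2l ?gerBl.
  by rewrite ler_wpM2r// subr_ge0 ltW.
have lowS : - (L * s ^+ 2) <= G S.
  have := hL S; rewrite Sp lexx => /(_ isT); rewrite ler_norml => /andP[h _].
  apply: le_trans h; rewrite lerN2 ler_wpM2l// lerXn2r ?nnegrE//; exact: ltW.
suff : C * s `^ p <= C * T `^ p * s ^+ 2 + e * s ^+ 6.
  by rewrite mulNr mulrDl; move: low lowS; lra.
have [sT|Ts] := leP s T.
  apply: (@le_trans _ _ (C * T `^ p * s ^+ 2)); last by rewrite lerDl.
  apply: (@le_trans _ _ (C * T `^ p)); last by rewrite ler_peMr// exprn_ege1.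
  by rewrite ler_pM2l//; apply: ge0_ler_powR; rewrite ?nnegrE ?(ltW s0) ?(ltW T0) ?(ltW pp).
apply: (@le_trans _ _ (e * s ^+ 6)); last by rewrite lerDr mulr_ge0.
have -> : s ^+ 6 = s `^ p * s `^ (6 - p).
  rewrite -powRD; last by apply/implyP => _; rewrite gt_eqF.
  by rewrite addrC subrK powR_mulrn// ltW.
rewrite mulrA [e * _]mulrC -mulrA mulrC ler_wpM2l ?powR_ge0//.
rewrite -ler_pdivrMl// mulrC.
have -> : C / e = ((C / e) `^ (6 - p)^-1) `^ (6 - p).
  by rewrite -powRrM mulVf ?gt_eqF// powRr1// divr_ge0 ?ltW.
apply: ge0_ler_powR; rewrite ?nnegrE ?powR_ge0 ?(ltW p60) ?(ltW s0)//.
by apply: le_trans (ltW Ts); rewrite le_max lexx orbT.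
Qed.

Lemma radial_nonlinearity : nonlinearity G g.
Proof.
split.
- exact: dG.
- exact: G_zero.
- exact: g_zero.
- exact: g_lipschitz.
- exact: G_small.
- exact: G_low.
- have [s Gs] := G1; have [s0|/ltW s0] := leP 0 s; first by exists s.
  by exists (- s); rewrite ?oppr_ge0// G_even.
Qed.

End Radial.

Theorem theorem1 (R : realType) (f : R[i] -> R[i]) (G : R -> R)
  (f_C1 : C1_real f)
  (f_conj : forall s : R[i], f (conjc s) = conjc (f s))
  (f_rot : forall s z : R[i], cabs z = 1 -> f (z * s) = z * f s)
  (G_prim : is_primitive0 G (restr_real f))
  (f_wp : globally_well_posed f)
  (G1 : exists s0 : R, G s0 < 0)
  (G2 : exists C p q pstar sstar : R,
    [/\ 0 < C, 2 < pstar < 6, 2 < p <= q,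
        forall s : R, `|derive1 G s| <= C * (`|s| `^ (p - 1) + `|s| `^ (q - 1)) &
        forall s : R, sstar <= s -> - C * `|s| `^ (pstar - 1) <= derive1 G s]) :
  exists2 lambda_star : R, 0 <= lambda_star &
    forall lambda : R, lambda_star < lambda ->
      ground_states G lambda !=set0 /\ stable f (ground_states G lambda).
Proof.
have nl := radial_nonlinearity f_C1 f_conj f_rot G_prim G1 G2.
have gc := g_continuous f_C1; have fE := f_radial f_conj f_rot.
have [l0 l00 hl] := negative_energy_mass nl; exists l0 => // lambda ll.
have lambda0 : 0 < lambda by exact: le_lt_trans ll.
have neg := hl lambda ll; split; last exact: ground_states_stable nl gc fE f_wp lambda0 neg.
have [w [wv [nw mw ew]]] := minimizer_exists nl lambda0 neg.
exists w; rewrite (ground_states_E nl lambda0 neg); split => //.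
  exact: sobolev_H1 nw.
by rewrite (sobolev_energy G nw).
Qed.
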